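(* Consider the two-time-scale stochastic approximation iteration $$x_{t+1}=x_t-\alpha_t\,(F(x_t,y_t)+\xi_t),\qquad y_{t+1}=y_t-\beta_t\,(G(x_t,y_t)+\psi_t),\qquad t\ge 0,$$ and suppose that the hypotheses (A1) Lipschitz conditions of $F$ and $H$, (A2) nested Lipschitz condition of $G$, (A3) star-type strong monotonicity, (A4) uniform local linearity of $H$ with exponent $\delta_H\in[0.5,1]$, (A5) nested local linearity with exponents $\delta_F,\delta_G\in(0,1]$, (A6) noise conditions, and (A7) step-size conditions, all stated in the context, hold. Let $\hat x_t=x_t-H(y_t)$ and $\hat y_t=y_t-y^\star$. Then there are constants $\mathcal M_x,\mathcal M_{xy,1},\mathcal M_{xy,2},\mathcal M_{y,1},\mathcal M_{y,2},\mathcal M_{y,3}\ge 0$, not depending on $t$ (they depend only on $d_x,d_y$, the constants appearing in (A1)--(A7), the initial errors $\hat x_0,\hat y_0$, and $\sup_{t\ge0}\alpha_t^{-2}\prod_{\tau=0}^t(1-\mu_G\beta_\tau/4)<\infty$), such that for all $t\ge 0$, $$\mathbb E\|\hat x_{t+1}\|^2\le \mathcal M_x\,\alpha_t,$$ $$\|\mathbb E\,\hat x_{t+1}\hat y_{t+1}^\top\|\le \mathcal M_{xy,1}\,\beta_t+\mathcal M_{xy,2}\,\alpha_t\beta_t\Big(\frac{\alpha_t}{\beta_t}\Big)^{2/\delta_F},$$ $$\mathbb E\|\hat y_{t+1}\|^2\le \mathcal M_{y,1}\,\beta_t+\mathcal M_{y,2}\,\alpha_t\beta_t\Big(\frac{\alpha_t}{\beta_t}\Big)^{2/\delta_F}+\mathcal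 M_{y,3}\,\alpha_t\beta_t\Big(\frac{\alpha_t}{\beta_t}\Big)^{1/\delta_G}.$$
   Context: Notation: $\|\cdot\|$ is the Euclidean norm of vectors and the spectral norm of matrices; $a\wedge b=\min\{a,b\}$, $a\vee b=\max\{a,b\}$. $F:\mathbb R^{d_x}\times\mathbb R^{d_y}\to\mathbb R^{d_x}$ and $G:\mathbb R^{d_x}\times\mathbb R^{d_y}\to\mathbb R^{d_y}$ are (Borel measurable) maps; $x_0\in\mathbb R^{d_x}$, $y_0\in\mathbb R^{d_y}$ are arbitrary initial points; $\alpha_t,\beta_t>0$ are step sizes; $\xi_t\in\mathbb R^{d_x},\psi_t\in\mathbb R^{d_y}$ are random noise vectors; $\mathcal F_t=\sigma\{x_0,y_0,\xi_0,\psi_0,\dots,\xi_{t-1},\psi_{t-1}\}$. (A1) For every $y$ the equation $F(x,y)=0$ has a unique solution $x=H(y)$, defining $H:\mathbb R^{d_y}\to\mathbb R^{d_x}$, and there are constants $L_H,L_F>0$ with $\|H(y_1)-H(y_2)\|\le L_H\|y_1-y_2\|$ and $\|F(x,y_1)-F(H(y_1),y_1)\|\le L_F\|x-H(y_1)\|$ for all $x,y_1,y_2$. (A2) The equation $G(H(y),y)=0$ has a unique solution $y^\star$ (and $x^\star:=H(y^\star)$), and there are constants $L_{G,x},L_{G,y}>0$ with $\|G(x,y)-G(H(y),y)\|\le L_{G,x}\|x-H(y)\|$ and $\|G(H(y),y)-G(H(y^\star),y^\star)\|\le L_{G,y}\|y-y^\star\|$ for all $x,y$. (A3) There are constants $\mu_F,\mu_G>0$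 with $\langle x-H(y),F(x,y)-F(H(y),y)\rangle\ge\mu_F\|x-H(y)\|^2$ and $\langle y-y^\star,G(H(y),y)-G(H(y^\star),y^\star)\rangle\ge\mu_G\|y-y^\star\|^2$ for all $x,y$. (A4) $H$ is differentiable and there are $S_H\ge0$, $\delta_H\in[0.5,1]$ with $\|H(y_1)-H(y_2)-\nabla H(y_2)(y_1-y_2)\|\le S_H\|y_1-y_2\|^{1+\delta_H}$ for all $y_1,y_2$. (A5) There are matrices $B_1,B_2,B_3$ of compatible dimensions, constants $S_{B,F},S_{B,G}\ge0$ and $\delta_F,\delta_G\in(0,1]$ such that for all $x,y$: $\|F(x,y)-B_1(x-H(y))\|\le S_{B,F}(\|x-H(y)\|^{1+\delta_F}+\|y-y^\star\|^{1+\delta_F})$ and $\|G(x,y)-B_2(x-H(y))-B_3(y-y^\star)\|\le S_{B,G}(\|x-H(y)\|^{1+\delta_G}+\|y-y^\star\|^{1+\delta_G})$. (A6) For all $t\ge0$: $\mathbb E[\xi_t|\mathcal F_t]=0$, $\mathbb E[\psi_t|\mathcal F_t]=0$, $\mathbb E[\|\xi_t\|^4|\mathcal F_t]\le\Gamma_{11}^2$, $\mathbb E[\|\psi_t\|^4|\mathcal F_t]\le\Gamma_{22}^2$, $\|\mathbb E[\xi_t\xi_t^\top|\mathcal F_t]\|\le\Sigma_{11}$, $\|\mathbb E[\psi_t\psi_t^\top|\mathcal F_t]\|\le\Sigma_{22}$, $\|\mathbb E[\xi_t\psi_t^\top|\mathcal F_t]\|\le\Sigma_{12}$. (A7) (i)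 For all $t$, $\alpha_t\le\iota_1$, $\beta_t\le\iota_2$, $\beta_t/\alpha_t\le\kappa$, $\beta_t^2/\alpha_t\le\rho$, where $\iota_1=\frac{\mu_F}{4L_F^2}\wedge\frac1{12\mu_F}$, $\iota_2=\frac{\mu_G}{L_{G,y}^2}\wedge\frac1{14\mu_G}$, $\kappa=\frac{\mu_F\mu_G}{(28d_x\vee200L_{G,y})L_HL_{G,x}}\wedge\frac{\mu_F}{5\mu_G}$, $\rho=\frac{\mu_F}{(16d_x\vee200)L_H^2L_{G,x}^2}$. (ii) For all $t\ge1$, $1\le\frac{\alpha_{t-1}}{\alpha_t}\le1+\big(\frac{\delta_F\mu_F}{16}\alpha_t\big)\wedge\big(\frac{\delta_F\mu_G}{16}\beta_t\big)\wedge\big(\frac{\delta_G\mu_G}{8}\beta_t\big)$ and $1\le\frac{\beta_{t-1}}{\beta_t}\le1+\frac{\mu_G}{64}\beta_t$. (iii) $\beta_t/\alpha_t$ is non-increasing in $t$ and $\prod_{\tau=0}^t(1-\frac{\mu_G\beta_\tau}4)=O(\alpha_t^2)$. *)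

(* Defs.v *)
From HB Require Import structures.
From mathcomp Require Import all_boot all_order all_algebra.
From mathcomp Require Import all_classical all_reals all_analysis.
Set Implicit Arguments.
Unset Strict Implicit.
Unset Printing Implicit Defensive.
Import Order.TTheory GRing.Theory Num.Theory.
Import numFieldNormedType.Exports.
Local Open Scope classical_set_scope.
Local Open Scope ring_scope.

(* The library norm on matrices is the sup norm, so the Euclidean and spectral
   norms are defined here. *)
Definition dotp (R : realType) (n : nat) (u v : 'cV[R]_n) : R :=
  \sum_(i < n) u i 0 * v i 0.

Definition enorm (R : realType) (n : nat) (v : 'cV[R]_n) : R :=
  Num.sqrt (dotp v v).

(* The operator norm induced by [enorm]. *)
Definition snorm (R : realType) (m n : nat) (A : 'M[R]_(m, n)) : R :=
  sup [set enorm (A *m v) | v in [set v : 'cV[R]_n | enorm v <= 1]].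

(* The Borel sigma-algebra of [V]: the one generated by its open sets. *)
Definition borel (V : ptopologicalType) := g_sigma_algebraType (@open V).

Section probability.
Context {d : measure_display} {T : measurableType d} {R : realType}.
Variable P : probability T R.

(* [Y] is a version of the conditional expectation of [X] given the
   sigma-algebra [S]. *)
Definition cond_exp (S : set_system T) (X Y : T -> R) : Prop :=
  [/\ P.-integrable setT (EFin \o X),
      P.-integrable setT (EFin \o Y),
      measurable_fun setT (Y : g_sigma_algebraType S -> R) &
      forall A, S A ->
        (\int[P]_(w in A) (Y w)%:E = \int[P]_(w in A) (X w)%:E)%E].

Definition cond_exp_mx (m n : nat) (S : set_system T) (X Y : T -> 'M[R]_(m, n)) :
    Prop :=
  forall i j, cond_exp S (fun w => X w i j) (fun w => Y w i j).

Definition cond_exp_le (S : set_system T) (X : T -> R) (c : R) : Prop :=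
  exists2 Y, cond_exp S X Y & {ae P, forall w, Y w <= c}.

Definition cond_exp_snorm_le (m n : nat) (S : set_system T)
    (X : T -> 'M[R]_(m, n)) (c : R) : Prop :=
  exists2 Y, cond_exp_mx S X Y & {ae P, forall w, snorm (Y w) <= c}.

Definition expectation_mx (m n : nat) (X : T -> 'M[R]_(m, n)) : 'M[R]_(m, n) :=
  \matrix_(i, j) fine ('E_P[fun w => X w i j])%E.

Definition preimage_borel (n : nat) (X : T -> 'cV[R]_n) : set_system T :=
  preimage_set_system setT (X : T -> borel 'cV[R]_n) measurable.

Definition filtration (dx dy : nat) (x0 : 'cV[R]_dx) (y0 : 'cV[R]_dy)
    (xi : nat -> T -> 'cV[R]_dx) (psi : nat -> T -> 'cV[R]_dy) (t : nat) :
    set_system T :=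
  <<s preimage_borel (cst x0) `|` preimage_borel (cst y0) `|`
      \bigcup_(s in `I_t) (preimage_borel (xi s) `|` preimage_borel (psi s)) >>.

Definition noise_conditions (dx dy : nat)
    (x0 : 'cV[R]_dx) (y0 : 'cV[R]_dy)
    (xi : nat -> T -> 'cV[R]_dx) (psi : nat -> T -> 'cV[R]_dy)
    (Gamma11 Gamma22 Sigma11 Sigma22 Sigma12 : R) : Prop :=
  forall t, let Ft := filtration x0 y0 xi psi t in
  [/\ cond_exp_mx Ft (xi t) (cst 0) /\ cond_exp_mx Ft (psi t) (cst 0),
      cond_exp_le Ft (fun w => enorm (xi t w) ^+ 4) (Gamma11 ^+ 2) /\
      cond_exp_le Ft (fun w => enorm (psi t w) ^+ 4) (Gamma22 ^+ 2),
      cond_exp_snorm_le Ft (fun w => xi t w *m (xi t w)^T) Sigma11,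
      cond_exp_snorm_le Ft (fun w => psi t w *m (psi t w)^T) Sigma22 &
      cond_exp_snorm_le Ft (fun w => xi t w *m (psi t w)^T) Sigma12].

End probability.

Section assumptions.
Context {R : realType} {dx dy : nat}.
Implicit Types (F : 'cV[R]_dx -> 'cV[R]_dy -> 'cV[R]_dx).
Implicit Types (G : 'cV[R]_dx -> 'cV[R]_dy -> 'cV[R]_dy).
Implicit Types (H : 'cV[R]_dy -> 'cV[R]_dx) (ystar : 'cV[R]_dy).

(* The domain carries the product of the two Borel sigma-algebras, which is the
   Borel sigma-algebra of the product space. *)
Definition borel_measurable (n : nat) (K : 'cV[R]_dx -> 'cV[R]_dy -> 'cV[R]_n) :
    Prop :=
  measurable_fun setT
    ((fun p => K p.1 p.2) :
      (borel 'cV[R]_dx * borel 'cV[R]_dy)%type -> borel 'cV[R]_n).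

Definition lipschitz_FH F H (LH LF : R) : Prop :=
  [/\ forall x y, F x y = 0 <-> x = H y,
      0 < LH /\ 0 < LF,
      forall y1 y2, enorm (H y1 - H y2) <= LH * enorm (y1 - y2) &
      forall x y1, enorm (F x y1 - F (H y1) y1) <= LF * enorm (x - H y1)].

Definition nested_lipschitz_G G H ystar (LGx LGy : R) : Prop :=
  [/\ forall y, G (H y) y = 0 <-> y = ystar,
      0 < LGx /\ 0 < LGy,
      forall x y, enorm (G x y - G (H y) y) <= LGx * enorm (x - H y) &
      forall y, enorm (G (H y) y - G (H ystar) ystar) <= LGy * enorm (y - ystar)].

Definition star_strong_monotone F G H ystar (muF muG : R) : Prop :=
  [/\ 0 < muF /\ 0 < muG,
      forall x y, dotp (x - H y) (F x y - F (H y) y) >= muF * enorm (x - H y) ^+ 2 &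
      forall y, dotp (y - ystar) (G (H y) y - G (H ystar) ystar) >=
                muG * enorm (y - ystar) ^+ 2].

Definition locally_linear_H H (SH deltaH : R) : Prop :=
  [/\ forall y, differentiable H y,
      0 <= SH,
      2^-1 <= deltaH <= 1 &
      forall y1 y2, enorm (H y1 - H y2 - 'd H y2 (y1 - y2)) <=
                    SH * enorm (y1 - y2) `^ (1 + deltaH)].

Definition nested_locally_linear F G H ystar
    (B1 : 'M[R]_(dx, dx)) (B2 : 'M[R]_(dy, dx)) (B3 : 'M[R]_(dy, dy))
    (SBF SBG deltaF deltaG : R) : Prop :=
  [/\ 0 <= SBF /\ 0 <= SBG,
      0 < deltaF <= 1,
      0 < deltaG <= 1,
      forall x y, enorm (F x y - B1 *m (x - H y)) <=
        SBF * (enorm (x - H y) `^ (1 + deltaF) + enorm (y - ystar) `^ (1 + deltaF)) &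
      forall x y, enorm (G x y - B2 *m (x - H y) - B3 *m (y - ystar)) <=
        SBG * (enorm (x - H y) `^ (1 + deltaG) + enorm (y - ystar) `^ (1 + deltaG))].

Definition tts_iteration (T : Type) F G (alpha beta : nat -> R)
    (xi : nat -> T -> 'cV[R]_dx) (psi : nat -> T -> 'cV[R]_dy)
    (x0 : 'cV[R]_dx) (y0 : 'cV[R]_dy)
    (x : nat -> T -> 'cV[R]_dx) (y : nat -> T -> 'cV[R]_dy) : Prop :=
  [/\ forall w, x 0 w = x0,
      forall w, y 0 w = y0,
      forall t w, x t.+1 w = x t w - alpha t *: (F (x t w) (y t w) + xi t w) &
      forall t w, y t.+1 w = y t w - beta t *: (G (x t w) (y t w) + psi t w)].

End assumptions.

Definition iota1 (R : realType) (muF LF : R) : R :=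
  Num.min (muF / (4 * LF ^+ 2)) (1 / (12 * muF)).

Definition iota2 (R : realType) (muG LGy : R) : R :=
  Num.min (muG / LGy ^+ 2) (1 / (14 * muG)).

Definition kappa (R : realType) (dx : nat) (muF muG LH LGx LGy : R) : R :=
  Num.min (muF * muG / (Num.max (28 * dx%:R) (200 * LGy) * LH * LGx))
          (muF / (5 * muG)).

Definition rho (R : realType) (dx : nat) (muF LH LGx : R) : R :=
  muF / (Num.max (16 * dx%:R) 200 * LH ^+ 2 * LGx ^+ 2).

Definition contraction_prod (R : realType) (muG : R) (beta : nat -> R) (t : nat) : R :=
  \prod_(tau < t.+1) (1 - muG * beta tau / 4).

Definition stepsize_conditions (R : realType) (dx : nat) (alpha beta : nat -> R)
    (LH LF LGx LGy muF muG deltaF deltaG : R) : Prop :=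
  [/\ forall t, 0 < alpha t /\ 0 < beta t,
      forall t, [/\ alpha t <= iota1 muF LF, beta t <= iota2 muG LGy,
                    beta t / alpha t <= kappa dx muF muG LH LGx LGy &
                    beta t ^+ 2 / alpha t <= rho dx muF LH LGx],
      forall t, (1 <= t)%N ->
        1 <= alpha t.-1 / alpha t <=
          1 + Num.min (Num.min (deltaF * muF / 16 * alpha t)
                               (deltaF * muG / 16 * beta t))
                      (deltaG * muG / 8 * beta t) /\
        1 <= beta t.-1 / beta t <= 1 + muG / 64 * beta t,
      {homo (fun t => beta t / alpha t) : s t / (s <= t)%N >-> t <= s} &
      contraction_prod muG beta =O_\oo (fun t => alpha t ^+ 2)].

Definition contraction_sup (R : realType) (muG : R) (alpha beta : nat -> R) : R :=
  sup (range (fun t => (alpha t ^+ 2)^-1 * contraction_prod muG beta t)).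

(* Main.v *)
Require Import Defs.
From HB Require Import structures.
From mathcomp Require Import all_boot all_order all_algebra.
From mathcomp Require Import all_classical all_reals all_analysis.
From mathcomp Require Import measurable_realfun ring lra.
Set Implicit Arguments.
Unset Strict Implicit.
Unset Printing Implicit Defensive.
Import Order.TTheory GRing.Theory Num.Theory.
Import numFieldNormedType.Exports.
Local Open Scope classical_set_scope.
Local Open Scope ring_scope.

(* [H] is linearized not at [y_t] but at the past-measurable point
   [y_t - beta_t G(x_t, y_t)]: the first-order noise in [xhat] is then a
   martingale difference, and the remainder is both at most of order
   [beta |psi|] and of order [beta^(3/2) (1 + |psi|^4)].  Hence the fourth moments
   of the noise suffice to close a recursion for [E V^2], where
   [V = |yhat|^2 + w |xhat|^2] and [w] is a constant times [beta / alpha]: it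
   contracts at rate [muG beta] and yields [E V^2 = O(alpha^2)], after which
   [E |xhat|^4] contracts at rate [muF alpha] and is [O(alpha^2)] as well.
   These two bounds absorb every nonlinear term of (A4) and (A5).  The columns
   of [E xhat yhat^T] contract through [I - alpha B1], and [E |yhat|^2] depends on
   [xhat] to first order only through these columns, so a discrete Gronwall
   argument gives [O(beta + alpha^(1 + deltaF / 2))] for the former and
   [O(beta + alpha^(1 + deltaF / 2) + alpha^(1 + deltaG))] for the latter.
   Finally [alpha^(1 + e) <= beta + alpha beta (alpha / beta)^(1 / e)]. *)

(** What shapes the proof is that the noise has four moments and no more. The linearization errors
    of (A5) enter squared or multiplied by [yhat], hence with powers of the errors up to the fourth,
    and second moments alone do not close. The fourth moments of [xhat] and [yhat] feed each other,
    which is why they are first treated jointly through [V]; a weight of order [beta / alpha] lets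
    the fast contraction pay for the coupling in both directions. The resulting scale [alpha] for
    |yhat|^2 is coarser than the final one, but it is needed only in terms of higher order, where
    the loss is harmless. The constants may not depend on the individual step sizes. Initial errors
    are therefore compared with [alpha_0^2] by means of [contraction_sup], whose term at t = 0
    controls [alpha_0^-2]. Estimates are made pointwise, for arbitrary noise vectors, with a right
    side that is linear in [1 + |xi|^4 + |psi|^4] apart from explicit terms of zero mean.
    Probability enters only afterwards, through one conditional moment bound and one vanishing
    lemma. *)

Section euclidean.
Context {R : realType} {n : nat}.
Implicit Types (u v w : 'cV[R]_n) (a : R).

(** * Euclidean inner product and norm *)

Lemma dotpC u v : dotp u v = dotp v u.
Proof. by apply: eq_bigr => i _; rewrite mulrC. Qed.

Lemma dotpDl u v w : dotp (u + v) w = dotp u w + dotp v w.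
Proof. by rewrite -big_split; apply: eq_bigr => i _; rewrite mxE mulrDl. Qed.

Lemma dotpZl a u v : dotp (a *: u) v = a * dotp u v.
Proof. by rewrite mulr_sumr; apply: eq_bigr => i _; rewrite mxE mulrA. Qed.

Lemma dotpDr u v w : dotp u (v + w) = dotp u v + dotp u w.
Proof. by rewrite !(dotpC u) dotpDl. Qed.

Lemma dotpZr a u v : dotp u (a *: v) = a * dotp u v.
Proof. by rewrite !(dotpC u) dotpZl. Qed.

Lemma dotpNl u v : dotp (- u) v = - dotp u v.
Proof. by rewrite -scaleN1r dotpZl mulN1r. Qed.

Lemma dotpNr u v : dotp u (- v) = - dotp u v.
Proof. by rewrite !(dotpC u) dotpNl. Qed.

Lemma dotp0r u : dotp u 0 = 0.
Proof. by rewrite -(scale0r 0) dotpZr mul0r. Qed.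

Lemma dotpv_ge0 v : 0 <= dotp v v.
Proof. by apply: sumr_ge0 => i _; rewrite -expr2 sqr_ge0. Qed.

Lemma enorm_ge0 v : 0 <= enorm v.
Proof. exact: sqrtr_ge0. Qed.

Lemma enorm_sqr v : enorm v ^+ 2 = dotp v v.
Proof. by rewrite sqr_sqrtr ?dotpv_ge0. Qed.

Lemma enorm0 : enorm (0 : 'cV[R]_n) = 0.
Proof. by rewrite /enorm dotp0r sqrtr0. Qed.

Lemma enormZ a v : enorm (a *: v) = `|a| * enorm v.
Proof.
by rewrite /enorm dotpZl dotpZr mulrA -expr2 sqrtrM ?sqr_ge0// sqrtr_sqr.
Qed.

Lemma enormN v : enorm (- v) = enorm v.
Proof. by rewrite -scaleN1r enormZ normrN1 mul1r. Qed.

Lemma enormB u v : enorm (u - v) = enorm (v - u).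
Proof. by rewrite -enormN opprB. Qed.

Lemma enorm_sqrD u v :
  enorm (u + v) ^+ 2 = enorm u ^+ 2 + 2 * dotp u v + enorm v ^+ 2.
Proof. rewrite !enorm_sqr !(dotpDl, dotpDr) (dotpC v u); ring. Qed.

Lemma enorm_sqrB u v :
  enorm (u - v) ^+ 2 = enorm u ^+ 2 - 2 * dotp u v + enorm v ^+ 2.
Proof. rewrite enorm_sqrD dotpNr enormN; ring. Qed.

(** Cauchy-Schwarz: expanding the square of [dotp v v *: u - dotp u v *: v] gives [dotp v v] times
    the squared inequality. The case [dotp v v = 0], where one cannot divide, is settled
    coordinatewise. *)
Lemma dotp_le u v : dotp u v <= enorm u * enorm v.
Proof.
have key : dotp u v ^+ 2 <= (enorm u * enorm v) ^+ 2.
  have := dotpv_ge0 (dotp v v *: u - dotp u v *: v).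
  rewrite !(dotpDl, dotpDr, dotpNl, dotpNr, dotpZl, dotpZr) (dotpC v u).
  rewrite exprMn !enorm_sqr.
  have : 0 <= dotp v v by exact: dotpv_ge0.
  rewrite le_eqVlt => /orP[/eqP v0 _|v0]; last first.
    move=> h; rewrite -subr_ge0 -(pmulr_rge0 _ v0); apply: (le_trans h); lra.
  suff -> : dotp u v = 0 by rewrite expr0n/= mulr_ge0// dotpv_ge0.
  apply: big1 => i _.
  suff -> : v i 0 = 0 by rewrite mulr0.
  have /eqP := esym v0; rewrite psumr_eq0 => [/allP/(_ i)|j _].
    by rewrite mem_index_enum => /(_ isT)/=; rewrite mulf_eq0 orbb => /eqP.
  by rewrite -expr2 sqr_ge0.
rewrite (le_trans (ler_norm _))// -(ler_pXn2r (n:=2))// ?nnegrE ?mulr_ge0 ?enorm_ge0//.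
by rewrite real_normK ?num_real.
Qed.

Lemma normr_dotp_le u v : `|dotp u v| <= enorm u * enorm v.
Proof.
by rewrite ler_norml dotp_le andbT lerNl -dotpNl (le_trans (dotp_le _ _))// enormN.
Qed.

Lemma enormD u v : enorm (u + v) <= enorm u + enorm v.
Proof.
rewrite -(ler_pXn2r (n:=2))// ?nnegrE ?addr_ge0 ?enorm_ge0// enorm_sqrD.
have := dotp_le u v; nra.
Qed.

Lemma enormB_le u v : enorm (u - v) <= enorm u + enorm v.
Proof. by rewrite (le_trans (enormD _ _)) ?enormN. Qed.

Lemma normr_coord_le v i : `|v i 0| <= enorm v.
Proof.
rewrite -sqrtr_sqr ler_wsqrtr// /dotp (bigD1 i)//= -expr2 lerDl.
by apply: sumr_ge0 => j _; rewrite -expr2 sqr_ge0.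
Qed.

Lemma enorm_delta (i : 'I_n) : enorm (delta_mx i 0 : 'cV[R]_n) = 1.
Proof.
rewrite /enorm /dotp (bigD1 i)//= !mxE !eqxx big1 ?addr0 ?mulr1 ?sqrtr1//.
by move=> j /negPf ji; rewrite !mxE ji mul0r.
Qed.

Lemma enorm_le_sum v : enorm v <= \sum_(i < n) `|v i 0|.
Proof.
rewrite {1}[v]matrix_sum_delta.
apply: (big_ind2 (fun x y => enorm x <= y)) => [|x a y b xa yb|i _].
- by rewrite enorm0.
- by rewrite (le_trans (enormD _ _)) ?lerD.
by rewrite big_ord1 enormZ enorm_delta mulr1.
Qed.

End euclidean.

Ltac nneg := lazymatch goal with
  | |- is_true (0 <= _ + _) => apply: addr_ge0; nneg
  | |- is_true (0 <= _ * _) => apply: mulr_ge0; nneg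
  | |- is_true (0 <= _^-1) => rewrite invr_ge0; nneg
  | |- is_true (0 <= _ ^+ 2) => exact: sqr_ge0
  | |- is_true (0 <= _ ^+ _) => apply: exprn_ge0; nneg
  | |- is_true (0 <= `|_|) => exact: normr_ge0
  | |- is_true (0 <= Num.sqrt _) => exact: sqrtr_ge0
  | |- is_true (0 <= enorm _) => exact: enorm_ge0
  | |- is_true (0 <= _ `^ _) => exact: powR_ge0
  | |- is_true (0 <= _%:R) => exact: ler0n
  | |- is_true (0 <= _) => first [assumption | exact: ltW | exact: enorm_ge0 | by []]
  end.

(** * Scalar inequalities *)

Section real_inequalities.
Context {R : realType}.
Implicit Types (x y z a b c d e g h k m n p q r s u v w omega A B K L M eps eta phi : R).

(** Half of the contraction pays for the decrease of [Q], since (1 - c g / 2)(1 + c g / 2) <= 1; the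
    other half absorbs the source, since K <= M c / 2. *)
Lemma discrete_gronwall (z g Q : nat -> R) c K M :
  0 <= c -> 0 <= M -> K <= M * (c / 2) ->
  (forall t, 0 <= g t) -> (forall t, c * g t <= 1) -> (forall t, 0 <= Q t) ->
  (forall t, Q t <= (1 + c / 2 * g t) * Q t.+1) ->
  (forall t, z t.+1 <= (1 - c * g t) * z t + K * g t * Q t) ->
  z 0%N <= M * Q 0%N -> forall t, z t <= M * Q t.
Proof.
move=> c0 M0 KM g0 cg1 Q0 QS zS z0; elim=> [//|t IH].
have := g0 t; have := cg1 t; have := Q0 t; have := QS t; have := Q0 t.+1.
set G := g t; set q := Q t; set q' := Q t.+1 => hq' hqq' hq hG1 hG0.
have h1 : (1 - c * G) * z t <= (1 - c * G) * (M * q).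
  by apply: ler_wpM2l => //; lra.
have h2 : K * G * q <= M * (c / 2) * G * q.
  by rewrite !ler_wpM2r.
have h3 : M * (1 - c / 2 * G) * q <= M * (1 - c / 2 * G) * ((1 + c / 2 * G) * q').
  apply: ler_wpM2l => //; apply: mulr_ge0 => //.
  have := mulr_ge0 c0 hG0; lra.
have h4 : 0 <= M * q' * (c / 2 * G) ^+ 2 by rewrite !mulr_ge0// sqr_ge0.
have := zS t; rewrite -/G -/q; nra.
Qed.

Lemma powR_le_1Dexpn x e (n : nat) : 0 <= x -> 0 <= e <= n%:R -> x `^ e <= 1 + x ^+ n.
Proof.
move=> x0 /andP[e0 en]; have [x1|x1] := leP 1 x.
  rewrite (le_trans (ler_powR x1 en))// powR_mulrn//; lra.
apply: (@le_trans _ _ 1); last by rewrite lerDl exprn_ge0.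
have -> : 1 = 1 `^ e :> R by rewrite powR1.
by apply: ge0_ler_powR; rewrite ?nnegrE// ltW.
Qed.

Lemma powR_le_expn x d (n : nat) : 1 <= x -> d <= n%:R -> x `^ d <= x ^+ n.
Proof. by move=> x1 dn; rewrite -powR_mulrn ?ler_powR//; lra. Qed.

(** This is where [deltaH >= 1/2] acts: it makes the remainder of [H] of order 3/2 in
    [beta |psi|]. *)
Lemma powR_le_sqrt x d : 0 <= x <= 1 -> 2^-1 <= d -> x `^ (1 + d) <= x * Num.sqrt x.
Proof.
move=> /andP[x0 x1] d1; rewrite le_eqVlt in x0.
have /orP[/eqP<-|x0'] := x0; first by rewrite powR0 ?mul0r//; apply/eqP; lra.
rewrite -powR12_sqrt ?(ltW x0')// -[X in X * _](powRr1 (ltW x0')) -powRD; last first.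
  by rewrite gt_eqF ?implybT.
by rewrite ger_powR ?x0'//; lra.
Qed.

(** The limit [h -> 0], taken with the explicit [h] for which [h^d = e / (|c| + 1)]. It transfers
    bounds from the nonlinear maps to their linear parts. *)
Lemma le_of_le_Dpow x y c d : 0 < d ->
  (forall h, 0 < h -> x <= y + c * h `^ d) -> x <= y.
Proof.
move=> d0 H; apply/ler_addgt0Pr => e e0.
have c1 : 0 < `|c| + 1 by rewrite ltr_wpDl.
have := H ((e / (`|c| + 1)) `^ d^-1) (powR_gt0 _ (divr_gt0 e0 c1)).
rewrite -powRrM mulVf ?gt_eqF// powRr1 ?divr_ge0 ?(ltW e0) ?(ltW c1)// => h.
apply: (le_trans h); rewrite lerD2l mulrCA ler_piMr ?(ltW e0)//.
by rewrite ler_pdivrMr// mul1r (le_trans (ler_norm c))// lerDl.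
Qed.

Lemma young x y eps : 0 < eps -> x * y <= eps * x ^+ 2 + y ^+ 2 / (4 * eps).
Proof.
move=> e0; have : 0 <= (2 * eps * x - y) ^+ 2 / (4 * eps).
  by rewrite divr_ge0 ?sqr_ge0// mulr_ge0 ?(ltW e0).
suff -> : (2 * eps * x - y) ^+ 2 / (4 * eps) = eps * x ^+ 2 - x * y + y ^+ 2 / (4 * eps).
  by lra.
by field; rewrite gt_eqF.
Qed.

(** Going from 7/4 to 3/2 leaves a quarter of [m a^2] for the cross terms: Young's inequality with
    weight [m / 20] spends a tenth on [2 a k], and the terms with [m / 200] take little more. The
    [k^2] terms amount to [(10 + 1/6) k^2 / m], rounded up to 11. *)
Lemma sqr_contraction_perturbed p a k m : 0 < m <= 12^-1 -> 0 <= p -> 0 <= a -> 0 <= k ->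
  p ^+ 2 <= (1 - 7 / 4 * m) * a ^+ 2 ->
  (p + (m / 200 * a + k)) ^+ 2 <= (1 - 3 / 2 * m) * a ^+ 2 + 11 * k ^+ 2 / m.
Proof.
move=> /andP[m0 hm] p0 a0 k0 hf.
have pa : p <= a.
  rewrite -(ler_pXn2r (n:=2))// (le_trans hf)// ler_piMl ?sqr_ge0//; lra.
have h2 : p * (m / 200 * a + k) <= a * (m / 200 * a + k).
  by rewrite ler_wpM2r//; nneg.
have h3 : a * k <= m / 20 * a ^+ 2 + k ^+ 2 / (4 * (m / 20)) by apply: young; lra.
pose K := k ^+ 2 / m.
have -> : 11 * k ^+ 2 / m = 11 * K by rewrite /K; field; rewrite gt_eqF.
rewrite (_ : k ^+ 2 / (4 * (m / 20)) = 5 * K) in h3; last by rewrite /K; field; rewrite gt_eqF.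
have h4 : 12 * k ^+ 2 <= K.
  have h : k ^+ 2 * m <= k ^+ 2 * 12^-1 by rewrite ler_wpM2l ?sqr_ge0.
  by rewrite /K ler_pdivlMr//; lra.
have h5 : m ^+ 2 * a ^+ 2 <= m / 12 * a ^+ 2.
  by rewrite ler_wpM2r ?sqr_ge0// expr2 ler_wpM2l ?(ltW m0).
have h6 : (m / 200 * a + k) ^+ 2 <= 2 * (m / 200 * a) ^+ 2 + 2 * k ^+ 2.
  by have := sqr_ge0 (m / 200 * a - k); lra.
have ma : 0 <= m * a ^+ 2 by nneg.
have := sqr_ge0 k.
rewrite sqrrD mulr2n; clearbody K; move: hf h2 h3 h4 h5 h6 ma; clear; lra.
Qed.

(** Young's inequality with weight [m / 8] costs [m p^2 / 4], and (1 + m / 4)(1 - m) <= 1 - 3 m / 4.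
    It leaves [4 k^2 / m + k^2], where [14 k^2 <= k^2 / m]. *)
Lemma sqr_shift_le p a k m : 0 < m <= 14^-1 -> 0 <= p ->
  p ^+ 2 <= (1 - m) * a ^+ 2 ->
  (p + k) ^+ 2 <= (1 - 3 / 4 * m) * a ^+ 2 + 5 * (k ^+ 2 / m).
Proof.
move=> /andP[m0 hm] p0 hp.
have m4 : 0 < m / 8 by lra.
have h1 := young p k m4.
rewrite (_ : k ^+ 2 / (4 * (m / 8)) = 2 * (k ^+ 2 / m)) in h1; last by field; rewrite gt_eqF.
have h4 : 14 * k ^+ 2 <= k ^+ 2 / m.
  have h : k ^+ 2 * m <= k ^+ 2 * 14^-1 by rewrite ler_wpM2l ?sqr_ge0.
  by rewrite ler_pdivlMr//; lra.
have h5 : m * p ^+ 2 <= m * ((1 - m) * a ^+ 2) by rewrite ler_wpM2l ?(ltW m0).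
have mb : 0 <= m ^+ 2 * a ^+ 2 by nneg.
have mb' : 0 <= m * a ^+ 2 by nneg.
have := sqr_ge0 k.
rewrite sqrrD mulr2n; move: (_ / m) h1 h4 => K h1 h4; move: hp h1 h4 h5 mb mb'; clear; lra.
Qed.

(** Two uses of Young's inequality: [s^3 h] is split into [s^4] and [s^2 h^2], and then all of
    [s^2 h^2], whose coefficient is the base of the outer square, into [s^4] and [h^4]. In that
    coefficient 11 is 2 from the product [s^2 N2] and 9 from the squares of [Mt] and [N1]; the last
    summand comes from [N2^2]. *)
Definition perturb_const K L eps : R :=
  (4 * K ^+ 2 / eps + 11 * K ^+ 2) ^+ 2 / (2 * eps) + 6 * K ^+ 2 * L.

Lemma perturb_const_ge0 K L eps : 0 <= L -> 0 < eps -> 0 <= perturb_const K L eps.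
Proof. by move=> L0 e0; rewrite /perturb_const; nneg. Qed.

(* The cubic term [s^3 h] is the reason for keeping a conditional moment of the
   noise: it must be split by Young's inequality with weight [1 + p^4 + q^4]. *)
Lemma sqr_perturbed_le K L eps s g h p q Mt N N1 N2 : 1 <= K -> 0 <= L -> 0 < eps ->
  0 <= s -> 0 <= g -> 0 <= h -> 0 <= p -> 0 <= q -> g ^+ 2 <= L ->
  `|Mt| <= K * s * g * h * (p + q) ->
  `|N| <= N1 + N2 -> 0 <= N1 -> 0 <= N2 ->
  N1 <= K * s * g ^+ 2 * h * (1 + q ^+ 4) ->
  N1 <= K * s * g * h * q ->
  N2 <= K * g ^+ 2 * h ^+ 2 * (p ^+ 2 + q ^+ 2) ->
  (s ^+ 2 + Mt + N) ^+ 2 <= s ^+ 4 + 2 * s ^+ 2 * Mt +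
    g ^+ 2 * (eps * s ^+ 4 + perturb_const K L eps * h ^+ 4) * (1 + p ^+ 4 + q ^+ 4).
Proof.
move=> K1 L0 e0 s0 g0 h0 p0 q0 gL hM hN N10 N20 hN1 hN1' hN2.
have K0 : 0 <= K by lra.
rewrite /perturb_const; pose k2 := 4 * K ^+ 2 / eps + 11 * K ^+ 2; rewrite -/k2.
have k20 : 0 <= k2 by rewrite /k2; nneg.
set P := 1 + p ^+ 4 + q ^+ 4.
have p4 : p ^+ 4 = (p ^+ 2) ^+ 2 by rewrite -exprM.
have q4 : q ^+ 4 = (q ^+ 2) ^+ 2 by rewrite -exprM.
have P1 : 1 + q ^+ 4 <= P by rewrite /P p4; have := sqr_ge0 (p ^+ 2); lra.
have P2 : p ^+ 2 + q ^+ 2 <= P by rewrite /P p4 q4; have := sqr_ge0 (p ^+ 2 - 2^-1); have := sqr_ge0 (q ^+ 2 - 2^-1); nra.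
have P3 : (p + q) ^+ 2 <= 2 * P by have := sqr_ge0 (p - q); nra.
have P4 : q ^+ 2 <= P by have := sqr_ge0 p; lra.
have P5 : (p ^+ 2 + q ^+ 2) ^+ 2 <= 2 * P.
  by rewrite /P p4 q4; have := sqr_ge0 (p ^+ 2 - q ^+ 2); nra.
have P0 : 0 <= P by have := sqr_ge0 q; lra.
have sgh0 : 0 <= K * s * g * h by rewrite !mulr_ge0.
have M2 : Mt ^+ 2 <= (K * s * g * h) ^+ 2 * (2 * P).
  rewrite -(real_normK (num_real Mt)).
  apply: (@le_trans _ _ ((K * s * g * h * (p + q)) ^+ 2)).
    by rewrite ler_pXn2r ?nnegrE// mulr_ge0// addr_ge0.
  by rewrite exprMn ler_wpM2l ?sqr_ge0.
have N12 : N1 ^+ 2 <= (K * s * g * h) ^+ 2 * P.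
  apply: (@le_trans _ _ ((K * s * g * h * q) ^+ 2)).
    by rewrite ler_pXn2r ?nnegrE// mulr_ge0// addr_ge0.
  by rewrite exprMn ler_wpM2l ?sqr_ge0.
have N22 : N2 ^+ 2 <= (K * g ^+ 2 * h ^+ 2) ^+ 2 * (2 * P).
  apply: (@le_trans _ _ ((K * g ^+ 2 * h ^+ 2 * (p ^+ 2 + q ^+ 2)) ^+ 2)).
    by rewrite ler_pXn2r ?nnegrE// mulr_ge0// ?addr_ge0// ?mulr_ge0// ?sqr_ge0.
  by rewrite exprMn ler_wpM2l ?sqr_ge0.
have sN : 2 * s ^+ 2 * N <= 2 * s ^+ 2 * (N1 + N2).
  by rewrite ler_wpM2l ?mulr_ge0 ?sqr_ge0// (le_trans (ler_norm _)).
have sN1 : s ^+ 2 * N1 <= s ^+ 2 * (K * s * g ^+ 2 * h * P).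
  rewrite ler_wpM2l ?sqr_ge0// (le_trans hN1)// ler_wpM2l// !mulr_ge0// sqr_ge0.
have sN2 : s ^+ 2 * N2 <= s ^+ 2 * (K * g ^+ 2 * h ^+ 2 * P).
  rewrite ler_wpM2l ?sqr_ge0// (le_trans hN2)// ler_wpM2l// !mulr_ge0// sqr_ge0.
have MN : (Mt + N) ^+ 2 <= 3 * (Mt ^+ 2 + N1 ^+ 2 + N2 ^+ 2).
  have : N ^+ 2 <= (N1 + N2) ^+ 2.
    by rewrite -(real_normK (num_real N)) ler_pXn2r ?nnegrE ?addr_ge0.
  have : Mt * N <= `|Mt| * (N1 + N2).
    by rewrite (le_trans (ler_norm _))// normrM ler_wpM2l.
  have := real_normK (num_real Mt).
  have := sqr_ge0 (`|Mt| - N1); have := sqr_ge0 (`|Mt| - N2); have := sqr_ge0 (N1 - N2).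
  nra.
have Y1 : 2 * K * s ^+ 3 * h <= eps / 4 * s ^+ 4 + (4 * K ^+ 2 / eps) * s ^+ 2 * h ^+ 2.
  have e4 : 0 < eps / 4 by rewrite divr_gt0.
  have := young s (2 * K * h) e4; rewrite -(ler_pM2l (ltr01)).
  move=> /(ler_wpM2l (sqr_ge0 s)).
  suff -> : (2 * K * h) ^+ 2 / (4 * (eps / 4)) = (4 * K ^+ 2 / eps) * h ^+ 2 by move=> H; nra.
  by field; rewrite gt_eqF.
have Y2 : k2 * s ^+ 2 * h ^+ 2 <= eps / 2 * s ^+ 4 + k2 ^+ 2 / (2 * eps) * h ^+ 4.
  have e2 : 0 < eps / 2 by rewrite divr_gt0.
  have := young (s ^+ 2) (k2 * h ^+ 2) e2.
  suff -> : (k2 * h ^+ 2) ^+ 2 / (4 * (eps / 2)) = k2 ^+ 2 / (2 * eps) * h ^+ 4 by move=> H; nra.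
  by field; rewrite gt_eqF.
have T : g ^+ 2 * P * (2 * K * s ^+ 3 * h + 11 * K ^+ 2 * s ^+ 2 * h ^+ 2 + 6 * K ^+ 2 * L * h ^+ 4)
    <= g ^+ 2 * P * (eps * s ^+ 4 + (k2 ^+ 2 / (2 * eps) + 6 * K ^+ 2 * L) * h ^+ 4).
  rewrite ler_wpM2l ?mulr_ge0 ?sqr_ge0//.
  have s40 : 0 <= s ^+ 4 by rewrite exprn_ge0.
  have : 0 <= eps * s ^+ 4 by rewrite mulr_ge0// ltW.
  rewrite /k2 in Y2 *; move: Y1 Y2; nra.
have KK : K * (s ^+ 2 * (g ^+ 2 * h ^+ 2 * P)) <= K ^+ 2 * (s ^+ 2 * (g ^+ 2 * h ^+ 2 * P)).
  by rewrite ler_wpM2r ?mulr_ge0 ?sqr_ge0// expr2 ler_peMr.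
have GL : 6 * K ^+ 2 * h ^+ 4 * P * g ^+ 2 * g ^+ 2 <= 6 * K ^+ 2 * h ^+ 4 * P * g ^+ 2 * L.
  by rewrite ler_wpM2l// !mulr_ge0// ?sqr_ge0// exprn_ge0.
apply: (le_trans _ (lerD (lexx (s ^+ 4 + 2 * s ^+ 2 * Mt)) (le_trans _ (le_trans T _)))); last first.
- by rewrite [leRHS]mulrAC.
- exact: lexx.
move: sN sN1 sN2 MN M2 N12 N22 KK GL; clear; nra.
Qed.

(** Prepares the hypotheses of [sqr_perturbed_le] for a weighted sum of squares: [u] and [v] stand
    for the norms of the slow and fast noiseless iterates, [p] and [q] for those of the noises, [r]
    for the remainder of [H], [n] for the whole fast noise. The bounds concern, in order, [Mt],
    twice [N1], and [N2]; the exponent 7 serves all of them. *)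
Lemma weighted_noise_le L g h s u v w p q r n omega :
  1 <= L -> 0 <= g -> 0 < h -> 0 <= s -> 0 <= u -> 0 <= v -> 0 <= p -> 0 <= q ->
  0 <= r -> 0 <= n -> 0 <= omega <= L -> g ^+ 2 <= L * h ^+ 2 ->
  w = omega * (g ^+ 2 / h ^+ 2) -> s ^+ 2 = u ^+ 2 + w * v ^+ 2 ->
  r <= 2 * L * (g ^+ 2 * q) -> r <= 2 * L * (g ^+ 2 * g * (1 + q ^+ 4)) ->
  n <= h ^+ 2 * p + L * (g ^+ 2 * q) ->
  [/\ 2 * (g ^+ 2 * (u * q)) + 2 * (w * (v * (h ^+ 2 * p + L * (g ^+ 2 * q))))
        <= 4 * L ^+ 7 * s * g * h * (p + q),
      2 * (w * (v * r)) <= 4 * L ^+ 7 * s * g ^+ 2 * h * (1 + q ^+ 4),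
      2 * (w * (v * r)) <= 4 * L ^+ 7 * s * g * h * q &
      g ^+ 4 * q ^+ 2 + w * n ^+ 2 <= 4 * L ^+ 7 * g ^+ 2 * h ^+ 2 * (p ^+ 2 + q ^+ 2)].
Proof.
move=> L1 g0 h0 s0 u0 v0 p0 q0 r0 n0 /andP[om0 omL] gh wE sE r1 r2 hn.
have L0 : 0 <= L by lra.
have h0' := ltW h0.
have LL i j (ij : (i <= j)%N) x : 0 <= x -> L ^+ i * x <= L ^+ j * x.
  by move=> x0; rewrite ler_wpM2r// ler_weXn2l.
have ghL : g <= L * h.
  rewrite -(ler_pXn2r (n:=2))// ?nnegrE//; last by nneg.
  by rewrite exprMn (le_trans gh)// ler_wpM2r ?sqr_ge0// expr2 ler_peMr.
have w0 : 0 <= w by rewrite wE; nneg.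
have us : u <= s.
  by rewrite -(ler_pXn2r (n:=2))// ?nnegrE// sE lerDl; nneg.
have wh2 : w * h ^+ 2 = omega * g ^+ 2 by rewrite wE; field; rewrite gt_eqF.
(* Of the two factors [sqrt w] in [w], one joins [v] and is absorbed by [s], the other is of order
   [g / h]. *)
have wvh : w * v * h <= L * g * s.
  rewrite -(ler_pXn2r (n:=2))// ?nnegrE; try by nneg.
  have -> : (w * v * h) ^+ 2 = omega * g ^+ 2 * (w * v ^+ 2) by rewrite -wh2; ring.
  apply: (@le_trans _ _ (L * g ^+ 2 * s ^+ 2)).
    apply: ler_pM; try by nneg.
      by rewrite ler_wpM2r ?sqr_ge0.
    by rewrite sE lerDr; nneg.
  by rewrite !exprMn !ler_wpM2r ?sqr_ge0// expr2 ler_peMr.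
have wvg : w * v * g <= L ^+ 2 * g * s.
  apply: (@le_trans _ _ (w * v * (L * h))); first by rewrite ler_wpM2l//; nneg.
  have := ler_wpM2l L0 wvh; lra.
have sgh0 : 0 <= s * g * h by nneg.
split.
- have t1 : g ^+ 2 * (u * q) <= L * (s * g * h * q).
    apply: (@le_trans _ _ (g * (L * h) * (s * q))); last by lra.
    rewrite expr2; apply: ler_pM; try by nneg.
      by rewrite ler_wpM2l.
    by rewrite ler_wpM2r.
  have t2 : w * v * h * (h * p) <= L * g * s * (h * p) by rewrite ler_wpM2r//; nneg.
  have t3 : w * v * g * (g * q) <= L ^+ 2 * g * s * (L * h * q).
    by apply: ler_pM; try nneg; rewrite ?ler_wpM2r.
  have t4 : L * (w * v * g * (g * q)) <= L * (L ^+ 2 * g * s * (L * h * q)).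
    by rewrite ler_wpM2l.
  have l1 := LL 1 7 isT (s * g * h * p) (mulr_ge0 sgh0 p0).
  have l2 := LL 4 7 isT (s * g * h * q) (mulr_ge0 sgh0 q0).
  have l3 := LL 1 7 isT (s * g * h * q) (mulr_ge0 sgh0 q0).
  have l4 : 0 <= L ^+ 7 * (s * g * h * p) by nneg.
  move: t1 t2 t4 l1 l2 l3 l4; clear; lra.
- have t1 : w * v * r <= w * v * (2 * L * (g ^+ 2 * g * (1 + q ^+ 4))).
    by rewrite ler_wpM2l//; nneg.
  have t2 : w * v * g * (L * (g ^+ 2 * (1 + q ^+ 4))) <= L ^+ 2 * g * s * (L * (g ^+ 2 * (1 + q ^+ 4))).
    by rewrite ler_wpM2r//; nneg.
  have t3 : g * (L ^+ 3 * g ^+ 2 * s * (1 + q ^+ 4)) <= L * h * (L ^+ 3 * g ^+ 2 * s * (1 + q ^+ 4)).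
    by rewrite ler_wpM2r//; nneg.
  have x0 : 0 <= s * g ^+ 2 * h * (1 + q ^+ 4) by nneg.
  have := LL 4 7 isT _ x0; move: t1 t2 t3; clear; lra.
- have t1 : w * v * r <= w * v * (2 * L * (g ^+ 2 * q)).
    by rewrite ler_wpM2l//; nneg.
  have t2 : w * v * g * (L * (g * q)) <= L ^+ 2 * g * s * (L * (g * q)).
    by rewrite ler_wpM2r//; nneg.
  have t3 : g * (L ^+ 3 * g * s * q) <= L * h * (L ^+ 3 * g * s * q).
    by rewrite ler_wpM2r//; nneg.
  have x0 : 0 <= s * g * h * q by nneg.
  have := LL 4 7 isT _ x0; move: t1 t2 t3; clear; lra.
- have n1 : n <= L ^+ 2 * h ^+ 2 * (p + q).
    apply: (le_trans hn).
    have : L * (g ^+ 2 * q) <= L * (L * h ^+ 2 * q).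
      by rewrite ler_wpM2l// ler_wpM2r.
    have hp0 : 0 <= h ^+ 2 * p by nneg.
    have := LL 0%N 2%N isT _ hp0; rewrite expr0; lra.
  have n2 : n ^+ 2 <= (L ^+ 2 * h ^+ 2 * (p + q)) ^+ 2.
    by rewrite ler_pXn2r ?nnegrE//; try nneg.
  have n3 : w * n ^+ 2 <= w * (L ^+ 2 * h ^+ 2 * (p + q)) ^+ 2 by rewrite ler_wpM2l.
  have n4 : w * (L ^+ 2 * h ^+ 2 * (p + q)) ^+ 2 <= L ^+ 5 * (g ^+ 2 * h ^+ 2 * (p + q) ^+ 2).
    rewrite (_ : _ * _ ^+ 2 = w * h ^+ 2 * (L ^+ 4 * h ^+ 2 * (p + q) ^+ 2)); last by ring.
    rewrite wh2 (_ : L ^+ 5 * _ = L * g ^+ 2 * (L ^+ 4 * h ^+ 2 * (p + q) ^+ 2)); last by ring.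
    by apply: ler_wpM2r; [nneg | rewrite ler_wpM2r//; nneg].
  have n5 : (p + q) ^+ 2 <= 2 * (p ^+ 2 + q ^+ 2) by have := sqr_ge0 (p - q); lra.
  have n6 : L ^+ 5 * (g ^+ 2 * h ^+ 2 * (p + q) ^+ 2) <= L ^+ 5 * (g ^+ 2 * h ^+ 2 * (2 * (p ^+ 2 + q ^+ 2))).
    by rewrite !ler_wpM2l//; nneg.
  have n7 : g ^+ 2 * (g ^+ 2 * q ^+ 2) <= L * h ^+ 2 * (g ^+ 2 * q ^+ 2).
    by rewrite ler_wpM2r//; nneg.
  have x0 : 0 <= g ^+ 2 * h ^+ 2 * q ^+ 2 by nneg.
  have x1 : 0 <= g ^+ 2 * h ^+ 2 * (p ^+ 2 + q ^+ 2) by nneg.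
  have x2 : 0 <= L ^+ 7 * (g ^+ 2 * h ^+ 2 * p ^+ 2) by nneg.
  have x3 : 0 <= L ^+ 7 * (g ^+ 2 * h ^+ 2 * q ^+ 2) by nneg.
  have := LL 1 7 isT _ x0; have := LL 5 7 isT _ x1; move: n3 n4 n6 n7 x2 x3; clear; lra.
Qed.

(** [A] and [B] are |xhat| and |yhat| in units of [h = sqrt alpha], and [phi] is the linearization
    error of [F]. After this scaling each summand is a product of steps times a polynomial dominated
    by [W * P]. The sharp bound on [phi] serves where it multiplies [yhat], the crude one, linear in
    [A], where it multiplies the slow increment, which already carries [g^2]. *)
Lemma cross_remainder_le L g h A B p q eta phi :
  1 <= L -> 0 <= g -> 0 <= h -> 0 <= A -> 0 <= B -> 0 <= p -> 0 <= q ->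
  g ^+ 2 <= L * h ^+ 2 -> g <= L * h -> h ^+ 2 <= L -> 0 <= eta -> 0 <= phi ->
  phi <= L * (eta * (2 + A ^+ 2 + B ^+ 2)) -> phi <= 2 * L * (h * A) ->
  g ^+ 2 * (h * A * (L * (h * A + h * B))) +
  (h ^+ 2 * phi + L ^+ 2 * (g ^+ 2 * (h * A + h * B))) * (h * B) +
  2 * L * (g ^+ 2 * g * (1 + q ^+ 4)) * (h * B) +
  (h ^+ 2 * phi + L ^+ 2 * (g ^+ 2 * (h * A + h * B)) + (h ^+ 2 * p + L * (g ^+ 2 * q))) *
    (g ^+ 2 * (L * (h * A + h * B) + q)) <=
  28 * L ^+ 5 * (h ^+ 2 * (eta * h) + h ^+ 2 * g ^+ 2) *
    ((1 + A ^+ 4 + B ^+ 4) * (1 + p ^+ 4 + q ^+ 4)).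
Proof.
move=> L1 g0 h0 A0 B0 p0 q0 gh ghL hL eta0 phi0 phi1 phi2.
have L0 : 0 <= L by lra.
set W := 1 + A ^+ 4 + B ^+ 4; set P := 1 + p ^+ 4 + q ^+ 4.
have sq4 (x : R) : x ^+ 4 = (x ^+ 2) ^+ 2 :> R by rewrite -exprM.
have bd (x : R) : x ^+ 2 <= (1 + x ^+ 4) / 2 by have := sqr_ge0 (x ^+ 2 - 1); rewrite sq4; lra.
have p40 (x : R) : 0 <= x ^+ 4 by rewrite sq4 sqr_ge0.
have W1 : 1 <= W by rewrite /W; have := p40 A; have := p40 B; lra.
have P1 : 1 <= P by rewrite /P; have := p40 p; have := p40 q; lra.
have W0 : 0 <= W by lra.
have P0 : 0 <= P by lra.
have WP : W <= W * P by rewrite ler_peMr.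
have PW : P <= W * P by rewrite ler_peMl.
have W2 : A ^+ 2 + B ^+ 2 <= W by rewrite /W; have := bd A; have := bd B; have := p40 A; have := p40 B; lra.
have W3 : A * (A + B) <= W by have := sqr_ge0 (A - B); rewrite /W; have := bd A; have := bd B; have := p40 A; have := p40 B; lra.
have W4 : (A + B) * B <= W by have := sqr_ge0 (A - B); rewrite /W; have := bd A; have := bd B; have := p40 A; have := p40 B; lra.
have W5 : B <= W by have := sqr_ge0 (B - 1); rewrite /W; have := bd B; have := p40 A; have := p40 B; lra.
have W6 : (2 + A ^+ 2 + B ^+ 2) * B <= 2 * W.
  have := sqr_ge0 (B - 1); have := sqr_ge0 (A ^+ 2 - B); have := sqr_ge0 (B ^+ 2 - B).
  by rewrite /W; have := bd B; have := p40 A; have := p40 B; rewrite !sq4; lra.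
have P2 : p ^+ 2 + q ^+ 2 <= P by rewrite /P; have := bd p; have := bd q; have := p40 p; have := p40 q; lra.
have P3 : 1 + q ^+ 4 <= P by rewrite /P; have := p40 p; lra.
have LL (i : nat) (x : R) : (i <= 5)%N -> 0 <= x -> L ^+ i * x <= L ^+ 5 * x.
  by move=> i5 x0; rewrite ler_wpM2r// ler_weXn2l.
set Q := W * P in WP PW *.
have Q0 : 0 <= Q by rewrite /Q; nneg.
set k := h ^+ 2 * g ^+ 2; set k' := h ^+ 2 * (eta * h).
have k0 : 0 <= k by rewrite /k; nneg.
have k'0 : 0 <= k' by rewrite /k'; nneg.
have kQ0 : 0 <= k * Q by nneg.
have k'Q0 : 0 <= k' * Q by nneg.
have t1 : g ^+ 2 * (h * A * (L * (h * A + h * B))) <= L ^+ 5 * (k * Q).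
  apply: le_trans (LL 1%N _ isT kQ0).
  rewrite (_ : _ * (h * A * _) = L ^+ 1 * (k * (A * (A + B)))); last by rewrite /k; ring.
  by rewrite ler_wpM2l ?exprn_ge0// ler_wpM2l// (le_trans W3).
have t2 : h ^+ 2 * phi * (h * B) <= 2 * (L ^+ 5 * (k' * Q)).
  have := LL 1%N _ isT k'Q0.
  have : h ^+ 2 * phi * (h * B) <= h ^+ 2 * (L * (eta * (2 + A ^+ 2 + B ^+ 2))) * (h * B).
    by rewrite ler_wpM2r ?mulr_ge0// ler_wpM2l ?sqr_ge0.
  rewrite (_ : _ * (L * _) * _ = L ^+ 1 * (k' * ((2 + A ^+ 2 + B ^+ 2) * B))); last by rewrite /k'; ring.
  have : L ^+ 1 * (k' * ((2 + A ^+ 2 + B ^+ 2) * B)) <= L ^+ 1 * (k' * (2 * Q)).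
    by rewrite ler_wpM2l ?exprn_ge0// ler_wpM2l//; lra.
  lra.
have t3 : L ^+ 2 * (g ^+ 2 * (h * A + h * B)) * (h * B) <= L ^+ 5 * (k * Q).
  apply: le_trans (LL 2%N _ isT kQ0).
  rewrite (_ : _ * (h * B) = L ^+ 2 * (k * ((A + B) * B))); last by rewrite /k; ring.
  by rewrite ler_wpM2l ?exprn_ge0// ler_wpM2l// (le_trans W4).
have t4 : 2 * L * (g ^+ 2 * g * (1 + q ^+ 4)) * (h * B) <= 2 * (L ^+ 5 * (k * Q)).
  have := LL 2%N _ isT kQ0.
  have : B * (1 + q ^+ 4) <= Q by rewrite /Q; apply: ler_pM => //; nneg.
  move=> /(ler_wpM2l k0)/(ler_wpM2l (exprn_ge0 2 L0)).
  have : 2 * L * (g ^+ 2 * g * (1 + q ^+ 4)) * (h * B) <= 2 * L * (g ^+ 2 * (L * h) * (1 + q ^+ 4)) * (h * B).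
    rewrite ler_wpM2r ?mulr_ge0// ler_wpM2l ?mulr_ge0// ler_wpM2r ?addr_ge0//.
    by rewrite ler_wpM2l ?sqr_ge0.
  rewrite (_ : 2 * L * (_ * (L * h) * _) * _ = 2 * (L ^+ 2 * (k * (B * (1 + q ^+ 4))))); last by rewrite /k; ring.
  by move=> ? ? ?; lra.
set S := h * A + h * B + p + q.
have S0 : 0 <= S by rewrite /S; nneg.
have t5 : h ^+ 2 * phi + L ^+ 2 * (g ^+ 2 * (h * A + h * B)) + (h ^+ 2 * p + L * (g ^+ 2 * q))
    <= 3 * L ^+ 3 * h ^+ 2 * S.
  have h20 : 0 <= h ^+ 2 by nneg.
  have hA0 : 0 <= h ^+ 2 * (h * A) by nneg.
  have hB0 : 0 <= h ^+ 2 * (h * B) by nneg.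
  have hp0 : 0 <= h ^+ 2 * p by nneg.
  have hq0 : 0 <= h ^+ 2 * q by nneg.
  have L3 (i : nat) (x : R) : (i <= 3)%N -> 0 <= x -> L ^+ i * x <= L ^+ 3 * x.
    by move=> i5 x0; rewrite ler_wpM2r// ler_weXn2l.
  have s1 := ler_wpM2l h20 phi2.
  have s2 : L ^+ 2 * (g ^+ 2 * (h * A + h * B)) <= L ^+ 2 * (L * h ^+ 2 * (h * A + h * B)).
    by rewrite ler_wpM2l ?exprn_ge0// ler_wpM2r//; nneg.
  have s3 : L * (g ^+ 2 * q) <= L * (L * h ^+ 2 * q).
    by rewrite ler_wpM2l// ler_wpM2r.
  have := L3 1%N _ isT hA0; have := L3 0%N _ isT hp0; have := L3 2%N _ isT hq0.
  have := L3 3%N _ isT hA0; have := L3 3%N _ isT hB0.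
  have := mulr_ge0 (exprn_ge0 3 L0) hB0; have := mulr_ge0 (exprn_ge0 3 L0) hp0.
  have := mulr_ge0 (exprn_ge0 3 L0) hq0; rewrite expr0 expr1.
  rewrite /S; move: s1 s2 s3; lra.
have t6 : g ^+ 2 * (L * (h * A + h * B) + q) <= L * (g ^+ 2 * S).
  rewrite [leRHS]mulrCA ler_wpM2l ?sqr_ge0// /S.
  have := ler_wpM2r q0 L1; have := mulr_ge0 L0 p0; lra.
have t7 : (h ^+ 2 * phi + L ^+ 2 * (g ^+ 2 * (h * A + h * B)) + (h ^+ 2 * p + L * (g ^+ 2 * q))) *
    (g ^+ 2 * (L * (h * A + h * B) + q)) <= 3 * L ^+ 3 * h ^+ 2 * S * (L * (g ^+ 2 * S)).
  by apply: ler_pM => //; nneg.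
have S2 : S ^+ 2 <= 8 * L * Q.
  have : S ^+ 2 <= 4 * (h ^+ 2 * (A ^+ 2 + B ^+ 2) + (p ^+ 2 + q ^+ 2)).
    have := sqr_ge0 (h * A - h * B); have := sqr_ge0 (h * A - p); have := sqr_ge0 (h * A - q).
    have := sqr_ge0 (h * B - p); have := sqr_ge0 (h * B - q); have := sqr_ge0 (p - q).
    rewrite /S; lra.
  have : h ^+ 2 * (A ^+ 2 + B ^+ 2) <= L * Q.
    by apply: ler_pM => //; first [exact: (le_trans W2 WP) | nneg].
  have : Q <= L * Q by rewrite ler_peMl.
  by move: P2 PW; lra.
have t8 : L ^+ 4 * k * S ^+ 2 <= L ^+ 4 * k * (8 * L * Q) by rewrite ler_wpM2l//; nneg.
rewrite (_ : 28 * L ^+ 5 * _ * Q = 28 * (L ^+ 5 * (k * Q)) + 28 * (L ^+ 5 * (k' * Q))); last by ring.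
rewrite (_ : 3 * L ^+ 3 * h ^+ 2 * S * _ = 3 * (L ^+ 4 * k * S ^+ 2)) in t7; last by rewrite /k; ring.
have e5 : 0 <= L ^+ 5 * (k' * Q) by nneg.
rewrite [X in _ + X + _ + _]mulrDl.
rewrite (_ : L ^+ 4 * k * (8 * L * Q) = 8 * (L ^+ 5 * (k * Q))) in t8; last by ring.
move: t1 t2 t3 t4 t7 t8 e5; clear.
move: (L ^+ 5 * _) (L ^+ 5 * _) => X Y.
lra.
Qed.

(** [rho], the linearization error of [G], appears squared because Young's inequality has separated
    it from [yhat]. With [eta = h^(1 + deltaG)] this makes [eta^2] equal to [alpha^(1 + deltaG)]. *)
Lemma slow_remainder_le L beta A B h q eta rho G :
  1 <= L -> 0 <= beta -> 0 <= A -> 0 <= B -> 0 <= h -> h ^+ 2 <= L -> 0 <= G -> 0 <= rho ->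
  0 <= eta -> rho <= 2 * L * (eta * (2 + A ^+ 2 + B ^+ 2)) ->
  G <= L * (h * A + h * B) ->
  L * beta * rho ^+ 2 + beta ^+ 2 * G ^+ 2 + beta ^+ 2 * q ^+ 2 <=
  51 * L ^+ 3 * (beta * (eta ^+ 2 + beta)) * ((1 + A ^+ 4 + B ^+ 4) * (1 + q ^+ 4)).
Proof.
move=> L1 b0 A0 B0 h0 hL G0 r0 e0 hr hG.
have L0 : 0 <= L by lra.
set W := 1 + A ^+ 4 + B ^+ 4; set P := 1 + q ^+ 4.
have sq4 (x : R) : x ^+ 4 = (x ^+ 2) ^+ 2 :> R by rewrite -exprM.
have bd (x : R) : x ^+ 2 <= (1 + x ^+ 4) / 2 by have := sqr_ge0 (x ^+ 2 - 1); rewrite sq4; lra.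
have p40 (x : R) : 0 <= x ^+ 4 by rewrite sq4 sqr_ge0.
have W1 : 1 <= W by rewrite /W; have := p40 A; have := p40 B; lra.
have P1 : 1 <= P by rewrite /P; have := p40 q; lra.
have W0 : 0 <= W by lra.
have P0 : 0 <= P by lra.
have WP : W <= W * P by rewrite ler_peMr.
have PW : P <= W * P by rewrite ler_peMl.
have W2 : A ^+ 2 + B ^+ 2 <= W by rewrite /W; have := bd A; have := bd B; have := p40 A; have := p40 B; lra.
have W6 : (2 + A ^+ 2 + B ^+ 2) ^+ 2 <= 12 * W.
  have := sqr_ge0 (A ^+ 2 - 2); have := sqr_ge0 (B ^+ 2 - 2); have := sqr_ge0 (A ^+ 2 - B ^+ 2).
  have := sqr_ge0 (A ^+ 2); have := sqr_ge0 (B ^+ 2); by rewrite /W !sq4; lra.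
have P2 : q ^+ 2 <= P by rewrite /P; have := bd q; have := p40 q; lra.
set Q := W * P in WP PW *.
have Q0 : 0 <= Q by rewrite /Q; nneg.
have t1 : rho ^+ 2 <= 48 * (L ^+ 2 * (eta ^+ 2 * Q)).
  apply: (@le_trans _ _ ((2 * L * (eta * (2 + A ^+ 2 + B ^+ 2))) ^+ 2)).
    by rewrite ler_pXn2r ?nnegrE//; nneg.
  rewrite (_ : _ ^+ 2 = 4 * (L ^+ 2 * (eta ^+ 2 * (2 + A ^+ 2 + B ^+ 2) ^+ 2))); last by ring.
  rewrite (_ : 48 * _ = 4 * (L ^+ 2 * (eta ^+ 2 * (12 * Q)))); last by ring.
  rewrite !ler_wpM2l ?sqr_ge0// (le_trans W6)// ler_wpM2l//.
have t2 : G ^+ 2 <= 2 * (L ^+ 3 * Q).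
  apply: (@le_trans _ _ ((L * (h * A + h * B)) ^+ 2)).
    by rewrite ler_pXn2r ?nnegrE//; nneg.
  have : (A + B) ^+ 2 <= 2 * Q by have := sqr_ge0 (A - B); lra.
  have : 0 <= (A + B) ^+ 2 by nneg.
  move=> /[swap] hAB AB0.
  rewrite (_ : _ ^+ 2 = L ^+ 2 * (h ^+ 2 * (A + B) ^+ 2)); last by ring.
  rewrite (_ : 2 * _ = L ^+ 2 * (L * (2 * Q))); last by ring.
  by rewrite ler_wpM2l ?sqr_ge0//; apply: ler_pM => //; nneg.
have L3 : 1 <= L ^+ 3 by rewrite exprn_ege1.
have t3 := ler_wpM2l (mulr_ge0 L0 b0) t1.
have t4 := ler_wpM2l (sqr_ge0 beta) t2.
have t5 : beta ^+ 2 * q ^+ 2 <= beta ^+ 2 * (L ^+ 3 * Q).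
  rewrite ler_wpM2l ?sqr_ge0// (le_trans P2)// (le_trans PW)// ler_peMl//.
have t6 : 0 <= beta ^+ 2 * (L ^+ 3 * Q) by nneg.
have t7 : 0 <= L ^+ 3 * (beta * eta ^+ 2 * Q) by nneg.
by move: t3 t4 t5 t6 t7; clear; lra.
Qed.
End real_inequalities.

(** * One step of the iteration *)

Section one_step.
Context {R : realType} {dx dy : nat}.
Variables (LH LF LGx LGy muF muG SH deltaH SBF SBG deltaF deltaG : R).
Variables (F : 'cV[R]_dx -> 'cV[R]_dy -> 'cV[R]_dx)
  (G : 'cV[R]_dx -> 'cV[R]_dy -> 'cV[R]_dy)
  (H : 'cV[R]_dy -> 'cV[R]_dx) (ystar : 'cV[R]_dy)
  (B1 : 'M[R]_(dx, dx)) (B2 : 'M[R]_(dy, dx)) (B3 : 'M[R]_(dy, dy)).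
Implicit Types (x : 'cV[R]_dx) (y z psi : 'cV[R]_dy).
Hypothesis hF : lipschitz_FH F H LH LF.
Hypothesis hG : nested_lipschitz_G G H ystar LGx LGy.
Hypothesis hmono : star_strong_monotone F G H ystar muF muG.
Hypothesis hH : locally_linear_H H SH deltaH.
Hypothesis hlin : nested_locally_linear F G H ystar B1 B2 B3 SBF SBG deltaF deltaG.

(* A single bound for all the constants of the problem, used wherever their
   exact values do not matter. *)
Variable L : R.
Hypotheses (L1 : 1 <= L) (LHL : LH <= L) (LFL : LF <= L) (LGxL : LGx <= L)
  (LGyL : LGy <= L) (SHL : SH <= L) (SBFL : SBF <= L) (SBGL : SBG <= L)
  (muFL : muF^-1 <= L) (muGL : muG^-1 <= L).

Let L0 : 0 <= L := le_trans ler01 L1.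

Lemma F_Hy y : F (H y) y = 0. Proof. by have [h _ _ _] := hF; apply/h. Qed.

Lemma G_star : G (H ystar) ystar = 0. Proof. by have [h _ _ _] := hG; apply/h. Qed.

Lemma F_le x y : enorm (F x y) <= LF * enorm (x - H y).
Proof. by have [_ _ _ /(_ x y)] := hF; rewrite F_Hy subr0. Qed.

Lemma G_Hy_le y : enorm (G (H y) y) <= LGy * enorm (y - ystar).
Proof. by have [_ _ _ /(_ y)] := hG; rewrite G_star subr0. Qed.

Lemma G_sub_le x y : enorm (G x y - G (H y) y) <= LGx * enorm (x - H y).
Proof. by have [_ _ h _] := hG. Qed.

Lemma G_le x y : enorm (G x y) <= LGx * enorm (x - H y) + LGy * enorm (y - ystar).
Proof.
rewrite -[G x y](subrK (G (H y) y)) (le_trans (enormD _ _))// lerD// ?G_sub_le//.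
exact: G_Hy_le.
Qed.

Lemma H_le y1 y2 : enorm (H y1 - H y2) <= LH * enorm (y1 - y2).
Proof. by have [_ _ h _] := hF. Qed.

(** Monotonicity and the Lipschitz bound are compared at a unit distance from [ystar], which
    requires a coordinate. The inequality removes [LGy] from the bound on [beta / alpha] contained
    in [kappa]. *)
Lemma muG_le : (dy = 0)%N \/ muG <= LGy.
Proof.
case: (posnP dy) => [->|dy0]; [by left | right].
have [_ _ /(_ (ystar + delta_mx (Ordinal dy0) 0))] := hmono.
rewrite G_star subr0 [ystar + _]addrC addrK enorm_delta expr1n mulr1 => /le_trans; apply.
rewrite (le_trans (dotp_le _ _))// enorm_delta mul1r (le_trans (G_Hy_le _))//.
by rewrite addrK enorm_delta mulr1.
Qed.

(** By (A4), ['d H y v] differs from the difference quotient with step [h], which [LH] bounds, by a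
    multiple of [h^deltaH]. *)
Lemma H_differential_le y (v : 'cV[R]_dy) : enorm ('d H y v) <= LH * enorm v.
Proof.
have [dH S0 /andP[d1 d2] hloc] := hH.
apply: (@le_of_le_Dpow _ _ _ (SH * enorm v `^ (1 + deltaH)) deltaH); first by lra.
move=> h h0.
have := hloc (y + h *: v) y; rewrite [y + _]addrC addrK linearZ enormZ gtr0_norm// => hl.
have hL := H_le (h *: v + y) y; rewrite addrK enormZ gtr0_norm// in hL.
have : enorm (h *: 'd H y v) <= LH * (h * enorm v) + SH * (h * enorm v) `^ (1 + deltaH).
  rewrite -[h *: _](subrK (H (h *: v + y) - H y)) (le_trans (enormD _ _))// addrC lerD//.
  by rewrite enormB.
rewrite enormZ gtr0_norm// (powRM _ (ltW h0) (enorm_ge0 v)).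
rewrite (@powRD _ h); last by rewrite (gt_eqF h0) implybT.
rewrite (powRr1 (ltW h0)).
rewrite (_ : _ + _ = h * (LH * enorm v + SH * enorm v `^ (1 + deltaH) * h `^ deltaH)).
  by rewrite ler_pM2l.
by ring.
Qed.

(** The two bounds have different uses. The one linear in |psi| may be squared with only four
    moments at hand; the other gains [sqrt beta] but exhausts the fourth moment, so it can be used
    to first order only. *)
Lemma H_remainder_le z psi (beta : R) : 0 < beta -> let q := enorm psi in
  let r := H (z - beta *: psi) - H z + beta *: 'd H z psi in
  enorm r <= 2 * L * (beta * q) /\
  enorm r <= 2 * L * (beta * Num.sqrt beta * (1 + q ^+ 4)).
Proof.
move=> b0 q r; have [dH S0 /andP[d1 d2] hloc] := hH.
have q0 : 0 <= q by exact: enorm_ge0.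
have rl : enorm r <= 2 * L * (beta * q).
  have h1 := H_le (z - beta *: psi) z.
  rewrite addrAC subrr add0r enormN enormZ gtr0_norm// -/q in h1.
  have h2 := H_differential_le z psi; rewrite -/q in h2.
  rewrite /r (le_trans (enormD _ _))// enormZ gtr0_norm//.
  have bq : 0 <= beta * q by nneg.
  have : LH * (beta * q) <= L * (beta * q) by rewrite ler_wpM2r.
  have : beta * enorm ('d H z psi) <= beta * (LH * q) by rewrite ler_wpM2l ?(ltW b0).
  lra.
split=> //.
have sq : q * Num.sqrt q <= 1 + q ^+ 4.
  have [q1|q1] := leP q 1.
    have s1 : Num.sqrt q <= 1 by rewrite -[leRHS]sqrtr1 ler_wsqrtr.
    have : q * Num.sqrt q <= 1 * 1 by rewrite ler_pM// sqrtr_ge0.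
    have : 0 <= q ^+ 4 by nneg.
    lra.
  have s1 : 1 <= Num.sqrt q by rewrite -[leLHS]sqrtr1 ler_wsqrtr ?ltW.
  have s2 := sqr_sqrtr q0.
  have q2 : 1 <= q ^+ 2 by rewrite exprn_ege1// ltW.
  have -> : q ^+ 4 = q ^+ 2 * q ^+ 2 by rewrite -exprD.
  have : Num.sqrt q <= q by rewrite -[leRHS]s2 expr2 ler_peMr ?sqrtr_ge0.
  nra.
have bsq : beta * q * Num.sqrt (beta * q) <= beta * Num.sqrt beta * (1 + q ^+ 4).
  rewrite sqrtrM ?(ltW b0)// (_ : _ * _ = beta * Num.sqrt beta * (q * Num.sqrt q)).
    by rewrite ler_wpM2l//; nneg.
  by ring.
have [bq1|bq1] := leP (beta * q) 1.
  have := hloc (z - beta *: psi) z; rewrite (addrAC z) subrr add0r.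
  rewrite ['d H z (- _)]linearN ['d H z (_ *: _)]linearZ opprK enormN enormZ gtr0_norm// -/q -/r => /le_trans; apply.
  have bq0 : 0 <= beta * q <= 1 by rewrite bq1 andbT; nneg.
  have h := powR_le_sqrt bq0 d1.
  apply: (@le_trans _ _ (L * (beta * Num.sqrt beta * (1 + q ^+ 4)))).
    rewrite ler_pM//; try nneg; exact: (le_trans h).
  have : 0 <= L * (beta * Num.sqrt beta * (1 + q ^+ 4)) by nneg.
  lra.
(* For [beta q > 1] the Lipschitz bound is itself below [(beta q)^(3/2)]. *)
apply: (le_trans rl); rewrite ler_wpM2l//; first by nneg.
apply: le_trans bsq; rewrite ler_peMr//; first by nneg.
by rewrite -[leLHS]sqrtr1 ler_wsqrtr ?ltW.
Qed.

(** * Contraction of the noiseless iterates *)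

Section step.
Variables (alpha beta : R).
Hypotheses (a0 : 0 < alpha) (b0 : 0 < beta) (ha : alpha <= iota1 muF LF)
  (hb : beta <= iota2 muG LGy) (hk : beta / alpha <= kappa dx muF muG LH LGx LGy).
Hypothesis muFGL : muF / (5 * muG) <= L.

Let muF0 : 0 < muF. Proof. by have [[]] := hmono. Qed.
Let muG0 : 0 < muG. Proof. by have [[]] := hmono. Qed.
Let LH0 : 0 < LH. Proof. by have [_ []] := hF. Qed.
Let LF0 : 0 < LF. Proof. by have [_ []] := hF. Qed.
Let LGx0 : 0 < LGx. Proof. by have [_ []] := hG. Qed.
Let LGy0 : 0 < LGy. Proof. by have [_ []] := hG. Qed.

Lemma step_alpha : alpha * muF <= 1 / 12 /\ alpha * LF ^+ 2 <= muF / 4.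
Proof.
move: ha; rewrite le_min => /andP[].
rewrite ler_pdivlMr ?mulr_gt0 ?exprn_gt0// => h1.
by rewrite ler_pdivlMr ?mulr_gt0// => h2; split; lra.
Qed.

Lemma step_beta : beta * muG <= 1 / 14 /\ beta * LGy ^+ 2 <= muG.
Proof.
move: hb; rewrite le_min => /andP[].
rewrite ler_pdivlMr ?mulr_gt0 ?exprn_gt0// => h1.
by rewrite ler_pdivlMr ?mulr_gt0// => h2; split; lra.
Qed.

Lemma step_ratio :
  beta * (200 * LGy * LH * LGx) <= alpha * (muF * muG) /\
  5 * (beta * muG) <= alpha * muF.
Proof.
have m0 : 0 < Num.max (28 * dx%:R) (200 * LGy) by rewrite lt_max (mulr_gt0 _ LGy0) ?orbT ?ltr0n.
move: hk; rewrite le_min => /andP[].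
rewrite ler_pdivrMr// mulrAC ler_pdivlMr ?mulr_gt0// => h1.
rewrite ler_pdivrMr// mulrAC ler_pdivlMr ?mulr_gt0// => h2.
split; last by lra.
rewrite mulrC in h1; rewrite mulrC [leRHS]mulrC (le_trans _ h1)//.
by rewrite ler_wpM2r ?(ltW b0)// !ler_wpM2r ?(ltW LH0) ?(ltW LGx0)// le_max lexx orbT.
Qed.

Lemma step_le : [/\ alpha <= L, beta <= L & beta <= L * alpha].
Proof.
have [h1 _] := step_alpha; have [h2 _] := step_beta; have [_ h3] := step_ratio.
split.
- apply: le_trans muFL; rewrite -[leRHS]mul1r ler_pdivlMr//; lra.
- apply: le_trans muGL; rewrite -[leRHS]mul1r ler_pdivlMr//; lra.
- apply: (@le_trans _ _ (muF / (5 * muG) * alpha)); last by rewrite ler_wpM2r// ltW.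
  by rewrite mulrAC ler_pdivlMr ?mulr_gt0//; lra.
Qed.

(** Monotonicity gives the rate 2, of which the second-order term [alpha^2 LF^2] takes a quarter, by
    the first condition in [iota1]. *)
Lemma F_step_le x y :
  enorm (x - H y - alpha *: F x y) ^+ 2 <= (1 - 7 / 4 * (alpha * muF)) * enorm (x - H y) ^+ 2.
Proof.
have [_ hL] := step_alpha.
have [_ /(_ x y) hm _] := hmono; rewrite F_Hy subr0 in hm.
rewrite [leLHS]enorm_sqrB enormZ gtr0_norm// dotpZr.
set a := enorm (x - H y) in hm *.
have h1 : enorm (F x y) ^+ 2 <= LF ^+ 2 * a ^+ 2.
  by rewrite -exprMn ler_pXn2r ?nnegrE ?F_le//; nneg.
have h2 : alpha ^+ 2 * enorm (F x y) ^+ 2 <= alpha ^+ 2 * (LF ^+ 2 * a ^+ 2).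
  by rewrite ler_wpM2l ?sqr_ge0.
have h3 : alpha * (alpha * LF ^+ 2) * a ^+ 2 <= alpha * (muF / 4) * a ^+ 2.
  by rewrite ler_wpM2r ?sqr_ge0// ler_wpM2l ?(ltW a0).
have h4 : alpha * (muF * a ^+ 2) <= alpha * dotp (x - H y) (F x y).
  by rewrite ler_wpM2l ?(ltW a0).
rewrite exprMn; lra.
Qed.

Lemma slow_drift_le x y :
  enorm (H y - H (y - beta *: G x y)) <=
    alpha * muF / 200 * enorm (x - H y) + beta * LH * LGy * enorm (y - ystar).
Proof.
set a := enorm (x - H y); set b := enorm (y - ystar).
have a'0 : 0 <= a by nneg.
have b'0 : 0 <= b by nneg.
have h := H_le y (y - beta *: G x y).
rewrite opprB [in X in _ <= X]addrC subrK enormZ gtr0_norm// in h.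
have [dy0|muLy] := muG_le.
  have -> : y - beta *: G x y = y.
    by apply/matrixP => i; have := ltn_ord i; rewrite [X in (_ < X)%N]dy0.
  by rewrite subrr enorm0; nneg.
apply: (le_trans h).
have h1 : LH * (beta * enorm (G x y)) <= LH * (beta * (LGx * a + LGy * b)).
  by rewrite ler_wpM2l ?(ltW LH0)// ler_wpM2l ?(ltW b0)// G_le.
have [h2 _] := step_ratio.
have h3 : beta * LH * LGx <= alpha * muF / 200.
  have h4 : 200 * (beta * LH * LGx) * LGy <= alpha * muF * LGy.
    apply: (@le_trans _ _ (alpha * muF * muG)); first by lra.
    by rewrite ler_wpM2l//; nneg.
  by rewrite ler_pM2r// in h4; lra.
have : beta * LH * LGx * a <= alpha * muF / 200 * a by rewrite ler_wpM2r.
lra.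
Qed.

(* The next iterates without their noise; [H] is linearized at [slow_drift],
   which, unlike the next slow iterate, is determined by the past. *)
Definition slow_drift x y := y - beta *: G x y.
Definition slow_mean x y := y - ystar - beta *: G x y.
Definition fast_mean x y := x - alpha *: F x y - H (slow_drift x y).

Lemma fast_mean_le x y :
  enorm (fast_mean x y) ^+ 2 <= (1 - 3 / 2 * (alpha * muF)) * enorm (x - H y) ^+ 2 +
    11 * (beta * LH * LGy * enorm (y - ystar)) ^+ 2 / (alpha * muF).
Proof.
have hd := slow_drift_le x y; have hf := F_step_le x y; have [hm _] := step_alpha.
have -> : fast_mean x y = x - H y - alpha *: F x y + (H y - H (slow_drift x y)).
  by rewrite /fast_mean addrA [x - H y - _ + _]addrAC subrK.
rewrite -/(slow_drift x y) in hd.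
set k := beta * LH * LGy * _ in hd *.
have k0 : 0 <= k by rewrite /k; nneg.
set p := x - H y - _ in hf *; set q := H y - _ in hd *; set a := enorm (x - H y) in hd hf *.
have m0 : 0 < alpha * muF <= 12^-1 by rewrite mulr_gt0//=; lra.
apply: le_trans (sqr_contraction_perturbed m0 _ _ k0 hf); try by nneg.
rewrite ler_pXn2r ?nnegrE//; try by nneg.
by rewrite (le_trans (enormD _ _))// lerD2l.
Qed.

(** [G] is split at [(H y, y)]. The first condition in [iota2] gives [beta^2 LGy^2 <= beta muG], so
    half of the monotonicity rate survives; the dependence on [xhat] is then a shift as in
    [sqr_shift_le]. *)
Lemma slow_mean_le x y :
  enorm (slow_mean x y) ^+ 2 <= (1 - 3 / 4 * (beta * muG)) * enorm (y - ystar) ^+ 2 +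
    5 * (beta / muG) * LGx ^+ 2 * enorm (x - H y) ^+ 2.
Proof.
have [hm hL] := step_beta.
have [_ _ /(_ y)] := hmono; rewrite G_star subr0 => hmy.
have hg := G_sub_le x y; have hy := G_Hy_le y.
have -> : slow_mean x y = (y - ystar - beta *: G (H y) y) - beta *: (G x y - G (H y) y).
  by rewrite /slow_mean scalerBr opprB addrA subrK.
set p := y - ystar - _; set a := enorm (x - _) in hg *; set b := enorm (y - _) in hmy hy *.
have a'0 : 0 <= a by rewrite /a; nneg.
have b'0 : 0 <= b by rewrite /b; nneg.
have hp : enorm p ^+ 2 <= (1 - beta * muG) * b ^+ 2.
  rewrite enorm_sqrB enormZ gtr0_norm// dotpZr exprMn -/b.
  have h1 : beta * (muG * b ^+ 2) <= beta * dotp (y - ystar) (G (H y) y).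
    by rewrite ler_wpM2l ?(ltW b0).
  have h2 : beta ^+ 2 * enorm (G (H y) y) ^+ 2 <= beta ^+ 2 * (LGy * b) ^+ 2.
    by rewrite ler_wpM2l ?sqr_ge0// ler_pXn2r// nnegrE; nneg.
  have h3 : beta * b ^+ 2 * (beta * LGy ^+ 2) <= beta * b ^+ 2 * muG.
    by rewrite ler_wpM2l//; nneg.
  lra.
have hd : enorm (p - beta *: (G x y - G (H y) y)) ^+ 2 <= (enorm p + beta * (LGx * a)) ^+ 2.
  rewrite ler_pXn2r ?nnegrE; [|by []|by nneg|by nneg].
  by rewrite (le_trans (enormB_le _ _))// lerD2l enormZ gtr0_norm// ler_wpM2l ?(ltW b0).
apply: (le_trans hd).
have m0 : 0 < beta * muG <= 14^-1 by rewrite mulr_gt0//=; lra.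
rewrite (le_trans (sqr_shift_le _ m0 _ hp))//; first by nneg.
rewrite lerD2l le_eqVlt; apply/orP; left; apply/eqP.
by field; rewrite !gt_eqF.
Qed.

(* Chosen so that the drift of [weight * |xhat|^2] absorbs four times the
   coupling term [5 (beta / muG) LGx^2 |xhat|^2] of [slow_mean_le]. *)
Definition lyapunov_weight : R := 20 * LGx ^+ 2 / (muF * muG) * (beta / alpha).
Hypothesis omegaL : 20 * LGx ^+ 2 / (muF * muG) <= L.

(** The feedback of [yhat] through the fast iterate costs [220 / 200^2] of [beta muG], which fits
    between 3/4 and 7/10. On the fast side the coupling takes a quarter of [alpha muF] out of 3/2,
    and the rest is far above [beta muG] because [5 beta muG <= alpha muF]. *)
Lemma lyapunov_mean_le x y :
  enorm (slow_mean x y) ^+ 2 + lyapunov_weight * enorm (fast_mean x y) ^+ 2 <=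
  (1 - 7 / 10 * (beta * muG)) *
    (enorm (y - ystar) ^+ 2 + lyapunov_weight * enorm (x - H y) ^+ 2).
Proof.
have hu := slow_mean_le x y; have hv := fast_mean_le x y.
have [hr1 hr2] := step_ratio.
move: (enorm (slow_mean x y)) (enorm (fast_mean x y)) (enorm (x - H y)) (enorm (y - ystar)) hu hv.
move=> u v a b hu hv; set w := lyapunov_weight.
have w0 : 0 <= w by rewrite /w /lyapunov_weight; nneg.
pose tau := beta * LGx * LH * LGy / (alpha * muF).
have tau1 : tau <= muG / 200.
  by rewrite /tau ler_pdivrMr ?mulr_gt0//; lra.
have tau0 : 0 <= tau by rewrite /tau; nneg.
have e1 : w * (11 * (beta * LH * LGy * b) ^+ 2 / (alpha * muF)) =
    220 * (beta / muG) * tau ^+ 2 * b ^+ 2.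
  by rewrite /w /tau /lyapunov_weight; field; rewrite !gt_eqF.
have e2 : w * (alpha * muF) = 20 * (beta / muG) * LGx ^+ 2.
  by rewrite /w /lyapunov_weight; field; rewrite !gt_eqF.
have e3 : 220 * (beta / muG) * tau ^+ 2 * b ^+ 2 <= 220 * (beta / muG) * (muG / 200) ^+ 2 * b ^+ 2.
  apply: ler_wpM2r; [by nneg | apply: ler_wpM2l; first by nneg].
  by rewrite ler_pXn2r ?nnegrE//; nneg.
have e4 : 220 * (beta / muG) * (muG / 200) ^+ 2 * b ^+ 2 = 220 / (200 * 200) * (beta * muG) * b ^+ 2.
  by field; rewrite gt_eqF.
have e5 := ler_wpM2l w0 hv.
have e6 : w * a ^+ 2 * (5 * (beta * muG)) <= w * a ^+ 2 * (alpha * muF).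
  by rewrite ler_wpM2l//; nneg.
have e7 : 0 <= beta * muG * b ^+ 2 by nneg.
have e8 : 0 <= w * a ^+ 2 * (beta * muG) by nneg.
have e9 : w * (alpha * muF) * a ^+ 2 = 20 * (beta / muG) * LGx ^+ 2 * a ^+ 2 by rewrite e2.
rewrite e4 in e3.
lra.
Qed.

(** * Squares of the Lyapunov function and of |xhat|^2 after a noisy step *)

Section noisy_step.
Variables (x : 'cV[R]_dx) (y : 'cV[R]_dy) (xi : 'cV[R]_dx) (psi : 'cV[R]_dy).
Let x' := x - alpha *: (F x y + xi).
Let y' := y - beta *: (G x y + psi).
Let v := fast_mean x y.
Let u := slow_mean x y.
Let z := slow_drift x y.
Let r := H (z - beta *: psi) - H z + beta *: 'd H z psi.

(** The part of the fast noise that is linear in [xi] and [psi], so that it is centred given the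
    past; the remainder [r] of [H] is the other part. *)
Definition fast_noise : 'cV[R]_dx := beta *: 'd H (slow_drift x y) psi - alpha *: xi.

Lemma slow_next : y' - ystar = u - beta *: psi.
Proof. by apply/matrixP => i j; rewrite /y' /u /slow_mean !mxE; ring. Qed.

Lemma fast_next : x' - H y' = v + (fast_noise - r).
Proof.
have -> : y' = z - beta *: psi by rewrite /y' scalerDr opprD addrA.
rewrite /r /fast_noise /v /fast_mean /x' -/z scalerDr.
set X := alpha *: F x y; set Y := alpha *: xi; set D := beta *: _.
by apply/matrixP => i j; rewrite !mxE; ring.
Qed.

(** The differential cancels between [fast_noise] and [r], leaving an increment of [H] to which the
    Lipschitz bound applies. *)
Lemma fast_next_sub_le :
  enorm (fast_noise - r) <= alpha * enorm xi + L * (beta * enorm psi).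
Proof.
have -> : fast_noise - r = - (alpha *: xi) - (H (z - beta *: psi) - H z).
  rewrite /r /fast_noise -/z; set D := beta *: _.
  by apply/matrixP => i j; rewrite !mxE; ring.
rewrite (le_trans (enormB_le _ _))// enormN enormZ gtr0_norm// lerD2l.
rewrite (le_trans (H_le _ _))// addrAC subrr add0r enormN enormZ gtr0_norm//.
by rewrite ler_wpM2r//; nneg.
Qed.

Lemma normr_dotp_fast_noise_le a :
  `|dotp a fast_noise| <= enorm a * (alpha * enorm xi + L * (beta * enorm psi)).
Proof.
rewrite (le_trans (normr_dotp_le _ _))// ler_wpM2l ?enorm_ge0//.
rewrite (le_trans (enormB_le _ _))// addrC lerD// enormZ gtr0_norm//.
rewrite mulrCA ler_wpM2l ?(ltW b0)// (le_trans (H_differential_le _ _))//.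
by rewrite ler_wpM2r//; nneg.
Qed.

Let g := Num.sqrt beta.
Let h := Num.sqrt alpha.
Let gE : g ^+ 2 = beta. Proof. by rewrite sqr_sqrtr ?ltW. Qed.
Let hE : h ^+ 2 = alpha. Proof. by rewrite sqr_sqrtr ?ltW. Qed.
Let h4E : h ^+ 4 = alpha ^+ 2. Proof. by rewrite -hE -exprM. Qed.

Definition lyapunov_martingale : R :=
  2 * lyapunov_weight * dotp v fast_noise - 2 * beta * dotp u psi.

Lemma lyapunov_sqr_le eps s2 : 0 < eps ->
  s2 = enorm u ^+ 2 + lyapunov_weight * enorm v ^+ 2 ->
  (enorm (y' - ystar) ^+ 2 + lyapunov_weight * enorm (x' - H y') ^+ 2) ^+ 2 <=
  s2 ^+ 2 + 2 * s2 * lyapunov_martingale +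
  beta * (eps * s2 ^+ 2 + perturb_const (4 * L ^+ 7) L eps * alpha ^+ 2) *
    (1 + enorm xi ^+ 4 + enorm psi ^+ 4).
Proof.
move=> e0 s2E; have [r1 r2] := H_remainder_le z psi b0.
have [aL bL baL] := step_le.
have w0 : 0 <= lyapunov_weight by rewrite /lyapunov_weight; nneg.
have s20 : 0 <= s2 by rewrite s2E; nneg.
have h0 : 0 < h by rewrite sqrtr_gt0.
have om : 0 <= 20 * LGx ^+ 2 / (muF * muG) <= L by rewrite omegaL andbT; nneg.
have gh : g ^+ 2 <= L * h ^+ 2 by rewrite gE hE.
have wE : lyapunov_weight = 20 * LGx ^+ 2 / (muF * muG) * (g ^+ 2 / h ^+ 2).
  by rewrite gE hE.
have ss : Num.sqrt s2 ^+ 2 = enorm u ^+ 2 + lyapunov_weight * enorm v ^+ 2.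
  by rewrite sqr_sqrtr.
have r1' : enorm r <= 2 * L * (g ^+ 2 * enorm psi) by rewrite gE.
have r2' : enorm r <= 2 * L * (g ^+ 2 * g * (1 + enorm psi ^+ 4)) by rewrite gE.
have n1 : enorm (fast_noise - r) <= h ^+ 2 * enorm xi + L * (g ^+ 2 * enorm psi).
  by rewrite gE hE fast_next_sub_le.
have [k1 k2 k3 k4] := weighted_noise_le L1 (sqrtr_ge0 beta) h0 (sqrtr_ge0 s2)
  (enorm_ge0 u) (enorm_ge0 v) (enorm_ge0 xi) (enorm_ge0 psi) (enorm_ge0 r)
  (enorm_ge0 (fast_noise - r)) om gh wE ss r1' r2' n1.
(* The terms beyond first order. In [sqr_perturbed_le] the term with [r] is bounded by [N1] and the
   two squares by [N2]. *)
pose N := beta ^+ 2 * enorm psi ^+ 2 +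
  lyapunov_weight * (enorm (fast_noise - r) ^+ 2 - 2 * dotp v r).
have -> : enorm (y' - ystar) ^+ 2 + lyapunov_weight * enorm (x' - H y') ^+ 2 =
    Num.sqrt s2 ^+ 2 + lyapunov_martingale + N.
  rewrite slow_next fast_next (enorm_sqrB u) enormZ gtr0_norm// dotpZr (enorm_sqrD v).
  rewrite dotpDr dotpNr ss /lyapunov_martingale /N; ring.
have -> : s2 ^+ 2 = Num.sqrt s2 ^+ 4 by rewrite -[in LHS](sqr_sqrtr s20) -exprM.
rewrite -[X in 2 * X * _](sqr_sqrtr s20) -h4E -[X in X * (eps * _ + _)]gE.
apply: (sqr_perturbed_le _ L0 e0 _ _ _ _ _ _ _ _ _ _ k2 k3 k4); try nneg.
- have : 1 <= L ^+ 7 by rewrite exprn_ege1.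
  lra.
- by rewrite gE.
- apply: le_trans k1; rewrite /lyapunov_martingale (le_trans (ler_normB _ _))//.
  rewrite addrC; apply: lerD.
    rewrite -mulrA normrM ger0_norm// ler_wpM2l// normrM gE ger0_norm ?(ltW b0)//.
    by rewrite ler_wpM2l ?(ltW b0)// normr_dotp_le.
  rewrite -mulrA normrM ger0_norm// ler_wpM2l// normrM ger0_norm// gE hE ler_wpM2l//.
  exact: normr_dotp_fast_noise_le.
- rewrite /N (_ : _ + _ = beta ^+ 2 * enorm psi ^+ 2 + lyapunov_weight * enorm (fast_noise - r) ^+ 2
     - 2 * (lyapunov_weight * dotp v r)); last by ring.
  have -> : g ^+ 4 = beta ^+ 2 by rewrite -gE -exprM.
  rewrite [leRHS]addrC (le_trans (ler_normB _ _))//; apply: lerD.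
    by rewrite ger0_norm//; nneg.
  rewrite (normrM 2) (normrM lyapunov_weight) (ger0_norm (ler0n _ 2)) (ger0_norm w0).
  by rewrite ler_wpM2l// ler_wpM2l// normr_dotp_le.
Qed.

(** The argument of [lyapunov_sqr_le] with slow part 0 and weight 1, on the time scale [alpha]:
    [sqrt alpha] replaces [sqrt beta] as well. Passing from [beta^(3/2)] to [alpha^(3/2)] turns [L]
    into [L^3], hence the exponent 21. *)
Lemma fast_sqr_le eps : 0 < eps ->
  (enorm (x' - H y') ^+ 2) ^+ 2 <=
  (enorm v ^+ 2) ^+ 2 + 2 * enorm v ^+ 2 * (2 * dotp v fast_noise) +
  alpha * (eps * (enorm v ^+ 2) ^+ 2 + perturb_const (4 * L ^+ 21) L eps * alpha ^+ 2) *
    (1 + enorm xi ^+ 4 + enorm psi ^+ 4).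
Proof.
move=> e0; have [r1 r2] := H_remainder_le z psi b0.
have [aL bL baL] := step_le.
have h0 : 0 < h by rewrite sqrtr_gt0.
have L3 : 1 <= L ^+ 3 by rewrite exprn_ege1.
have L3L : L <= L ^+ 3 by rewrite -[leLHS]expr1 ler_weXn2l.
have L2L : L ^+ 2 <= L ^+ 3 by rewrite ler_weXn2l.
have om : 0 <= (1 : R) <= L ^+ 3 by rewrite L3 andbT.
have gL : g <= L * h.
  rewrite -(ler_pXn2r (n:=2))// ?nnegrE ?sqrtr_ge0//; last by nneg.
  rewrite exprMn gE hE (le_trans baL)// ler_wpM2r ?(ltW a0)//.
  by rewrite expr2 ler_peMr.
have gh : h ^+ 2 <= L ^+ 3 * h ^+ 2 by rewrite ler_peMl//; nneg.
have wE : 1 = 1 * (h ^+ 2 / h ^+ 2) by rewrite mul1r divff// expf_neq0// gt_eqF.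
have ss : enorm v ^+ 2 = 0 ^+ 2 + 1 * enorm v ^+ 2 by rewrite expr0n/= add0r mul1r.
have bq : L * (beta * enorm psi) <= L ^+ 3 * (h ^+ 2 * enorm psi).
  rewrite hE !mulrA ler_wpM2r//; first by nneg.
  apply: (@le_trans _ _ (L ^+ 2 * alpha)); last by rewrite ler_wpM2r ?(ltW a0).
  by rewrite expr2 -mulrA ler_wpM2l.
have r1' : enorm r <= 2 * L ^+ 3 * (h ^+ 2 * enorm psi) by move: r1 bq; lra.
have r2' : enorm r <= 2 * L ^+ 3 * (h ^+ 2 * h * (1 + enorm psi ^+ 4)).
  apply: (le_trans r2); rewrite -[2 * L ^+ 3 * _]mulrA -[2 * L * _]mulrA ler_wpM2l//.
  rewrite hE [leLHS]mulrA [leRHS]mulrA ler_wpM2r//; first by nneg.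
  rewrite [leLHS]mulrA (_ : L ^+ 3 * _ = L * (L * alpha) * (L * h)); last by ring.
  apply: ler_pM; try by nneg.
    by rewrite ler_wpM2l.
  by [].
have n1 : enorm (fast_noise - r) <= h ^+ 2 * enorm xi + L ^+ 3 * (h ^+ 2 * enorm psi).
  by rewrite (le_trans fast_next_sub_le)// hE lerD2l -hE.
have := weighted_noise_le L3 (ltW h0) h0 (enorm_ge0 v)
  (lexx 0) (enorm_ge0 v) (enorm_ge0 xi) (enorm_ge0 psi) (enorm_ge0 r)
  (enorm_ge0 (fast_noise - r)) om gh wE ss r1' r2' n1.
rewrite -[(L ^+ 3) ^+ 7]exprM => -[k1 k2 k3 k4].
pose N := enorm (fast_noise - r) ^+ 2 - 2 * dotp v r.
have -> : enorm (x' - H y') ^+ 2 = enorm v ^+ 2 + 2 * dotp v fast_noise + N.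
  rewrite fast_next (enorm_sqrD v) dotpDr dotpNr /N; ring.
rewrite -h4E -[X in X * (eps * _ + _)]hE -[(enorm v ^+ 2) ^+ 2]exprM.
apply: (sqr_perturbed_le _ L0 e0 _ _ _ _ _ _ _ _ _ _ k2 k3 k4); try nneg.
- have : 1 <= L ^+ (3 * 7) by rewrite exprn_ege1.
  lra.
- by rewrite hE.
- apply: le_trans k1; rewrite mul0r mulr0 mulr0 add0r mul1r normrM ger0_norm// ler_wpM2l//.
  rewrite (le_trans (normr_dotp_fast_noise_le _))// ler_wpM2l ?enorm_ge0// hE lerD2l.
  by rewrite -hE.
- have -> : h ^+ 4 * enorm psi ^+ 2 + 1 * enorm (fast_noise - r) ^+ 2 =
      enorm (fast_noise - r) ^+ 2 + h ^+ 4 * enorm psi ^+ 2 by ring.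
  rewrite /N [leRHS]addrC (le_trans (ler_normB _ _))//; apply: lerD.
    by rewrite ger0_norm ?lerDl; nneg.
  by rewrite normrM ger0_norm// mul1r ler_wpM2l// normr_dotp_le.
Qed.

End noisy_step.

(** * The linear parts [B1] and [B2], obtained by scaling at [ystar] *)

Let deltaF0 : 0 < deltaF. Proof. by have [_ /andP[]] := hlin. Qed.
Let deltaG0 : 0 < deltaG. Proof. by have [_ _ /andP[]] := hlin. Qed.

Lemma F_expansion_le (h : R) (w : 'cV[R]_dx) : 0 < h ->
  enorm (F (H ystar + h *: w) ystar - h *: (B1 *m w)) <=
  h * (SBF * enorm w `^ (1 + deltaF) * h `^ deltaF).
Proof.
move=> h0; have [_ /andP[d0 _] _ /(_ (H ystar + h *: w) ystar) + _] := hlin.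
rewrite [H ystar + _ - _]addrAC subrr add0r -scalemxAr subrr enorm0 powR0; last by rewrite gt_eqF ?addr_gt0.
rewrite addr0 enormZ gtr0_norm// (powRM _ (ltW h0) (enorm_ge0 w)).
rewrite (@powRD _ h); last by rewrite (gt_eqF h0) implybT.
by rewrite (powRr1 (ltW h0)) => /le_trans; apply; rewrite le_eqVlt; apply/orP; left; apply/eqP; ring.
Qed.

Lemma G_expansion_le (h : R) (w : 'cV[R]_dx) : 0 < h ->
  enorm (G (H ystar + h *: w) ystar - h *: (B2 *m w)) <=
  h * (SBG * enorm w `^ (1 + deltaG) * h `^ deltaG).
Proof.
move=> h0; have [_ _ /andP[d0 _] _ /(_ (H ystar + h *: w) ystar)] := hlin.
rewrite [H ystar + _ - _]addrAC subrr add0r -scalemxAr subrr mulmx0 subr0 enorm0 powR0; last by rewrite gt_eqF ?addr_gt0.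
rewrite addr0 enormZ gtr0_norm// (powRM _ (ltW h0) (enorm_ge0 w)).
rewrite (@powRD _ h); last by rewrite (gt_eqF h0) implybT.
by rewrite (powRr1 (ltW h0)) => /le_trans; apply; rewrite le_eqVlt; apply/orP; left; apply/eqP; ring.
Qed.

Lemma B1_le (w : 'cV[R]_dx) : enorm (B1 *m w) <= LF * enorm w.
Proof.
apply: (@le_of_le_Dpow _ _ _ (SBF * enorm w `^ (1 + deltaF)) deltaF) => // h h0.
rewrite -(ler_pM2l h0) -{1}(gtr0_norm h0) -enormZ -[h *: _](subKr (F (H ystar + h *: w) ystar)).
rewrite (le_trans (enormB_le _ _))// mulrDr lerD ?F_expansion_le//.
by rewrite (le_trans (F_le _ _))// addrAC subrr add0r enormZ gtr0_norm// mulrCA.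
Qed.

Lemma B2_le (w : 'cV[R]_dx) : enorm (B2 *m w) <= LGx * enorm w.
Proof.
apply: (@le_of_le_Dpow _ _ _ (SBG * enorm w `^ (1 + deltaG)) deltaG) => // h h0.
rewrite -(ler_pM2l h0) -{1}(gtr0_norm h0) -enormZ -[h *: _](subKr (G (H ystar + h *: w) ystar)).
rewrite (le_trans (enormB_le _ _))// mulrDr lerD ?G_expansion_le//.
by rewrite (le_trans (G_le _ _))// addrAC subrr add0r subrr enorm0 mulr0 addr0 enormZ gtr0_norm// mulrCA.
Qed.

(** The bound [F_step_le] at the point [H ystar + h w] becomes a bound on the linear part as
    [h -> 0]. Taking the square root halves the rate: 1 - 7/4 m <= (1 - 7/8 m)^2. *)
Lemma B1_contraction (w : 'cV[R]_dx) :
  enorm (w - alpha *: (B1 *m w)) <= (1 - 7 / 8 * (alpha * muF)) * enorm w.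
Proof.
have [hm _] := step_alpha.
apply: (@le_of_le_Dpow _ _ _ (alpha * (SBF * enorm w `^ (1 + deltaF))) deltaF) => // h h0.
rewrite -(ler_pM2l h0) -{1}(gtr0_norm h0) -enormZ.
have -> : h *: (w - alpha *: (B1 *m w)) = h *: w - alpha *: F (H ystar + h *: w) ystar +
    alpha *: (F (H ystar + h *: w) ystar - h *: (B1 *m w)).
  by apply/matrixP => i j; rewrite !mxE; ring.
rewrite (le_trans (enormD _ _))// mulrDr lerD//; last first.
  rewrite enormZ gtr0_norm// -!mulrA [leRHS]mulrCA ler_wpM2l ?(ltW a0)// !mulrA.
  by have := F_expansion_le w h0; rewrite !mulrA.
have hs := F_step_le (H ystar + h *: w) ystar.
rewrite [_ + h *: w - H ystar]addrAC subrr add0r enormZ gtr0_norm// in hs.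
have w0 := enorm_ge0 w.
have mu0 := mulr_gt0 a0 muF0.
rewrite -(ler_pXn2r (n:=2))// ?nnegrE ?enorm_ge0//; last first.
  by rewrite mulr_ge0 ?(ltW h0)// mulr_ge0//; lra.
apply: (le_trans hs).
rewrite [h * (_ * _)]mulrCA [leRHS]exprMn ler_wpM2r ?sqr_ge0//.
have := sqr_ge0 (alpha * muF); lra.
Qed.

Lemma enorm_B2_col i : enorm (col i B2) <= LGx.
Proof. by rewrite colE (le_trans (B2_le _))// enorm_delta mulr1. Qed.

(* The fourth powers of [xhat] and [yhat] in units of their typical size
   [alpha^2]. *)
Definition size4 x y : R :=
  1 + enorm (x - H y) ^+ 4 / alpha ^+ 2 + enorm (y - ystar) ^+ 4 / alpha ^+ 2.

Lemma size4_ge1 x y : 1 <= size4 x y.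
Proof. by rewrite /size4 -addrA lerDl; nneg. Qed.

Let h := Num.sqrt alpha.
Let g := Num.sqrt beta.
Let h0 : 0 < h. Proof. by rewrite sqrtr_gt0. Qed.
Let gE : g ^+ 2 = beta. Proof. by rewrite sqr_sqrtr ?ltW. Qed.
Let hE : h ^+ 2 = alpha. Proof. by rewrite sqr_sqrtr ?ltW. Qed.

Let size4E x y : size4 x y =
  1 + (enorm (x - H y) / h) ^+ 4 + (enorm (y - ystar) / h) ^+ 4.
Proof.
have h4 : h ^+ 4 = alpha ^+ 2 by rewrite -hE -exprM.
by rewrite /size4 !expr_div_n h4.
Qed.

Let scaleE (a : R) : h * (a / h) = a.
Proof. by rewrite mulrCA divff ?mulr1// gt_eqF. Qed.

Let powR_scale_le (a d : R) : 0 <= a -> 0 < d <= 1 ->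
  a `^ (1 + d) <= h `^ (1 + d) * (1 + (a / h) ^+ 2).
Proof.
move=> a'0 /andP[d0 d1]; rewrite -{1}(scaleE a) powRM; [|exact: ltW|by nneg].
by rewrite ler_wpM2l ?powR_ge0// powR_le_1Dexpn//; [nneg | lra].
Qed.

Let powR_half (d : R) : h `^ (1 + d) * h = alpha `^ (1 + d / 2).
Proof.
rewrite -[X in _ * X](powRr1 (ltW h0)) -powRD; last by rewrite (gt_eqF h0) implybT.
rewrite /h -powR12_sqrt ?(ltW a0)// -powRrM; congr (_ `^ _); lra.
Qed.

Let powR_half2 (d : R) : (h `^ (1 + d)) ^+ 2 = alpha `^ (1 + d).
Proof.
rewrite -powR_mulrn ?powR_ge0// -powRrM /h -powR12_sqrt ?(ltW a0)// -powRrM.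
by congr (_ `^ _); lra.
Qed.

(** * The product [xhat yhat^T] and |yhat|^2 after a noisy step *)

Section noisy_step_covariance.
Variables (x : 'cV[R]_dx) (y : 'cV[R]_dy) (xi : 'cV[R]_dx) (psi : 'cV[R]_dy).
Let x' := x - alpha *: (F x y + xi).
Let y' := y - beta *: (G x y + psi).
Let p := (x - H y) - alpha *: (B1 *m (x - H y)).
Let fnoise := fast_noise x y xi psi.

(** [p] is the linearized fast iterate. The two first-order noise terms are subtracted exactly
    because their means vanish; bounding them in absolute value would lose a factor of order
    [alpha^(-1/2)]. *)
Lemma cross_next_le i j :
  `| (x' - H y') i 0 * (y' - ystar) j 0 - (p i 0 * (y - ystar) j 0 +
      (fnoise i 0 * (y - ystar) j 0 - beta * (p i 0 * psi j 0))) | <=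
  28 * L ^+ 5 * (alpha * (alpha `^ (1 + deltaF / 2) + beta)) *
    (size4 x y * (1 + enorm xi ^+ 4 + enorm psi ^+ 4)).
Proof.
have [aL bL baL] := step_le; have [hm _] := step_alpha.
pose a := enorm (x - H y); pose b := enorm (y - ystar).
pose phi := enorm (F x y - B1 *m (x - H y)).
have [_ /andP[dF0 dF1] _ /(_ x y) hphi _] := hlin; rewrite -/a -/b -/phi in hphi.
pose r := H (slow_drift x y - beta *: psi) - H (slow_drift x y) + beta *: 'd H (slow_drift x y) psi.
pose e := fast_mean x y - p.
have eq1 : x' - H y' = p + e + (fnoise - r) by rewrite /e [p + _]addrC subrK; exact: fast_next.
have eq2 : y' - ystar = y - ystar - beta *: (G x y + psi) by rewrite /y' addrAC.
have hG' : enorm (G x y) <= L * (a + b).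
  rewrite (le_trans (G_le _ _))// mulrDr lerD// ler_wpM2r//; nneg.
have he : enorm e <= alpha * phi + L ^+ 2 * (beta * (a + b)).
  have -> : e = H y - H (slow_drift x y) - alpha *: (F x y - B1 *m (x - H y)).
    by apply/matrixP => k l; rewrite /e /p /fast_mean !mxE; ring.
  rewrite (le_trans (enormB_le _ _))// addrC enormZ gtr0_norm// lerD2l.
  rewrite (le_trans (H_le _ _))// subKr enormZ gtr0_norm//.
  rewrite (_ : L ^+ 2 * _ = L * (beta * (L * (a + b)))); last by ring.
  by apply: ler_pM; [nneg|nneg|by []|]; rewrite ler_wpM2l ?(ltW b0).
have hp : enorm p <= a.
  rewrite (le_trans (B1_contraction _))// ler_piMl; [by []|by nneg|].
  have := mulr_gt0 a0 muF0; lra.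
have [_ hr] := H_remainder_le (slow_drift x y) psi b0; rewrite -/r -/g in hr.
have hn := fast_next_sub_le x y xi psi; rewrite -/fnoise -/r in hn.
have phi2 : phi <= 2 * L * (h * (a / h)).
  rewrite scaleE /phi (le_trans (enormB_le _ _))//.
  have := F_le x y; have := B1_le (x - H y); rewrite -/a.
  have : LF * a <= L * a by rewrite ler_wpM2r//; nneg.
  lra.
have phi1 : phi <= L * (h `^ (1 + deltaF) * (2 + (a / h) ^+ 2 + (b / h) ^+ 2)).
  apply: (le_trans hphi); apply: ler_pM => //; try nneg.
  - by have [[]] := hlin.
  - rewrite (_ : 2 + _ + _ = (1 + (a / h) ^+ 2) + (1 + (b / h) ^+ 2)); last by ring.
    by rewrite mulrDr lerD// powR_scale_le ?dF0//; nneg.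
have gL : g <= L * h.
  rewrite -(ler_pXn2r (n:=2))// ?nnegrE ?sqrtr_ge0//; last by nneg.
  rewrite exprMn gE hE (le_trans baL)// ler_wpM2r ?(ltW a0)//.
  by rewrite expr2 ler_peMr.
have gh : g ^+ 2 <= L * h ^+ 2 by rewrite gE hE.
have hL : h ^+ 2 <= L by rewrite hE.
have aA0 : 0 <= a / h by nneg.
have bB0 : 0 <= b / h by nneg.
have phi0 : 0 <= phi by exact: enorm_ge0.
have := cross_remainder_le L1 (sqrtr_ge0 beta) (ltW h0) aA0 bB0
  (enorm_ge0 xi) (enorm_ge0 psi) gh gL hL (powR_ge0 _ _) phi0 phi1 phi2.
rewrite -/g -/h gE hE !scaleE powR_half -size4E -mulrDr => /(le_trans _); apply.
rewrite eq1 eq2.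
have -> : (p + e + (fnoise - r)) i 0 * (y - ystar - beta *: (G x y + psi)) j 0 -
    (p i 0 * (y - ystar) j 0 + (fnoise i 0 * (y - ystar) j 0 - beta * (p i 0 * psi j 0))) =
   - (beta * (p i 0 * G x y j 0)) + e i 0 * (y - ystar) j 0 - r i 0 * (y - ystar) j 0
   - (e i 0 + (fnoise - r) i 0) * (beta * (G x y j 0 + psi j 0)).
  by rewrite !mxE; ring.
have le2 (s t u v : R) : `|s| <= u -> `|t| <= v -> `|s * t| <= u * v.
  by move=> su tv; rewrite normrM ler_pM.
have cb n (v : 'cV[R]_n) k c : enorm v <= c -> `|v k 0| <= c.
  by apply: le_trans; exact: normr_coord_le.
have yb : `|(y - ystar) j 0| <= b by exact: normr_coord_le.
rewrite (le_trans (ler_normB _ _))//; apply: lerD.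
  rewrite (le_trans (ler_normB _ _))//; apply: lerD; last by apply: le2 => //; apply: cb.
  rewrite (le_trans (ler_normD _ _))//; apply: lerD; last by apply: le2 => //; apply: cb.
  rewrite normrN normrM gtr0_norm// ler_wpM2l ?(ltW b0)//.
  by apply: le2; apply: cb.
apply: le2.
  by rewrite (le_trans (ler_normD _ _))//; apply: lerD; apply: cb.
rewrite normrM gtr0_norm// ler_wpM2l ?(ltW b0)//.
by rewrite (le_trans (ler_normD _ _))//; apply: lerD; [apply: cb | exact: normr_coord_le].
Qed.

(** Half of the rate [2 beta muG] given by monotonicity is spent, by Young's inequality, on the
    linearization error. The [B2] term is kept exactly, its mean being a function of the cross
    moments. *)
Lemma slow_next_sqr_le :
  enorm (y' - ystar) ^+ 2 <= (1 - beta * muG) * enorm (y - ystar) ^+ 2 -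
    2 * beta * dotp (y - ystar) (B2 *m (x - H y)) -
    2 * beta * dotp (slow_mean x y) psi +
  51 * L ^+ 3 * (beta * (alpha `^ (1 + deltaG) + beta)) *
    (size4 x y * (1 + enorm psi ^+ 4)).
Proof.
have [aL bL baL] := step_le.
pose a := enorm (x - H y); pose b := enorm (y - ystar).
pose rho := G x y - G (H y) y - B2 *m (x - H y).
have [_ S0] := (let: And5 h _ _ _ _ := hlin in h).
have [_ _ /andP[dG0 dG1] _ hlG] := hlin.
have hrho : enorm rho <= 2 * L * (h `^ (1 + deltaG) * (2 + (a / h) ^+ 2 + (b / h) ^+ 2)).
  (* A difference of two errors of (A5), at [x] and at [H y], in which the [B3] terms cancel. *)
  have -> : rho = (G x y - B2 *m (x - H y) - B3 *m (y - ystar)) -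
      (G (H y) y - B2 *m (H y - H y) - B3 *m (y - ystar)).
    by rewrite subrr mulmx0 subr0 /rho; apply/matrixP => k l; rewrite !mxE; ring.
  rewrite (le_trans (enormB_le _ _))//.
  have := hlG x y; have := hlG (H y) y; rewrite subrr enorm0 powR0; last by rewrite gt_eqF ?addr_gt0.
  rewrite -/a -/b add0r => k1 k2.
  have k3 : a `^ (1 + deltaG) + b `^ (1 + deltaG) <= h `^ (1 + deltaG) * (2 + (a / h) ^+ 2 + (b / h) ^+ 2).
    rewrite (_ : 2 + _ + _ = (1 + (a / h) ^+ 2) + (1 + (b / h) ^+ 2)); last by ring.
    by rewrite mulrDr lerD// powR_scale_le ?dG0//; nneg.
  have k4 : SBG * (a `^ (1 + deltaG) + b `^ (1 + deltaG)) <= L * (h `^ (1 + deltaG) * (2 + (a / h) ^+ 2 + (b / h) ^+ 2)).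
    by apply: ler_pM => //; nneg.
  have := mulr_ge0 S0 (powR_ge0 a (1 + deltaG)); lra.
have hG' : enorm (G x y) <= L * (h * (a / h) + h * (b / h)).
  rewrite !scaleE (le_trans (G_le _ _))// mulrDr lerD// ler_wpM2r//; nneg.
have hL : h ^+ 2 <= L by rewrite hE.
have aA0 : 0 <= a / h by nneg.
have bB0 : 0 <= b / h by nneg.
have := slow_remainder_le (enorm psi) L1 (ltW b0) aA0 bB0 (ltW h0) hL (enorm_ge0 _) (enorm_ge0 _)
  (powR_ge0 _ _) hrho hG'.
rewrite -/h powR_half2 -size4E => key.
have eu : enorm (slow_mean x y) ^+ 2 = b ^+ 2 - 2 * (beta * dotp (y - ystar) (G x y)) +
    (beta * enorm (G x y)) ^+ 2.
  by rewrite /slow_mean (enorm_sqrB (y - ystar)) dotpZr enormZ gtr0_norm.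
rewrite slow_next (enorm_sqrB (slow_mean x y)) dotpZr enormZ gtr0_norm// eu.
have [_ _ /(_ y)] := hmono; rewrite G_star subr0 -/b => hmy.
have -> : dotp (y - ystar) (G x y) = dotp (y - ystar) (G (H y) y) +
    dotp (y - ystar) (B2 *m (x - H y)) + dotp (y - ystar) rho.
  by rewrite -!dotpDr; congr dotp; rewrite /rho -addrA subrKC addrC subrK.
have h1 : - dotp (y - ystar) rho <= b * enorm rho.
  by rewrite -dotpNr (le_trans (dotp_le _ _))// enormN.
have h2 : 2 * (b * enorm rho) <= muG * b ^+ 2 + L * enorm rho ^+ 2.
  have m4 : 0 < muG / 2 by rewrite divr_gt0.
  have := young b (enorm rho) m4.
  have -> : enorm rho ^+ 2 / (4 * (muG / 2)) = muG^-1 * enorm rho ^+ 2 / 2.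
    by field; rewrite gt_eqF.
  have : muG^-1 * enorm rho ^+ 2 <= L * enorm rho ^+ 2 by rewrite ler_wpM2r ?sqr_ge0.
  lra.
have h3 := ler_wpM2l (ltW b0) hmy.
have h4 := ler_wpM2l (ltW b0) h1.
have h5 := ler_wpM2l (ltW b0) h2.
move: key; rewrite -/b => key.
lra.
Qed.

End noisy_step_covariance.

End step.

End one_step.

(** * Measurability and conditioning *)

Section borel_vectors.
Context {R : realType}.

Lemma continuous_borel_measurable (n : nat) (f : 'cV[R]_n -> R) :
  continuous f -> measurable_fun setT (f : borel 'cV[R]_n -> R).
Proof.
move=> /continuousP cf; apply: (measurability _ (RGenOpens.measurableE R)).
move=> _ [_ [a [b ->]] <-]; rewrite setTI; apply: sub_sigma_algebra.
by apply: cf; exact: interval_open.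
Qed.

Lemma continuous_borel_measurable_mx (m n : nat) (f : 'cV[R]_n -> 'cV[R]_m) :
  continuous f -> measurable_fun setT (f : borel 'cV[R]_n -> borel 'cV[R]_m).
Proof.
move=> /continuousP cf; apply: (@measurability _ _ (borel 'cV[R]_n) (borel 'cV[R]_m) _ _ open) => //.
move=> _ [A oA <-]; rewrite setTI; apply: sub_sigma_algebra; exact: cf.
Qed.

Lemma measurable_coord d (T : measurableType d) (n : nat) (X : T -> 'cV[R]_n) i :
  measurable_fun setT (X : T -> borel 'cV[R]_n) ->
  measurable_fun setT (fun w => X w i 0).
Proof.
move=> mX; have mc : measurable_fun setT ((fun v : 'cV[R]_n => v i 0) : borel 'cV[R]_n -> R).
  by apply: continuous_borel_measurable; exact: coord_continuous.
exact: (measurableT_comp mc mX).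
Qed.

(* An open set is the union of the boxes with rational centre and radius that
   it contains. *)
Lemma measurable_of_coord d (T : measurableType d) (n : nat) (X : T -> 'cV[R]_n) :
  (forall i, measurable_fun setT (fun w => X w i 0)) ->
  measurable_fun setT (X : T -> borel 'cV[R]_n).
Proof.
move=> mX; apply: (@measurability _ _ T (borel 'cV[R]_n) _ _ open) => //.
move=> _ [A oA <-]; rewrite setTI.
pose box (c : 'cV[rat]_n * rat) := [set v : 'cV[R]_n | forall i, `|ratr (c.1 i 0) - v i 0| < ratr c.2].
have boxP v : A v -> exists c, box c v /\ box c `<=` A.
  move=> Av; move: (oA); rewrite openE => /(_ v Av)/nbhs_ballP[e /= e0 evA].
  have [r /andP[r0 re]] : exists r : rat, 0 < (ratr r : R) < e / 2.
    have [r] := rat_in_itvoo (divr_gt0 e0 (ltr0n R 2)).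
    by rewrite in_itv/=; exists r.
  have q_ex i : exists q : rat, `|(ratr q : R) - v i 0| < ratr r.
    have h : v i 0 - ratr r < v i 0 + ratr r by lra.
    have [q] := rat_in_itvoo h; rewrite in_itv/= => /andP[q1 q2]; exists q.
    by rewrite ltr_distl q1 q2.
  exists (\col_i sval (cid (q_ex i)), r); split.
    by move=> i /=; rewrite mxE; exact: svalP (cid (q_ex i)).
  move=> u hu; apply: evA; rewrite /ball/=; split=> // i j.
  rewrite ord1 /ball/=; have := hu i; have := svalP (cid (q_ex i)); rewrite /= mxE => h1 h2.
  rewrite (_ : v i 0 - u i 0 = (ratr (sval (cid (q_ex i))) - u i 0) - (ratr (sval (cid (q_ex i))) - v i 0)); last by ring.
  by rewrite (le_lt_trans (ler_normB _ _))//; lra.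
have -> : X @^-1` A = \bigcup_(c in [set c | box c `<=` A]) (X @^-1` box c).
  apply/seteqP; split=> [w /= Aw|w [c /= cA] /cA//].
  by have [c [c1 c2]] := boxP _ Aw; exists c.
rewrite bigcup_mkcond; apply: countable_bigcupT_measurable; first exact: countableP.
move=> c; case: ifP => // _.
have -> : X @^-1` box c = \bigcap_(i in [set: 'I_n]) ((fun w => X w i 0) @^-1` [set t | `|ratr (c.1 i 0) - t| < ratr c.2]).
  by apply/seteqP; split=> [w /= h i _|w /= h i]; [exact: h | exact: (h i I)].
apply: fin_bigcap_measurable => // i _; rewrite -[X in measurable X]setTI; apply: mX => //.
apply: open_measurable; rewrite (_ : mkset _ = ball (ratr (c.1 i 0) : R) (ratr c.2))//.
exact: ball_open.
Qed.

End borel_vectors.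

(** * Integrals against functions measurable for a sub-sigma-algebra *)

Section sub_sigma_algebra_integral.
Context d (T : measurableType d) (R : realType).
Variables (P : {measure set T -> \bar R}) (S : set_system T).
Hypothesis subS : <<s S >> `<=` @measurable d T.

Lemma measurable_fun_sub d' (U : measurableType d') (f : T -> U) :
  measurable_fun setT (f : g_sigma_algebraType S -> U) -> measurable_fun setT f.
Proof. by move=> mf _ A mA; apply: subS; exact: mf. Qed.

Import HBNNSimple.

(* Both sides are compared on the simple approximations of [W]. *)
Lemma le_integral_mul_adapted (W X X' : T -> R) :
  measurable_fun setT (W : g_sigma_algebraType S -> R) -> (forall w, 0 <= W w) ->
  measurable_fun setT X -> (forall w, 0 <= X w) ->
  measurable_fun setT X' -> (forall w, 0 <= X' w) ->
  (forall A, <<s S >> A -> (\int[P]_(w in A) (X w)%:E <= \int[P]_(w in A) (X' w)%:E)%E) ->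
  (\int[P]_w (W w * X w)%:E <= \int[P]_w (W w * X' w)%:E)%E.
Proof.
move=> mW W0 mX X0 mX' X'0 hle.
have mWe : measurable_fun setT (EFin \o W : g_sigma_algebraType S -> \bar R).
  exact/measurable_EFinP.
pose f := nnsfun_approx measurableT mWe.
have f0 n w : 0 <= f n w by [].
have mf n : measurable_fun setT (f n : T -> R) by apply: measurable_fun_sub.
have fcvg w : EFin \o f ^~ w @ \oo --> (W w)%:E.
  by apply: (@cvg_nnsfun_approx _ _ _ _ measurableT _ mWe) => // t _; rewrite lee_fin.
have fnd w m n : (m <= n)%N -> f m w <= f n w.
  by move=> mn; apply/lefP; exact: (nd_nnsfun_approx measurableT mWe mn).
have lim (Z : T -> R) : measurable_fun setT Z -> (forall w, 0 <= Z w) ->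
    (\int[P]_w (f n w * Z w)%:E @[n --> \oo] --> \int[P]_w (W w * Z w)%:E)%E.
  move=> mZ Z0.
  have -> : (\int[P]_w (W w * Z w)%:E = \int[P]_w limn (fun n => (f n w * Z w)%:E))%E.
    apply: eq_integral => w _; apply/esym/cvg_lim => //.
    under eq_fun do rewrite EFinM.
    by rewrite EFinM; apply: cvgeZr => //; exact: fcvg.
  apply: cvg_monotone_convergence => //.
  - by move=> n; apply/measurable_EFinP; exact: measurable_funM.
  - by move=> n w _; rewrite lee_fin mulr_ge0.
  - by move=> w _ m n mn; rewrite lee_fin ler_wpM2r// fnd.
apply: (lee_cvg_to (lim X mX X0) (lim X' mX' X'0)); apply: nearW => n.
have expand (Z : T -> R) : measurable_fun setT Z -> (forall w, 0 <= Z w) ->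
    (\int[P]_w (f n w * Z w)%:E =
     \sum_(r \in range (f n)) (r%:E * \int[P]_(w in f n @^-1` [set r]) (Z w)%:E))%E.
  move=> mZ Z0.
  have mr r : measurable (f n @^-1` [set r] : set T) by rewrite -[X in measurable X]setTI; exact: mf.
  under eq_integral => w _.
    rewrite fimfunE fsbig_finite//= big_distrl/= -sumEFin -fsbig_finite//.
    over.
  rewrite ge0_integral_fsum//.
  - apply: eq_fsbigr => r; rewrite inE => -[w _ <-].
    rewrite -ge0_integralZl//; last 3 first.
    + by apply/measurable_EFinP; apply: measurable_funTS.
    + by move=> t _; rewrite lee_fin.
    + by rewrite lee_fin.
    rewrite [RHS]integral_mkcond; apply: eq_integral => t _.
    rewrite patchE indicE; case: ifP => _ /=.
      by rewrite mulr1 EFinM.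
    by rewrite mulr0 mul0r.
  - move=> r; apply/measurable_EFinP; apply: measurable_funM => //.
    by apply: measurable_funM => //; exact: measurable_indic.
  - by move=> r w _; rewrite lee_fin mulr_ge0// -lee_fin EFinM nnfun_muleindic_ge0.
rewrite (expand X mX X0) (expand X' mX' X'0) !fsbig_finite//=.
rewrite big_seq [leRHS]big_seq; apply: lee_sum => r.
rewrite in_fset_set// inE => -[w _ <-]; apply: lee_wpmul2l; first by rewrite lee_fin.
apply: hle; rewrite -[X in <<s S >> X]setTI.
have mfn : measurable_fun setT (f n : g_sigma_algebraType S -> R) by [].
exact: (mfn measurableT _ (measurable_set1 (f n w))).
Qed.

End sub_sigma_algebra_integral.

(** * Real-valued expectations and conditioning *)

Section mean.
Context d (T : measurableType d) (R : realType) (P : probability T R).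
Implicit Types (X Y W : T -> R) (c : R).

Definition integ X := P.-integrable setT (EFin \o X).
(** [fine] sends an infinite expectation to 0, so a bound on [mean] is informative only together
    with [integ]. *)
Definition mean X : R := fine ('E_P[X])%E.

Lemma meanE X : mean X = \int[P]_w X w.
Proof. by rewrite /mean unlock. Qed.

Lemma expectation_mean X : integ X -> ('E_P[X] = (mean X)%:E)%E.
Proof. by move=> iX; rewrite /mean unlock fineK//; exact: integrable_fin_num. Qed.

Lemma integ_measurable X : integ X -> measurable_fun setT X.
Proof. by move=> /measurable_int/measurable_EFinP. Qed.

Lemma integ_le X Y : measurable_fun setT X -> (forall w, `|X w| <= Y w) ->
  integ Y -> integ X.
Proof.
move=> mX XY; apply: le_integrable => //; first exact/measurable_EFinP.
by move=> w _ /=; rewrite lee_fin (le_trans (XY w))// ler_norm.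
Qed.

Lemma integ_cst c : integ (fun=> c).
Proof. exact: finite_measure_integrable_cst. Qed.

Lemma integD X Y : integ X -> integ Y -> integ (fun w => X w + Y w).
Proof. by move=> iX iY; apply: eq_integrable (integrableD measurableT iX iY). Qed.

Lemma integZ c X : integ X -> integ (fun w => c * X w).
Proof. by move=> iX; apply: eq_integrable (integrableZl measurableT c iX). Qed.

Lemma integB X Y : integ X -> integ Y -> integ (fun w => X w - Y w).
Proof.
move=> iX iY; rewrite (_ : (fun w => _) = (fun w => X w + -1 * Y w)).
  by apply: integD => //; exact: integZ.
by apply/funext => w; rewrite mulN1r.
Qed.

Lemma integ_sum (I : Type) (s : seq I) (X : I -> T -> R) :
  (forall i, integ (X i)) -> integ (fun w => \sum_(i <- s) X i w).
Proof.
move=> iX; elim: s => [|i s IH].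
  by under eq_fun do rewrite big_nil; exact: integ_cst.
by under eq_fun do rewrite big_cons; exact: integD.
Qed.

Lemma meanD X Y : integ X -> integ Y -> mean (fun w => X w + Y w) = mean X + mean Y.
Proof. by move=> iX iY; rewrite !meanE RintegralD. Qed.

Lemma meanB X Y : integ X -> integ Y -> mean (fun w => X w - Y w) = mean X - mean Y.
Proof. by move=> iX iY; rewrite !meanE RintegralB. Qed.

Lemma meanZ c X : integ X -> mean (fun w => c * X w) = c * mean X.
Proof. by move=> iX; rewrite !meanE RintegralZl. Qed.

Lemma mean_cst c : mean (fun=> c) = c.
Proof. by rewrite /mean (expectation_cst P c). Qed.

Lemma mean_sum (I : Type) (s : seq I) (X : I -> T -> R) :
  (forall i, integ (X i)) -> mean (fun w => \sum_(i <- s) X i w) = \sum_(i <- s) mean (X i).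
Proof.
move=> iX; elim: s => [|i s IH].
  by under eq_fun do rewrite big_nil; rewrite big_nil mean_cst.
under eq_fun do rewrite big_cons.
by rewrite big_cons meanD ?IH//; exact: integ_sum.
Qed.

Lemma le_mean X Y : integ X -> integ Y -> (forall w, X w <= Y w) -> mean X <= mean Y.
Proof. by move=> iX iY XY; rewrite !meanE le_Rintegral. Qed.

Lemma mean_ge0 X : (forall w, 0 <= X w) -> 0 <= mean X.
Proof. by move=> X0; rewrite meanE Rintegral_ge0. Qed.

Lemma le_mean_norm X Y : integ X -> integ Y -> (forall w, `|X w| <= Y w) -> `|mean X| <= mean Y.
Proof.
move=> iX iY XY; rewrite ler_norml; apply/andP; split.
  rewrite -mulN1r -meanZ//; apply: le_mean => // [|w]; first exact: integZ.
  by have := XY w; rewrite ler_norml mulN1r => /andP[].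
by apply: le_mean => // w; rewrite (le_trans (ler_norm _)).
Qed.

Section conditioning.
Variable S : set_system T.
Hypotheses (sigS : <<s S >> = S) (subS : S `<=` @measurable d T).

Definition adapted X := measurable_fun setT (X : g_sigma_algebraType S -> R).

Let subS' : <<s S >> `<=` @measurable d T. Proof. by rewrite sigS. Qed.

Lemma adapted_measurable X : adapted X -> measurable_fun setT X.
Proof. exact: (measurable_fun_sub subS'). Qed.

(** On every set of [S] the integral of [X] is that of its conditional expectation, hence at most
    that of the constant [c]; [le_integral_mul_adapted] then inserts [W]. Integrability of the
    product is part of the result, as no moment of [W X] is assumed. *)
Lemma ge0_cond_moment_le W X c : 0 <= c -> adapted W -> (forall w, 0 <= W w) -> integ W ->
  (forall w, 0 <= X w) -> cond_exp_le P S X c ->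
  integ (fun w => W w * X w) /\ mean (fun w => W w * X w) <= c * mean W.
Proof.
move=> c0 aW W0 iW X0 [Y [iX iY mY XY] Yc].
have mX := integ_measurable iX; have mW := adapted_measurable aW.
have mYT : measurable_fun setT Y by exact: integ_measurable.
have key : (\int[P]_w (W w * X w)%:E <= \int[P]_w (W w * c)%:E)%E.
  apply: (le_integral_mul_adapted subS' aW W0 mX X0 (X' := cst c)) => // A.
  rewrite sigS => SA; have mA := subS SA; rewrite -XY//.
  (* [Y] may be negative somewhere and is bounded only almost everywhere; its positive part can be
     compared with [c] as a nonnegative function. *)
  apply: (@le_trans _ _ (\int[P]_(w in A) (Num.max (Y w) 0)%:E)%E).
    apply: le_integral => //.
    - exact: integrableS iY.
    - apply: (@le_integrable _ _ _ _ _ mA _ (EFin \o Y)) => //.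
      + apply/measurable_EFinP; apply: measurable_funTS; exact: measurable_maxr.
      + move=> w _ /=; rewrite lee_fin; case: (leP (Y w) 0) => // _.
        by rewrite normr0.
      + exact: integrableS iY.
    - by move=> w _; rewrite lee_fin le_max lexx.
  apply: ae_ge0_le_integral => //.
  - by move=> w _; rewrite lee_fin le_max lexx orbT.
  - apply/measurable_EFinP; apply: measurable_funTS; exact: measurable_maxr.
  - by apply/measurable_EFinP.
  - by apply: filterS Yc => w Yw _; rewrite lee_fin ge_max Yw.
have iWc : integ (fun w => W w * c) by apply: eq_integrable (integZ c iW) => // w _ /=; rewrite mulrC.
have iWX : integ (fun w => W w * X w).
  apply/integrableP; split.
    by apply/measurable_EFinP; exact: measurable_funM.
  under eq_integral do rewrite /= ger0_norm ?mulr_ge0//.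
  by rewrite (le_lt_trans key)// ltey_eq integrable_fin_num.
split=> //; rewrite -meanZ//.
have -> : (fun w => c * W w) = (fun w => W w * c) by apply/funext => w; rewrite mulrC.
by rewrite -lee_fin -!expectation_mean// unlock.
Qed.

(** The positive and negative parts of [X] have the same integral on every set of [S], so for
    [W >= 0] the comparison lemma applies in both directions. A signed [W] is split in the same
    way. *)
Lemma mean_mul_noise W X : adapted W -> cond_exp P S X (cst 0) ->
  integ (fun w => W w * X w) -> mean (fun w => W w * X w) = 0.
Proof.
move=> aW [iX _ _ X0] iWX.
have mX := integ_measurable iX; have mW := adapted_measurable aW.
pose pos (Z : T -> R) w := Num.max (Z w) 0.
have posE (Z : T -> R) w : Z w = pos Z w - pos (fun w => - Z w) w.
  by rewrite /pos; case: (leP (Z w) 0); case: (leP (- Z w) 0) => h1 h2; lra.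
have pos_ge0 (Z : T -> R) w : 0 <= pos Z w by rewrite /pos le_max lexx orbT.
have pos_le (Z : T -> R) w : pos Z w <= `|Z w| by rewrite /pos ge_max ler_norm normr_ge0.
have mpos (Z : T -> R) : measurable_fun setT Z -> measurable_fun setT (pos Z) by move=> ?; exact: measurable_maxr.
have mN (Z : T -> R) : measurable_fun setT Z -> measurable_fun setT (fun w => - Z w).
  by move=> ?; exact: measurableT_comp.
have ipos (Z : T -> R) : integ Z -> integ (pos Z).
  move=> iZ; have iZ' : integ (fun w => `|Z w|) by exact: integrable_norm.
  apply: integ_le iZ' => [|w]; first by apply: mpos; exact: integ_measurable.
  by rewrite ger0_norm.
have iN (Z : T -> R) : integ Z -> integ (fun w => - Z w).
  by move=> /(integZ (-1)); apply: eq_integrable => // w _ /=; rewrite mulN1r.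
have eqA A : S A -> (\int[P]_(w in A) (pos X w)%:E = \int[P]_(w in A) (pos (fun w => (- X w)%R) w)%:E)%E.
  move=> SA; have mA := subS SA.
  have i1 : P.-integrable A (EFin \o pos X).
    by apply: integrableS (ipos _ iX).
  have i2 : P.-integrable A (EFin \o pos (fun w => - X w)).
    by apply: integrableS (ipos _ (iN _ iX)).
  have := X0 A SA; rewrite integral0 => /esym.
  under eq_integral do rewrite (posE X) EFinB.
  rewrite integralB//= -(fineK (integrable_fin_num mA i1)) -(fineK (integrable_fin_num mA i2)) -EFinB.
  by move=> /eqP; rewrite eqe subr_eq0 => /eqP ->.
have half (V : T -> R) : adapted V -> (forall w, 0 <= V w) -> integ (fun w => V w * X w) ->
    mean (fun w => V w * X w) = 0.
  move=> aV V0 iVX; have mV := adapted_measurable aV.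
  have iVn : integ (fun w => `|V w * X w|) by exact: integrable_norm.
  have iV (Z : T -> R) : measurable_fun setT Z -> (forall w, 0 <= Z w <= `|X w|) -> integ (fun w => V w * Z w).
    move=> mZ hZ; apply: integ_le iVn => [|w]; first exact: measurable_funM.
    have /andP[z0 z1] := hZ w.
    by rewrite !normrM ler_wpM2l// ger0_norm.
  have i1 : integ (fun w => V w * pos X w).
    by apply: iV => [|w]; [exact: mpos | rewrite pos_ge0 pos_le].
  have i2 : integ (fun w => V w * pos (fun w => - X w) w).
    apply: iV => [|w]; [exact/mpos/mN | rewrite pos_ge0/=].
    by rewrite (le_trans (pos_le _ _))// normrN.
  have -> : (fun w => V w * X w) = (fun w => V w * pos X w - V w * pos (fun w => - X w) w).
    by apply/funext => w; rewrite -mulrBr -posE.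
  rewrite meanB//; apply/eqP; rewrite subr_eq0 eq_le.
  rewrite -!lee_fin -!expectation_mean// unlock; apply/andP; split.
    apply: (le_integral_mul_adapted subS' aV V0) => //; [exact: mpos|exact/mpos/mN|].
    by move=> A; rewrite sigS => SA; rewrite eqA.
  apply: (le_integral_mul_adapted subS' aV V0) => //; [exact/mpos/mN|exact: mpos|].
  by move=> A; rewrite sigS => SA; rewrite eqA.
have aN : adapted (fun w => - W w) by exact: (measurableT_comp (@oppr_measurable R setT) aW).
have aP (V : T -> R) : adapted V -> adapted (pos V).
  by move=> aV; apply: (@measurable_maxr _ (g_sigma_algebraType S)) => //.
have iVX (V : T -> R) : (forall w, 0 <= V w <= `|W w|) -> adapted V -> integ (fun w => V w * X w).
  move=> hV aV; have iWn : integ (fun w => `|W w * X w|) by exact: integrable_norm.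
  apply: integ_le iWn => [|w]; first by apply: measurable_funM => //; exact: adapted_measurable.
  by have /andP[z0 z1] := hV w; rewrite !normrM ler_wpM2r// ger0_norm.
have j1 : integ (fun w => pos W w * X w).
  by apply: iVX => [w|]; [rewrite pos_ge0 pos_le | exact: aP].
have j2 : integ (fun w => pos (fun w => - W w) w * X w).
  apply: iVX => [w|]; [rewrite pos_ge0/= | exact: aP].
  by rewrite (le_trans (pos_le _ _))// normrN.
have -> : (fun w => W w * X w) = (fun w => pos W w * X w - pos (fun w => - W w) w * X w).
  by apply/funext => w; rewrite -mulrBl -posE.
by rewrite meanB// !half ?subrr//; exact: aP.
Qed.

End conditioning.
End mean.

(** * Functions with finite fourth moment *)

Section fourth_moments.
Context d (T : measurableType d) (R : realType) (P : probability T R).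
Implicit Types X Y : T -> R.

Definition L4 X := measurable_fun setT X /\ integ P (fun w => X w ^+ 4).

Lemma L4_cst (c : R) : L4 (fun=> c).
Proof. by split=> //; exact: integ_cst. Qed.

Lemma L4_le X Y : measurable_fun setT X -> (forall w, `|X w| <= Y w) -> L4 Y -> L4 X.
Proof.
move=> mX XY [mY iY]; split=> //; apply: integ_le iY => [|w].
  exact: measurable_funX.
by rewrite normrX ler_pXn2r ?nnegrE// (le_trans _ (XY w)).
Qed.

Lemma expr4D_le (a b : R) : (a + b) ^+ 4 <= 8 * (a ^+ 4 + b ^+ 4).
Proof.
have -> : (a + b) ^+ 4 = ((a + b) ^+ 2) ^+ 2 by rewrite -exprM.
apply: (@le_trans _ _ ((2 * (a ^+ 2 + b ^+ 2)) ^+ 2)).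
  rewrite ler_pXn2r ?nnegrE//; try nneg.
  by have := sqr_ge0 (a - b); lra.
have := sqr_ge0 (a ^+ 2 - b ^+ 2); lra.
Qed.

Lemma L4D X Y : L4 X -> L4 Y -> L4 (fun w => X w + Y w).
Proof.
move=> [mX iX] [mY iY]; split; first exact: measurable_funD.
apply: (integ_le _ _ (integZ 8 (integD iX iY))) => [|w].
  by apply: measurable_funX; exact: measurable_funD.
by rewrite ger0_norm ?expr4D_le ?exprn_even_ge0.
Qed.

Lemma L4Z c X : L4 X -> L4 (fun w => c * X w).
Proof.
move=> [mX iX]; split; first exact: measurable_funM.
by apply: eq_integrable (integZ (c ^+ 4) iX) => // w _ /=; rewrite exprMn.
Qed.

(** A product of four factors is dominated by the sum of their fourth powers. *)
Lemma integ_mul4 X1 X2 X3 X4 : L4 X1 -> L4 X2 -> L4 X3 -> L4 X4 ->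
  integ P (fun w => X1 w * X2 w * X3 w * X4 w).
Proof.
move=> [m1 i1] [m2 i2] [m3 i3] [m4 i4].
apply: (integ_le _ _ (integD (integD i1 i2) (integD i3 i4))) => [|w].
  by do 3!apply: measurable_funM => //.
have sq4 (a : R) : a ^+ 4 = (a ^+ 2) ^+ 2 by rewrite -exprM.
rewrite ler_norml !sq4; have := sqr_ge0 (X1 w ^+ 2 - X2 w ^+ 2); have := sqr_ge0 (X3 w ^+ 2 - X4 w ^+ 2).
have := sqr_ge0 (X1 w * X2 w - X3 w * X4 w); have := sqr_ge0 (X1 w * X2 w + X3 w * X4 w).
have := sqr_ge0 (X1 w ^+ 2); have := sqr_ge0 (X2 w ^+ 2).
have := sqr_ge0 (X3 w ^+ 2); have := sqr_ge0 (X4 w ^+ 2).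
by move=> *; apply/andP; split; lra.
Qed.

Lemma integ_mul2 X1 X2 : L4 X1 -> L4 X2 -> integ P (fun w => X1 w * X2 w).
Proof.
move=> h1 h2; have := integ_mul4 h1 h2 (L4_cst 1) (L4_cst 1).
by apply: eq_integrable => // w _ /=; rewrite !mulr1.
Qed.

Lemma L4_coord n (X : T -> 'cV[R]_n) i : measurable_fun setT (fun w => X w i 0) ->
  L4 (fun w => enorm (X w)) -> L4 (fun w => X w i 0).
Proof. by move=> mX; apply: L4_le => // w; exact: normr_coord_le. Qed.

End fourth_moments.

Section measurable_vectors.
Context d (T : measurableType d) (R : realType).

Lemma measurable_mulmx m n (A : 'M[R]_(m, n)) (X : T -> 'cV[R]_n) i :
  (forall j, measurable_fun setT (fun w => X w j 0)) ->
  measurable_fun setT (fun w => (A *m X w) i 0).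
Proof.
move=> mX; under eq_fun do rewrite mxE.
by apply: measurable_sum => j; apply: measurable_funM.
Qed.

Lemma measurable_dotp n (X Y : T -> 'cV[R]_n) :
  (forall i, measurable_fun setT (fun w => X w i 0)) ->
  (forall i, measurable_fun setT (fun w => Y w i 0)) ->
  measurable_fun setT (fun w => dotp (X w) (Y w)).
Proof. by move=> mX mY; apply: measurable_sum => j; apply: measurable_funM. Qed.

Lemma measurable_enorm n (X : T -> 'cV[R]_n) :
  (forall i, measurable_fun setT (fun w => X w i 0)) ->
  measurable_fun setT (fun w => enorm (X w)).
Proof.
move=> mX; have ms : measurable_fun setT (@Num.sqrt R).
  by apply: continuous_measurable_fun; exact: sqrt_continuous.
exact: (measurableT_comp ms (measurable_dotp mX mX)).
Qed.

End measurable_vectors.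

Section continuity.
Context {R : realType}.

(** The topology is that of the sup norm; [enorm] dominates each coordinate and is at most [n] times
    the sup norm, which decides the radius [r]. *)
Lemma enorm_lipschitz_continuous m n (f : 'cV[R]_n -> 'cV[R]_m) (k : R) :
  (forall u v, enorm (f u - f v) <= k * enorm (u - v)) -> continuous f.
Proof.
move=> lf u A /nbhs_ballP[e /= e0 eA].
have k1 : 0 < `|k| * n%:R + 1 by rewrite ltr_wpDl ?mulr_ge0.
pose r := e / (`|k| * n%:R + 1); have r0 : 0 < r by rewrite divr_gt0.
suff : nbhs u (f @^-1` A) by []; apply/nbhs_ballP.
exists r => //= v [_ uv]; apply: eA; split=> // i j.
rewrite /ball/= ord1 (_ : _ - _ = (f u - f v) i 0); last by rewrite !mxE.
rewrite (le_lt_trans (normr_coord_le _ _))// (le_lt_trans (lf _ _))//.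
have enr : enorm (u - v) <= n%:R * r.
  rewrite (le_trans (enorm_le_sum _))//.
  apply: (@le_trans _ _ (\sum_(i < n) r)); last by rewrite sumr_const card_ord mulr_natl.
  by apply: ler_sum => l _; have := uv l 0; rewrite /ball/= !mxE => /ltW.
apply: (@le_lt_trans _ _ (`|k| * (n%:R * r))).
  apply: (@le_trans _ _ (`|k| * enorm (u - v))); last by rewrite ler_wpM2l.
  by rewrite ler_wpM2r ?ler_norm ?enorm_ge0.
have -> : e = (`|k| * n%:R + 1) * r by rewrite /r mulrCA divff ?mulr1// gt_eqF.
by rewrite mulrA mulrDl mul1r ltrDl.
Qed.

End continuity.

(** * The filtration generated by the noise *)

Section filtration_properties.
Context d (T : measurableType d) (R : realType) (dx dy : nat).
Variables (x0 : 'cV[R]_dx) (y0 : 'cV[R]_dy)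
  (xi : nat -> T -> 'cV[R]_dx) (psi : nat -> T -> 'cV[R]_dy).
Let Ft := filtration x0 y0 xi psi.

Lemma filtration_sigma t : <<s Ft t >> = Ft t.
Proof. by apply: sigma_algebra_id; exact: smallest_sigma_algebra. Qed.

Lemma filtration_le t : Ft t `<=` Ft t.+1.
Proof.
apply: sub_sigma_algebra2; apply: setUS => A [s /= st As]; exists s => //=.
by rewrite (ltn_trans st).
Qed.

Lemma xi_filtration t : measurable_fun setT (xi t : g_sigma_algebraType (Ft t.+1) -> borel 'cV[R]_dx).
Proof.
move=> _ A mA; apply: sub_sigma_algebra; apply: sub_sigma_algebra; right.
by exists t => /=; [exact: ltnSn | left; exists A].
Qed.

Lemma psi_filtration t : measurable_fun setT (psi t : g_sigma_algebraType (Ft t.+1) -> borel 'cV[R]_dy).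
Proof.
move=> _ A mA; apply: sub_sigma_algebra; apply: sub_sigma_algebra; right.
by exists t => /=; [exact: ltnSn | right; exists A].
Qed.

Hypotheses (mxi : forall t, measurable_fun setT (xi t : T -> borel 'cV[R]_dx))
  (mpsi : forall t, measurable_fun setT (psi t : T -> borel 'cV[R]_dy)).

Lemma filtration_measurable t : Ft t `<=` @measurable d T.
Proof.
apply: smallest_sub; first exact: sigma_algebra_measurable.
move=> A [[[B mB <-]|[B mB <-]]|[s _ [[B mB <-]|[B mB <-]]]].
- have mc : measurable_fun setT (cst x0 : T -> borel 'cV[R]_dx) by exact: measurable_cst.
  exact: mc.
- have mc : measurable_fun setT (cst y0 : T -> borel 'cV[R]_dy) by exact: measurable_cst.
  exact: mc.
- exact: mxi.
- exact: mpsi.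
Qed.

Lemma filtration_fun_le d' (U : measurableType d') t (f : T -> U) :
  measurable_fun setT (f : g_sigma_algebraType (Ft t) -> U) ->
  measurable_fun setT (f : g_sigma_algebraType (Ft t.+1) -> U).
Proof.
move=> mf _ A mA; have := mf measurableT A mA.
by apply: sub_sigma_algebra2; exact: filtration_le.
Qed.

End filtration_properties.

(** * Adaptedness of the iterates *)

Section iterates.
Context d (T : measurableType d) (R : realType) (dx dy : nat).
Variables (F : 'cV[R]_dx -> 'cV[R]_dy -> 'cV[R]_dx)
  (G : 'cV[R]_dx -> 'cV[R]_dy -> 'cV[R]_dy) (H : 'cV[R]_dy -> 'cV[R]_dx).
Variables (alpha beta : nat -> R)
  (x0 : 'cV[R]_dx) (y0 : 'cV[R]_dy)
  (xi : nat -> T -> 'cV[R]_dx) (psi : nat -> T -> 'cV[R]_dy)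
  (x : nat -> T -> 'cV[R]_dx) (y : nat -> T -> 'cV[R]_dy).
Hypotheses (mF : borel_measurable F) (mG : borel_measurable G).
Hypothesis hiter : tts_iteration F G alpha beta xi psi x0 y0 x y.
Let Tt t := g_sigma_algebraType (filtration x0 y0 xi psi t).

Lemma borel_measurable_comp m t (K : 'cV[R]_dx -> 'cV[R]_dy -> 'cV[R]_m) X Y :
  borel_measurable K ->
  measurable_fun setT (X : Tt t -> borel 'cV[R]_dx) ->
  measurable_fun setT (Y : Tt t -> borel 'cV[R]_dy) ->
  measurable_fun setT ((fun w => K (X w) (Y w)) : Tt t -> borel 'cV[R]_m).
Proof. by move=> mK mX mY; exact: (measurableT_comp mK (measurable_fun_pair mX mY)). Qed.

Lemma vmeasurable_affine d' (T' : measurableType d') m (X Y Z : T' -> 'cV[R]_m) (a : R) :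
  measurable_fun setT (X : T' -> borel 'cV[R]_m) ->
  measurable_fun setT (Y : T' -> borel 'cV[R]_m) ->
  measurable_fun setT (Z : T' -> borel 'cV[R]_m) ->
  measurable_fun setT ((fun w => X w - a *: (Y w + Z w)) : T' -> borel 'cV[R]_m).
Proof.
move=> mX mY mZ; apply: measurable_of_coord => i.
have -> : (fun w => (X w - a *: (Y w + Z w)) i 0) = (fun w => X w i 0 - a * (Y w i 0 + Z w i 0)).
  by apply/funext => w; rewrite !mxE.
apply: measurable_funB; first exact: measurable_coord.
by apply: measurable_funM => //; apply: measurable_funD; exact: measurable_coord.
Qed.

Lemma iterates_adapted t : measurable_fun setT (x t : Tt t -> borel 'cV[R]_dx) /\
  measurable_fun setT (y t : Tt t -> borel 'cV[R]_dy).
Proof.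
have [hx0 hy0 hx hy] := hiter.
elim: t => [|t [IHx IHy]].
  rewrite (_ : x 0 = cst x0); last exact/funext.
  by rewrite (_ : y 0 = cst y0); last exact/funext.
have IHx' := filtration_fun_le IHx; have IHy' := filtration_fun_le IHy.
rewrite (_ : x t.+1 = fun w => x t w - alpha t *: (F (x t w) (y t w) + xi t w)); last exact/funext.
rewrite (_ : y t.+1 = fun w => y t w - beta t *: (G (x t w) (y t w) + psi t w)); last exact/funext.
split; apply: vmeasurable_affine => //.
- exact: borel_measurable_comp.
- exact: xi_filtration.
- exact: borel_measurable_comp.
- exact: psi_filtration.
Qed.

End iterates.

Section differential_measurable.
Context {R : realType} {dx dy : nat} (H : 'cV[R]_dy -> 'cV[R]_dx) (SH deltaH LH : R).
Hypothesis hH : locally_linear_H H SH deltaH.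
Hypothesis H_lip : forall y1 y2, enorm (H y1 - H y2) <= LH * enorm (y1 - y2).

(* Difference quotients along steps [h] with [h^deltaH = 1 / (n + 1)]. *)
Lemma differential_coord_measurable v i :
  measurable_fun setT ((fun z => 'd H z v i 0) : borel 'cV[R]_dy -> R).
Proof.
have [_ S0 /andP[d1 _] hloc] := hH.
have d0 : 0 < deltaH by apply: lt_le_trans d1.
pose h n : R := (n.+1%:R^-1) `^ deltaH^-1.
have h0 n : 0 < h n by rewrite powR_gt0// invr_gt0.
have hd n : h n `^ deltaH = n.+1%:R^-1.
  by rewrite -powRrM mulVf ?gt_eqF// powRr1// invr_ge0.
pose q n (z : 'cV[R]_dy) := (h n)^-1 * (H (z + h n *: v) - H z) i 0.
apply: (@measurable_fun_cvg _ (borel 'cV[R]_dy) R setT q).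
- move=> n.
  have coordC (f : 'cV[R]_dy -> 'cV[R]_dx) : continuous f -> continuous (fun z => f z i 0).
    by move=> cf z; exact: (continuous_comp (cf z) (@coord_continuous _ _ _ i 0 _)).
  have cH : continuous H by exact: enorm_lipschitz_continuous H_lip.
  have cHv : continuous (fun z : 'cV[R]_dy => H (z + h n *: v)).
    apply: (@enorm_lipschitz_continuous _ _ _ _ LH) => u1 u2.
    by rewrite (le_trans (H_lip _ _))// opprD addrACA subrr addr0.
  have -> : q n = (fun z => (h n)^-1 * (H (z + h n *: v) i 0 - H z i 0)).
    by apply/funext => z; rewrite /q !mxE.
  apply: (@measurable_funM _ (borel 'cV[R]_dy) _ _ (cst (h n)^-1)); first exact: measurable_cst.
  by apply: (@measurable_funB _ (borel 'cV[R]_dy) _ _ (fun z => H (z + h n *: v) i 0));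
    apply: continuous_borel_measurable; exact: coordC.
- move=> z _; pose c := SH * enorm v `^ (1 + deltaH).
  have est n : `|'d H z v i 0 - (h n)^-1 * (H (z + h n *: v) - H z) i 0| <= c * n.+1%:R^-1.
    have hn := h0 n.
    rewrite (_ : _ - _ = (- (h n)^-1 *: (H (z + h n *: v) - H z - 'd H z (h n *: v))) i 0); last first.
      by rewrite ['d H z (_ *: _)]linearZ !mxE; field; rewrite gt_eqF.
    rewrite (le_trans (normr_coord_le _ _))// enormZ normrN gtr0_norm ?invr_gt0//.
    rewrite mulrC ler_pdivrMr//.
    have := hloc (z + h n *: v) z; rewrite [z + _]addrC addrK => /le_trans; apply.
    rewrite enormZ gtr0_norm// (powRM _ (ltW hn) (enorm_ge0 v)).
    rewrite (@powRD _ (h n)); last by rewrite (gt_eqF hn) implybT.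
    rewrite (powRr1 (ltW hn)) hd /c le_eqVlt; apply/orP; left; apply/eqP; ring.
  apply/cvgrPdist_le => e e0.
  have /cvgrPdist_le/(_ e e0) : c * n.+1%:R^-1 @[n --> \oo] --> (0 : R).
    by rewrite -[X in _ --> X](mulr0 c); apply: cvgM; [exact: cvg_cst | exact: cvg_harmonic].
  apply: filterS => n; rewrite sub0r normrN => cn.
  by rewrite (le_trans (est n))// (le_trans (ler_norm _)).
Qed.

End differential_measurable.

(** * Integrable terms of zero mean *)

Section null_terms.
Context d (T : measurableType d) (R : realType) (P : probability T R).
Implicit Types (X Y W : T -> R).

Definition null X := integ P X /\ mean P X = 0.

Lemma nullD X Y : null X -> null Y -> null (fun w => X w + Y w).
Proof. by move=> [iX mX] [iY mY]; split; [exact: integD | rewrite meanD// mX mY addr0]. Qed.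

Lemma nullZ c X : null X -> null (fun w => c * X w).
Proof. by move=> [iX mX]; split; [exact: integZ | rewrite meanZ// mX mulr0]. Qed.

Lemma nullB X Y : null X -> null Y -> null (fun w => X w - Y w).
Proof. by move=> [iX mX] [iY mY]; split; [exact: integB | rewrite meanB// mX mY subr0]. Qed.

Lemma null_sum (I : Type) (s : seq I) (X : I -> T -> R) :
  (forall i, null (X i)) -> null (fun w => \sum_(i <- s) X i w).
Proof.
move=> h; split; first by apply: integ_sum => i; have [] := h i.
by rewrite mean_sum => [|i]; [rewrite big1// => i _|]; have [] := h i.
Qed.

Lemma eq_null X Y : X =1 Y -> null X -> null Y.
Proof. by move=> /funext ->. Qed.

Variables (S : set_system T).
Hypotheses (sigS : <<s S >> = S) (subS : S `<=` @measurable d T).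

Definition adapted4 X := adapted S X /\ L4 P X.

Lemma adapted4_cst c : adapted4 (fun=> c).
Proof. by split; [exact: measurable_cst | exact: L4_cst]. Qed.

Lemma adaptedM X Y : adapted S X -> adapted S Y -> adapted S (fun w => X w * Y w).
Proof. by move=> mX mY; exact: measurable_funM. Qed.

Lemma adaptedD X Y : adapted S X -> adapted S Y -> adapted S (fun w => X w + Y w).
Proof. by move=> mX mY; exact: measurable_funD. Qed.

Lemma adaptedX X n : adapted S X -> adapted S (fun w => X w ^+ n).
Proof. by move=> mX; exact: measurable_funX. Qed.

Lemma adapted4_le X Y : adapted S X -> (forall w, `|X w| <= Y w) -> L4 P Y -> adapted4 X.
Proof. by move=> aX XY l4; split=> //; apply: L4_le XY l4; exact: (adapted_measurable sigS subS). Qed.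

Lemma adapted4_bounded X Y c : adapted4 X -> adapted S Y -> (forall w, `|Y w| <= c) ->
  adapted4 (fun w => X w * Y w).
Proof.
move=> [aX l4X] aY Yc; apply: (@adapted4_le _ (fun w => c * `|X w|)).
- exact: adaptedM.
- by move=> w; rewrite normrM mulrC ler_wpM2r.
- apply: L4Z; have [mX iX] := l4X; split; first exact: measurableT_comp.
  apply: eq_integrable iX => // w _ /=; congr EFin.
  by rewrite -normrX ger0_norm ?exprn_even_ge0.
Qed.

(** Three factors from the past, because the part of [V^2] or |xhat|^4 that is linear in the noise
    is cubic in the errors. Lower degrees take the constant 1 as a factor. *)
Lemma null_mul_noise A B C Z : adapted4 A -> adapted4 B -> adapted4 C ->
  L4 P Z -> cond_exp P S Z (cst 0) -> null (fun w => A w * B w * C w * Z w).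
Proof.
move=> [aA lA] [aB lB] [aC lC] lZ cZ; have iABCZ := integ_mul4 lA lB lC lZ.
by split=> //; apply: (mean_mul_noise sigS subS) => //; do 2!apply: adaptedM => //.
Qed.

End null_terms.

(* With [tau = a / b] and [z = a * tau `^ e^-1], the left side is [b * z `^ e]
   and [z `^ e <= 1 + z]. *)
Lemma powR_1D_le_ratio (R : realType) (a b e : R) : 0 < a -> 0 < b -> 0 < e <= 1 ->
  a `^ (1 + e) <= b + a * b * (a / b) `^ e^-1.
Proof.
move=> a0 b0 /andP[e0 e1]; have r0 : 0 <= a / b by rewrite ltW ?divr_gt0.
have z0 : 0 <= a * (a / b) `^ e^-1 by rewrite mulr_ge0 ?powR_ge0 ?ltW.
have e01 : 0 <= e <= 1%:R by rewrite (ltW e0).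
have := ler_wpM2l (ltW b0) (powR_le_1Dexpn z0 e01).
rewrite powRM ?powR_ge0 ?(ltW a0)// -powRrM mulVf ?gt_eqF// powRr1//.
have -> : a `^ (1 + e) = a * a `^ e by rewrite powRD ?(gt_eqF a0) ?implybT// powRr1 ?ltW.
rewrite expr1 (_ : b * (a `^ e * (a / b)) = a * a `^ e); last by field; rewrite gt_eqF.
by rewrite mulrDr mulr1 mulrCA mulrA.
Qed.

(** For |v| <= 1, [A *m v] combines the columns with coefficients of modulus at most 1. *)
Lemma snorm_le_col (R : realType) (m n : nat) (A : 'M[R]_(m, n)) :
  snorm A <= \sum_(j < n) enorm (col j A).
Proof.
apply: ge_sup => [|_ /= [v v1 <-]].
  by exists (enorm (A *m 0)) => /=; exists 0 => //=; rewrite enorm0 ler01.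
have -> : A *m v = \sum_(j < n) v j 0 *: col j A.
  apply/matrixP => i k; rewrite ord1 mxE summxE; apply: eq_bigr => j _.
  by rewrite !mxE mulrC.
have : forall s : seq 'I_n, enorm (\sum_(j <- s) v j 0 *: col j A) <= \sum_(j <- s) enorm (col j A).
  elim=> [|j s IH]; first by rewrite !big_nil enorm0.
  rewrite !big_cons (le_trans (enormD _ _))// lerD// enormZ ler_piMl ?enorm_ge0//.
  exact: le_trans (normr_coord_le _ _) v1.
exact.
Qed.

(** The term t = 0 of the supremum is [alpha_0^-2 (1 - muG beta_0 / 4)], whose last factor is at
    least 1/2. The order condition makes the set bounded above, without which [sup] would bound
    nothing. *)
Lemma alpha0_inv_sqr_le (R : realType) (alpha beta : nat -> R) (muG : R) :
  (forall t, 0 < alpha t) -> muG * beta 0 <= 2 ->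
  contraction_prod muG beta =O_\oo (fun t => alpha t ^+ 2) ->
  (alpha 0 ^+ 2)^-1 <= 2 * contraction_sup muG alpha beta.
Proof.
move=> al mb /eqO_exP[k k0 [N _ hN]].
pose f t := (alpha t ^+ 2)^-1 * contraction_prod muG beta t.
have hub : has_ubound (range f).
  (* [k] bounds the terms from [N] on; the sum takes care of the finitely many earlier ones. *)
  exists (k + \sum_(i < N) `|f i|) => _ [t _ <-].
  have [tN|Nt] := ltnP t N.
    rewrite (bigD1 (Ordinal tN))//= (le_trans (ler_norm _))// addrCA lerDl.
    by rewrite addr_ge0 ?(ltW k0)// sumr_ge0.
  apply: (@le_trans _ _ k); last by rewrite lerDl sumr_ge0.
  have := hN t Nt; rewrite /f ler_pdivrMl ?exprn_gt0// mulrC [`|alpha t ^+ 2|]ger0_norm ?sqr_ge0//.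
  by apply: le_trans; exact: ler_norm.
have := ub_le_sup hub (ex_intro2 _ _ 0%N I erefl : range f (f 0%N)).
rewrite -/(contraction_sup muG alpha beta) /f /contraction_prod big_ord1 /= => h.
have i0 : 0 <= (alpha 0%N ^+ 2)^-1 by rewrite invr_ge0 sqr_ge0.
have := mulr_ge0 i0 (_ : 0 <= 2 - muG * beta 0); rewrite subr_ge0 mb => /(_ isT) h'.
lra.
Qed.

(** * Moment recursions *)

Section moments.
Context {R : realType} {dx dy : nat}.
Variables (LH LF LGx LGy muF muG SH deltaH SBF SBG deltaF deltaG : R).
Variables (Gamma11 Gamma22 Sigma11 Sigma22 Sigma12 : R).
Context (d : measure_display) (T : measurableType d) (P : probability T R).
Variables (F : 'cV[R]_dx -> 'cV[R]_dy -> 'cV[R]_dx)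
  (G : 'cV[R]_dx -> 'cV[R]_dy -> 'cV[R]_dy)
  (H : 'cV[R]_dy -> 'cV[R]_dx) (ystar : 'cV[R]_dy)
  (B1 : 'M[R]_(dx, dx)) (B2 : 'M[R]_(dy, dx)) (B3 : 'M[R]_(dy, dy)).
Variables (alpha beta : nat -> R)
  (xi : nat -> T -> 'cV[R]_dx) (psi : nat -> T -> 'cV[R]_dy)
  (x0 : 'cV[R]_dx) (y0 : 'cV[R]_dy)
  (x : nat -> T -> 'cV[R]_dx) (y : nat -> T -> 'cV[R]_dy).
Hypotheses (mF : borel_measurable F) (mG : borel_measurable G).
Hypotheses (mxi : forall t, measurable_fun setT (xi t : T -> borel 'cV[R]_dx))
  (mpsi : forall t, measurable_fun setT (psi t : T -> borel 'cV[R]_dy)).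
Hypothesis hiter : tts_iteration F G alpha beta xi psi x0 y0 x y.
Hypothesis hF : lipschitz_FH F H LH LF.
Hypothesis hG : nested_lipschitz_G G H ystar LGx LGy.
Hypothesis hmono : star_strong_monotone F G H ystar muF muG.
Hypothesis hH : locally_linear_H H SH deltaH.
Hypothesis hlin : nested_locally_linear F G H ystar B1 B2 B3 SBF SBG deltaF deltaG.
Hypothesis hnoise : noise_conditions P x0 y0 xi psi Gamma11 Gamma22 Sigma11 Sigma22 Sigma12.
Hypothesis hstep : stepsize_conditions dx alpha beta LH LF LGx LGy muF muG deltaF deltaG.
Variable L : R.
Hypotheses (L1 : 1 <= L) (LHL : LH <= L) (LFL : LF <= L) (LGxL : LGx <= L)
  (LGyL : LGy <= L) (SHL : SH <= L) (SBFL : SBF <= L) (SBGL : SBG <= L)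
  (muFL : muF^-1 <= L) (muGL : muG^-1 <= L) (muFGL : muF / (5 * muG) <= L)
  (omegaL : 20 * LGx ^+ 2 / (muF * muG) <= L).

Let Ft t := filtration x0 y0 xi psi t.
Let xhat t w := x t w - H (y t w).
Let yhat t w := y t w - ystar.
Let a t w := enorm (xhat t w).
Let b t w := enorm (yhat t w).
Let sm t w := slow_mean G ystar (beta t) (x t w) (y t w).
Let fm t w := fast_mean F G H (alpha t) (beta t) (x t w) (y t w).
Let sd t w := slow_drift G (beta t) (x t w) (y t w).
Let fnoise t w := fast_noise G H (alpha t) (beta t) (x t w) (y t w) (xi t w) (psi t w).
Let w_ t := lyapunov_weight LGx muF muG (alpha t) (beta t).

Let L0 : 0 <= L := le_trans ler01 L1.
Let muF0 : 0 < muF. Proof. by have [[]] := hmono. Qed.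
Let muG0 : 0 < muG. Proof. by have [[]] := hmono. Qed.
Let alpha0 t : 0 < alpha t. Proof. by have [/(_ t)[]] := hstep. Qed.
Let beta0 t : 0 < beta t. Proof. by have [/(_ t)[]] := hstep. Qed.
Let halpha t : alpha t <= iota1 muF LF. Proof. by have [_ /(_ t)[]] := hstep. Qed.
Let hbeta t : beta t <= iota2 muG LGy. Proof. by have [_ /(_ t)[]] := hstep. Qed.
Let hkappa t : beta t / alpha t <= kappa dx muF muG LH LGx LGy.
Proof. by have [_ /(_ t)[]] := hstep. Qed.
Let sigF t : <<s Ft t >> = Ft t. Proof. exact: filtration_sigma. Qed.
Let subF t : Ft t `<=` @measurable d T. Proof. exact: filtration_measurable. Qed.
Let stepL t : [/\ alpha t <= L, beta t <= L & beta t <= L * alpha t].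
Proof. exact: (step_le hF hG hmono muFL muGL (alpha0 t) (beta0 t)). Qed.

(** * Adaptedness of the errors and of the noiseless iterates *)

Let Tt t := g_sigma_algebraType (Ft t).
Let mx t : measurable_fun setT (x t : Tt t -> borel 'cV[R]_dx).
Proof. by have [] := iterates_adapted mF mG hiter t. Qed.
Let my t : measurable_fun setT (y t : Tt t -> borel 'cV[R]_dy).
Proof. by have [] := iterates_adapted mF mG hiter t. Qed.

Let cH : continuous H.
Proof. by have [_ _ lH _] := hF; exact: enorm_lipschitz_continuous lH. Qed.

Let coord_sub t n (X Y : T -> 'cV[R]_n) i :
  measurable_fun setT (X : Tt t -> borel 'cV[R]_n) ->
  measurable_fun setT (Y : Tt t -> borel 'cV[R]_n) ->
  adapted (Ft t) (fun w => (X w - Y w) i 0).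
Proof.
move=> mX mY; rewrite (_ : (fun w => _) = (fun w => X w i 0 - Y w i 0)); last first.
  by apply/funext => w; rewrite !mxE.
by apply: (@measurable_funB _ (Tt t)); exact: (@measurable_coord _ _ (Tt t)).
Qed.

Let coord_scale t n (X : T -> 'cV[R]_n) c i :
  measurable_fun setT (X : Tt t -> borel 'cV[R]_n) ->
  adapted (Ft t) (fun w => (c *: X w) i 0).
Proof.
move=> mX; rewrite (_ : (fun w => _) = (fun w => c * X w i 0)); last first.
  by apply/funext => w; rewrite !mxE.
by apply: (@measurable_funM _ (Tt t) _ _ (cst c)) => //; exact: (@measurable_coord _ _ (Tt t)).
Qed.

Let vsub t n (X Y : T -> 'cV[R]_n) c :
  measurable_fun setT (X : Tt t -> borel 'cV[R]_n) ->
  measurable_fun setT (Y : Tt t -> borel 'cV[R]_n) ->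
  measurable_fun setT ((fun w => X w - c *: Y w) : Tt t -> borel 'cV[R]_n).
Proof.
move=> mX mY; apply: measurable_of_coord => i; apply: coord_sub => //.
by apply: measurable_of_coord => j; exact: coord_scale.
Qed.

Let mHy t : measurable_fun setT ((fun w => H (y t w)) : Tt t -> borel 'cV[R]_dx).
Proof.
have mH := continuous_borel_measurable_mx cH.
exact: (measurableT_comp mH (@my t)).
Qed.

Let mxhat t i : adapted (Ft t) (fun w => xhat t w i 0).
Proof. exact: coord_sub. Qed.

Let myhat t i : adapted (Ft t) (fun w => yhat t w i 0).
Proof. by apply: coord_sub => //; exact: measurable_cst. Qed.

Let ma t : adapted (Ft t) (a t).
Proof. by apply: (@measurable_enorm _ (Tt t)) => i; exact: mxhat. Qed.
Let mb t : adapted (Ft t) (b t).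
Proof. by apply: (@measurable_enorm _ (Tt t)) => i; exact: myhat. Qed.

Let mGxy t : measurable_fun setT ((fun w => G (x t w) (y t w)) : Tt t -> borel 'cV[R]_dy).
Proof. exact: borel_measurable_comp. Qed.

Let msd t : measurable_fun setT (sd t : Tt t -> borel 'cV[R]_dy).
Proof. exact: vsub. Qed.

Let mfm t i : adapted (Ft t) (fun w => fm t w i 0).
Proof.
apply: (@coord_sub t _ (fun w => x t w - alpha t *: F (x t w) (y t w))).
  by apply: vsub => //; exact: borel_measurable_comp.
have mH := continuous_borel_measurable_mx cH.
exact: (measurableT_comp mH (@msd t)).
Qed.

Let msm t i : adapted (Ft t) (fun w => sm t w i 0).
Proof.
apply: (@coord_sub t _ (yhat t) (fun w => beta t *: G (x t w) (y t w))).
  by apply: measurable_of_coord => j; exact: myhat.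
by apply: measurable_of_coord => j; exact: coord_scale.
Qed.

Let mdiff t v i : adapted (Ft t) (fun w => 'd H (sd t w) v i 0).
Proof.
have [_ _ lH _] := hF.
have mD := differential_coord_measurable hH lH v i.
exact: (measurableT_comp mD (@msd t)).
Qed.

(** * Finiteness of fourth moments along the iteration *)

Let L4_xi t : L4 P (fun w => enorm (xi t w)).
Proof.
have [_ [[Y [iX _ _ _] _] _] _ _ _] := hnoise t; split=> //.
by apply: measurable_enorm => i; exact: measurable_coord.
Qed.

Let L4_psi t : L4 P (fun w => enorm (psi t w)).
Proof.
have [_ [_ [Y [iX _ _ _] _]] _ _ _] := hnoise t; split=> //.
by apply: measurable_enorm => i; exact: measurable_coord.
Qed.

Let enorm_G_le t w : enorm (G (x t w) (y t w)) <= L * (a t w + b t w).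
Proof. by rewrite (le_trans (G_le hG _ _))// mulrDr lerD// ler_wpM2r//; exact: enorm_ge0. Qed.

(** This bound and the next are deliberately crude: they only propagate the finiteness of fourth
    moments by induction. *)
Let next_slow_le t w : b t.+1 w <= b t w + L * (L * (a t w + b t w)) + L * enorm (psi t w).
Proof.
have [_ _ _ hy] := hiter; rewrite /b /yhat hy.
rewrite (_ : _ - ystar = y t w - ystar - beta t *: G (x t w) (y t w) - beta t *: psi t w); last first.
  by apply/matrixP => i j; rewrite !mxE; ring.
have [_ bL _] := stepL t; have b0 := ltW (beta0 t).
rewrite (le_trans (enormB_le _ _))// lerD//; last first.
  by rewrite enormZ ger0_norm// ler_wpM2r//; exact: enorm_ge0.
rewrite (le_trans (enormB_le _ _))// lerD// enormZ ger0_norm//.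
by apply: ler_pM => //; first [nneg | exact: enorm_G_le].
Qed.

Let next_fast_le t w : a t.+1 w <= a t w + L * (L * a t w) + L * enorm (xi t w) +
  L * (L * (L * (a t w + b t w)) + L * enorm (psi t w)).
Proof.
have [_ _ hx hy] := hiter; rewrite /a /xhat hx hy.
set y' := y t w - _.
rewrite (_ : _ - H y' = x t w - H (y t w) - alpha t *: F (x t w) (y t w) - alpha t *: xi t w
   + (H (y t w) - H y')); last first.
  by apply/matrixP => i j; rewrite !mxE; ring.
have [aL bL _] := stepL t; have b0 := ltW (beta0 t); have al0 := ltW (alpha0 t).
rewrite (le_trans (enormD _ _))//; apply: lerD.
  rewrite (le_trans (enormB_le _ _))// lerD//; last first.
    by rewrite enormZ ger0_norm// ler_wpM2r//; exact: enorm_ge0.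
  rewrite (le_trans (enormB_le _ _))// lerD// enormZ ger0_norm//.
  apply: ler_pM => //; first by nneg.
  by rewrite (le_trans (F_le hF _ _))// ler_wpM2r//; exact: enorm_ge0.
rewrite (le_trans (H_le hF _ _))// /y' subKr scalerDr.
apply: ler_pM => //; try nneg; first by have [_ [/ltW]] := hF.
rewrite (le_trans (enormD _ _))//; apply: lerD; rewrite enormZ ger0_norm//.
  by apply: ler_pM => //; first [nneg | exact: enorm_G_le].
by rewrite ler_wpM2r//; exact: enorm_ge0.
Qed.

Lemma L4_errors t : L4 P (a t) /\ L4 P (b t).
Proof.
elim: t => [|t [IHa IHb]].
  have [hx0 hy0 _ _] := hiter; rewrite /a /b /xhat /yhat.
  split; [rewrite (_ : (fun w => _) = cst (enorm (x0 - H y0)))|rewrite (_ : (fun w => _) = cst (enorm (y0 - ystar)))];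
    by [exact: L4_cst | apply/funext => w; rewrite ?hx0 hy0].
have Lab : L4 P (fun w => L * (L * (a t w + b t w))) by do 2!apply: L4Z; exact: L4D.
have Lp : L4 P (fun w => L * enorm (psi t w)) by exact: L4Z.
split.
  apply: (L4_le _ (Y := fun w => a t w + L * (L * a t w) + L * enorm (xi t w) +
    L * (L * (L * (a t w + b t w)) + L * enorm (psi t w)))) => [|w|].
  - exact: (adapted_measurable (sigF _) (@subF _) (@ma _)).
  - by rewrite ger0_norm; [exact: next_fast_le | exact: enorm_ge0].
  - apply: L4D; last by apply: L4Z; exact: L4D.
    apply: L4D; last exact: L4Z.
    by apply: L4D => //; do 2!apply: L4Z.
apply: (L4_le _ (Y := fun w => b t w + L * (L * (a t w + b t w)) + L * enorm (psi t w))) => [|w|].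
- exact: (adapted_measurable (sigF _) (@subF _) (@mb _)).
- by rewrite ger0_norm; [exact: next_slow_le | exact: enorm_ge0].
- by apply: L4D => //; apply: L4D.
Qed.

Let A4 t := adapted4 P (Ft t).

Let A4_le t X Y : adapted (Ft t) X -> (forall w, `|X w| <= Y w) -> L4 P Y -> A4 t X.
Proof. exact: (adapted4_le (sigF t) (@subF t)). Qed.

Let A4_xhat t i : A4 t (fun w => xhat t w i 0).
Proof.
apply: (@A4_le _ _ (a t)) => // [w|]; first exact: normr_coord_le.
by have [] := L4_errors t.
Qed.

Let A4_yhat t i : A4 t (fun w => yhat t w i 0).
Proof.
apply: (@A4_le _ _ (b t)) => // [w|]; first exact: normr_coord_le.
by have [] := L4_errors t.
Qed.

Let sm_le t w : enorm (sm t w) <= b t w + L * (L * (a t w + b t w)).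
Proof.
have [_ bL _] := stepL t; have b0 := ltW (beta0 t).
rewrite (le_trans (enormB_le _ _))// lerD// enormZ ger0_norm//.
by apply: ler_pM => //; first [nneg | exact: enorm_G_le].
Qed.

Let fm_le t w : enorm (fm t w) <= a t w + L * (L * a t w) + L * (L * (L * (a t w + b t w))).
Proof.
have [aL bL _] := stepL t; have b0 := ltW (beta0 t); have al0 := ltW (alpha0 t).
rewrite (_ : fm t w = x t w - H (y t w) - alpha t *: F (x t w) (y t w) + (H (y t w) - H (sd t w))); last first.
  by apply/matrixP => i j; rewrite /fm /fast_mean -/(sd t w) !mxE; ring.
rewrite (le_trans (enormD _ _))//; apply: lerD.
  rewrite (le_trans (enormB_le _ _))// lerD// enormZ ger0_norm//.
  apply: ler_pM => //; first by nneg.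
  by rewrite (le_trans (F_le hF _ _))// ler_wpM2r//; exact: enorm_ge0.
rewrite (le_trans (H_le hF _ _))// /sd /slow_drift subKr.
apply: ler_pM => //; try nneg; first by have [_ [/ltW]] := hF.
by rewrite enormZ ger0_norm//; apply: ler_pM => //; first [nneg | exact: enorm_G_le].
Qed.

Let L4_sm_bound t : L4 P (fun w => b t w + L * (L * (a t w + b t w))).
Proof.
have [la lb] := L4_errors t.
by apply: L4D => //; do 2!apply: L4Z; exact: L4D.
Qed.

Let L4_fm_bound t : L4 P (fun w => a t w + L * (L * a t w) + L * (L * (L * (a t w + b t w)))).
Proof.
have [la lb] := L4_errors t.
apply: L4D; last by do 3!apply: L4Z; exact: L4D.
by apply: L4D => //; do 2!apply: L4Z.
Qed.

Let A4_sm t i : A4 t (fun w => sm t w i 0).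
Proof.
apply: (A4_le _ _ (L4_sm_bound t)) => [|w]; first exact: msm.
exact: (le_trans (normr_coord_le _ _) (sm_le _ _)).
Qed.

Let A4_fm t i : A4 t (fun w => fm t w i 0).
Proof.
apply: (A4_le _ _ (L4_fm_bound t)) => [|w]; first exact: mfm.
exact: (le_trans (normr_coord_le _ _) (fm_le _ _)).
Qed.

Let A4_enorm_sm t : A4 t (fun w => enorm (sm t w)).
Proof.
apply: (A4_le _ _ (L4_sm_bound t)) => [|w]; first by apply: (@measurable_enorm _ (Tt t)) => i; exact: msm.
by rewrite ger0_norm ?enorm_ge0// sm_le.
Qed.

Let A4_enorm_fm t : A4 t (fun w => enorm (fm t w)).
Proof.
apply: (A4_le _ _ (L4_fm_bound t)) => [|w]; first by apply: (@measurable_enorm _ (Tt t)) => i; exact: mfm.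
by rewrite ger0_norm ?enorm_ge0// fm_le.
Qed.

Let L4_xi_coord t i : L4 P (fun w => xi t w i 0).
Proof. by apply: L4_coord => //; exact: measurable_coord. Qed.

Let L4_psi_coord t i : L4 P (fun w => psi t w i 0).
Proof. by apply: L4_coord => //; exact: measurable_coord. Qed.

(** * First-order noise terms have zero mean *)

Let null_xi t A B C i : A4 t A -> A4 t B -> A4 t C ->
  null P (fun w => A w * B w * C w * xi t w i 0).
Proof.
move=> hA hB hC; apply: (null_mul_noise (sigF t) (@subF t)) => //.
have [[/(_ i 0) h _] _ _ _ _] := hnoise t.
rewrite (_ : cst 0 = fun w : T => (cst (0 : 'cV[R]_dx) w) i 0)//.
by apply/funext => w; rewrite mxE.
Qed.

Let null_psi t A B C i : A4 t A -> A4 t B -> A4 t C ->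
  null P (fun w => A w * B w * C w * psi t w i 0).
Proof.
move=> hA hB hC; apply: (null_mul_noise (sigF t) (@subF t)) => //.
have [[_ /(_ i 0) h] _ _ _ _] := hnoise t.
rewrite (_ : cst 0 = fun w : T => (cst (0 : 'cV[R]_dy) w) i 0)//.
by apply/funext => w; rewrite mxE.
Qed.

(** The differential is taken at [sd t], a function of the past, so expanding [psi] in the basis
    leaves adapted coefficients. Since these are bounded by [LH], multiplying by them preserves
    fourth moments. *)
Lemma null_fast_noise t A B C i : A4 t A -> A4 t B -> A4 t C ->
  null P (fun w => A w * B w * C w * fnoise t w i 0).
Proof.
move=> hA hB hC.
pose D j w := 'd H (sd t w) (delta_mx j 0) i 0.
have hCD j : A4 t (fun w => C w * D j w).
  apply: (adapted4_bounded (sigF t) (@subF t) (c := LH)) => // [|w]; first exact: mdiff.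
  by rewrite (le_trans (normr_coord_le _ _))// (le_trans (H_differential_le hF hH _ _))// enorm_delta mulr1.
apply: (@eq_null _ _ _ _ (fun w => beta t * (\sum_(j < dy) A w * B w * (C w * D j w) * psi t w j 0) -
    alpha t * (A w * B w * C w * xi t w i 0))).
  move=> w.
  have fnE : fnoise t w i 0 = beta t * (\sum_(j < dy) psi t w j 0 * D j w) - alpha t * xi t w i 0.
    rewrite /fnoise /fast_noise -/(sd t w) [in LHS](matrix_sum_delta (psi t w)) linear_sum/=.
    rewrite !mxE summxE; congr (_ * _ - _).
    by apply: eq_bigr => j _; rewrite big_ord1 linearZ/= mxE.
  rewrite fnE mulrBr; congr (_ - _); last by ring.
  rewrite [in RHS]mulrCA; congr (_ * _); rewrite mulr_sumr.
  by apply: eq_bigr => j _; ring.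
by apply: nullB; apply: nullZ; [apply: null_sum => j; exact: null_psi | exact: null_xi].
Qed.

Lemma null_dotp_fast_noise t A B (V : T -> 'cV[R]_dx) : A4 t A -> A4 t B ->
  (forall i, A4 t (fun w => V w i 0)) ->
  null P (fun w => A w * B w * dotp (V w) (fnoise t w)).
Proof.
move=> hA hB hV; apply: (@eq_null _ _ _ _ (fun w => \sum_(i < dx) A w * B w * V w i 0 * fnoise t w i 0)).
  by move=> w; rewrite mulr_sumr; apply: eq_bigr => i _; rewrite !mulrA.
by apply: null_sum => i; exact: null_fast_noise.
Qed.

Lemma null_dotp_psi t A B (V : T -> 'cV[R]_dy) : A4 t A -> A4 t B ->
  (forall i, A4 t (fun w => V w i 0)) ->
  null P (fun w => A w * B w * dotp (V w) (psi t w)).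
Proof.
move=> hA hB hV; apply: (@eq_null _ _ _ _ (fun w => \sum_(i < dy) A w * B w * V w i 0 * psi t w i 0)).
  by move=> w; rewrite mulr_sumr; apply: eq_bigr => i _; rewrite !mulrA.
by apply: null_sum => i; exact: null_psi.
Qed.

Definition noise_const : R := 1 + Gamma11 ^+ 2 + Gamma22 ^+ 2.

Lemma noise_weight_le t W : adapted (Ft t) W -> (forall w, 0 <= W w) -> integ P W ->
  integ P (fun w => W w * (1 + enorm (xi t w) ^+ 4 + enorm (psi t w) ^+ 4)) /\
  mean P (fun w => W w * (1 + enorm (xi t w) ^+ 4 + enorm (psi t w) ^+ 4)) <=
    noise_const * mean P W.
Proof.
move=> aW W0 iW; have [_ [hxi hpsi] _ _ _] := hnoise t.
have e40 n (v : 'cV[R]_n) : 0 <= enorm v ^+ 4 by nneg.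
have [i1 m1] := ge0_cond_moment_le (sigF t) (@subF t) (sqr_ge0 Gamma11) aW W0 iW (fun w => e40 _ _) hxi.
have [i2 m2] := ge0_cond_moment_le (sigF t) (@subF t) (sqr_ge0 Gamma22) aW W0 iW (fun w => e40 _ _) hpsi.
have -> : (fun w => W w * (1 + enorm (xi t w) ^+ 4 + enorm (psi t w) ^+ 4)) =
    (fun w => W w + W w * enorm (xi t w) ^+ 4 + W w * enorm (psi t w) ^+ 4).
  by apply/funext => w; rewrite !mulrDr mulr1.
have i01 : integ P (fun w => W w + W w * enorm (xi t w) ^+ 4) by exact: integD.
split; first exact: integD.
by rewrite !meanD// /noise_const; lra.
Qed.

Let K := noise_const.
Let K1 : 1 <= K. Proof. by rewrite /K /noise_const -addrA lerDl; nneg. Qed.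
Let K0 : 0 < K. Proof. exact: lt_le_trans K1. Qed.

Let integ_sqr_comb c X Y : L4 P X -> L4 P Y -> integ P (fun w => (X w ^+ 2 + c * Y w ^+ 2) ^+ 2).
Proof.
move=> [lX iX] [lY iY].
apply: (integ_le _ _ (integD (integZ 2 iX) (integZ (2 * c ^+ 2) iY))) => [|w].
  apply: measurable_funX; apply: measurable_funD; first exact: measurable_funX.
  by apply: measurable_funM => //; exact: measurable_funX.
rewrite ger0_norm ?sqr_ge0//.
have sq4 (u : R) : u ^+ 4 = (u ^+ 2) ^+ 2 by rewrite -exprM.
by rewrite !sq4; have := sqr_ge0 (X w ^+ 2 - c * Y w ^+ 2); lra.
Qed.

Let w_ge0 t : 0 <= w_ t.
Proof.
have [_ [LGx0 _] _ _] := hG.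
rewrite /w_ /lyapunov_weight; have := alpha0 t; have := beta0 t => ? ?; nneg.
Qed.

(** Monotonicity of [beta / alpha] allows the weight of time [t] to be kept during the step to
    [t + 1]. *)
Let w_le t : w_ t.+1 <= w_ t.
Proof.
have [_ _ _ hratio _] := hstep; have [_ [LGx0 _] _ _] := hG.
by rewrite /w_ /lyapunov_weight ler_wpM2l ?hratio//; nneg.
Qed.

(** * The recursion for the mean of [V^2] *)

Let V t w := b t w ^+ 2 + w_ t * a t w ^+ 2.
(** The value that [V] takes after a step without noise, with the weight of time [t]. *)
Let s2 t w := enorm (sm t w) ^+ 2 + w_ t * enorm (fm t w) ^+ 2.

Let V_ge0 t w : 0 <= V t w. Proof. by rewrite /V addr_ge0 ?sqr_ge0// mulr_ge0 ?sqr_ge0. Qed.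
Let s2_ge0 t w : 0 <= s2 t w. Proof. by rewrite /s2 addr_ge0 ?sqr_ge0// mulr_ge0 ?sqr_ge0. Qed.

Let integ_V t : integ P (fun w => V t w ^+ 2).
Proof. by have [la lb] := L4_errors t; exact: integ_sqr_comb. Qed.

Let integ_s2 t : integ P (fun w => s2 t w ^+ 2).
Proof. by apply: integ_sqr_comb; [have [] := A4_enorm_sm t | have [] := A4_enorm_fm t]. Qed.

Let adapted_s2 t : adapted (Ft t) (fun w => s2 t w ^+ 2).
Proof.
apply: adaptedX; apply: adaptedD; first by apply: adaptedX; have [] := A4_enorm_sm t.
apply: adaptedM; first exact: measurable_cst.
by apply: adaptedX; have [] := A4_enorm_fm t.
Qed.

Let weighted_noise t (c e1 e2 : R) (Z : T -> R) : 0 <= c -> 0 <= e1 -> 0 <= e2 ->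
  (forall w, 0 <= Z w) -> adapted (Ft t) Z -> integ P Z ->
  integ P (fun w => c * (e1 * Z w + e2) * (1 + enorm (xi t w) ^+ 4 + enorm (psi t w) ^+ 4)) /\
  mean P (fun w => c * (e1 * Z w + e2) * (1 + enorm (xi t w) ^+ 4 + enorm (psi t w) ^+ 4)) <=
    K * (c * (e1 * mean P Z + e2)).
Proof.
move=> c0 e10 e20 Z0 aZ iZ.
have ie : integ P (fun w => e1 * Z w + e2) by apply: integD; [exact: integZ | exact: integ_cst].
have -> : c * (e1 * mean P Z + e2) = mean P (fun w => c * (e1 * Z w + e2)).
  by rewrite meanZ// meanD ?meanZ ?mean_cst//; [exact: integZ | exact: integ_cst].
apply: noise_weight_le; last exact: integZ.
  apply: adaptedM; first exact: measurable_cst.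
  by apply: adaptedD; [apply: adaptedM => //|]; exact: measurable_cst.
by move=> w; rewrite mulr_ge0// addr_ge0// mulr_ge0.
Qed.

Let martingale_null t : null P (fun w => 2 * s2 t w *
  lyapunov_martingale LGx muF muG F G H ystar (alpha t) (beta t) (x t w) (y t w) (xi t w) (psi t w)).
Proof.
apply: (@eq_null _ _ _ _ (fun w =>
   (4 * w_ t) * (enorm (sm t w) * enorm (sm t w) * dotp (fm t w) (fnoise t w)) +
   (4 * w_ t ^+ 2) * (enorm (fm t w) * enorm (fm t w) * dotp (fm t w) (fnoise t w)) +
   (- (4 * beta t)) * (enorm (sm t w) * enorm (sm t w) * dotp (sm t w) (psi t w)) +
   (- (4 * beta t * w_ t)) * (enorm (fm t w) * enorm (fm t w) * dotp (sm t w) (psi t w)))).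
  by move=> w; rewrite /s2 /lyapunov_martingale -/(fm t w) -/(sm t w) -/(w_ t) -/(fnoise t w); ring.
by repeat first [apply: nullD | apply: nullZ]; (apply: null_dotp_fast_noise || apply: null_dotp_psi).
Qed.

(* With this last argument the noise consumes a tenth of the drift. *)
Let perturb_V := perturb_const (4 * L ^+ 7) L (muG / (10 * K)).

Let perturb_V_ge0 : 0 <= perturb_V.
Proof. by apply: perturb_const_ge0 => //; rewrite divr_gt0// mulr_gt0. Qed.

(** With [n = muG beta], squaring the contraction of [s2] gives a rate of 1.4 n, the noise returns n
    / 10, and the remaining 0.3 n covers the terms in [n^2] and [n^3] because n <= 1/14. *)
Lemma lyapunov_recursion t :
  mean P (fun w => V t.+1 w ^+ 2) <=
  (1 - muG * beta t) * mean P (fun w => V t w ^+ 2) + K * perturb_V * beta t * alpha t ^+ 2.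
Proof.
have eps0 : 0 < muG / (10 * K) by rewrite divr_gt0// mulr_gt0.
have [_ _ hx hy] := hiter.
have [inull mnull] := martingale_null t.
have [inoise mnoise] := weighted_noise (ltW (beta0 t)) (ltW eps0)
  (mulr_ge0 perturb_V_ge0 (sqr_ge0 (alpha t))) (fun w => sqr_ge0 (s2 t w)) (@adapted_s2 t) (integ_s2 t).
have isum : integ P (fun w => s2 t w ^+ 2 + 2 * s2 t w *
  lyapunov_martingale LGx muF muG F G H ystar (alpha t) (beta t) (x t w) (y t w) (xi t w) (psi t w)).
  exact: integD.
have step1 : mean P (fun w => V t.+1 w ^+ 2) <= mean P (fun w => s2 t w ^+ 2) +
    K * (beta t * (muG / (10 * K) * mean P (fun w => s2 t w ^+ 2) + perturb_V * alpha t ^+ 2)).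
  apply: (le_trans (le_mean _ (integD isum inoise) _)) => //.
    move=> w; apply: (@le_trans _ _ ((b t.+1 w ^+ 2 + w_ t * a t.+1 w ^+ 2) ^+ 2)).
      rewrite ler_pXn2r ?nnegrE//.
        by rewrite lerD2l ler_wpM2r ?sqr_ge0// w_le.
      by rewrite addr_ge0 ?sqr_ge0// mulr_ge0 ?sqr_ge0.
    rewrite /a /b /xhat /yhat hx hy.
    exact: (lyapunov_sqr_le hF hG hmono hH L1 LHL SHL muFL muGL (alpha0 t) (beta0 t)
      (halpha t) (hbeta t) (hkappa t) muFGL omegaL (xi t w) (psi t w) eps0 (erefl (s2 t w))).
  by rewrite meanD// meanD// mnull addr0 lerD2l.
apply: (le_trans step1).
have [hbm _] := step_beta hG hmono (hbeta t).
set m := mean P (fun w => V t w ^+ 2).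
have hm : mean P (fun w => s2 t w ^+ 2) <= (1 - 7 / 10 * (beta t * muG)) ^+ 2 * m.
  rewrite -meanZ//; apply: le_mean => // [|w]; first exact: integZ.
  rewrite -exprMn ler_pXn2r ?nnegrE//.
    exact: (lyapunov_mean_le hF hG hmono (alpha0 t) (beta0 t) (halpha t) (hbeta t) (hkappa t)).
  apply: mulr_ge0 => //.
  have bm0 : 0 < beta t * muG by rewrite mulr_gt0.
  by lra.
have m0 : 0 <= m by apply: mean_ge0 => w; exact: sqr_ge0.
have n0 : 0 < beta t * muG by rewrite mulr_gt0.
set n := beta t * muG in hbm hm n0.
set q := mean P _ in hm *.
have -> : q + K * (beta t * (muG / (10 * K) * q + perturb_V * alpha t ^+ 2)) =
    (1 + n / 10) * q + K * perturb_V * beta t * alpha t ^+ 2.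
  by rewrite /n; field; rewrite gt_eqF.
rewrite lerD2r [muG * _]mulrC -/n.
apply: (@le_trans _ _ ((1 + n / 10) * ((1 - 7 / 10 * n) ^+ 2 * m))).
  by rewrite ler_wpM2l//; lra.
rewrite mulrA ler_wpM2r//.
have nn : n ^+ 2 <= n * (1 / 14) by rewrite expr2 ler_wpM2l// ltW.
have nn0 := ltW n0.
have nnn : n ^+ 3 <= n * (1 / 14).
  rewrite exprS ler_wpM2l//; lra.
lra.
Qed.

(** * The recursion for the mean of |xhat|^4 *)

Let perturb_a := perturb_const (4 * L ^+ 21) L (muF / (10 * K)).

Let perturb_a_ge0 : 0 <= perturb_a.
Proof. by apply: perturb_const_ge0 => //; rewrite divr_gt0// mulr_gt0. Qed.

(** [yhat] enters through [b^4 <= V^2] as a source. With [m = muF alpha], Young's inequality uses (1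
    + m)(1 - 3/2 m)^2 <= 1 - 2 m, and the noise factor 1 + m / 10 reduces the rate to [m]. The
    source has coefficient 2 * 121 = 242, at most doubled by the noise factor, hence below 500. *)
Lemma fast_recursion t :
  mean P (fun w => a t.+1 w ^+ 4) <= (1 - muF * alpha t) * mean P (fun w => a t w ^+ 4) +
    alpha t * (500 * L ^+ 15 * mean P (fun w => V t w ^+ 2) + K * perturb_a * alpha t ^+ 2).
Proof.
have sq4 (u : R) : u ^+ 4 = (u ^+ 2) ^+ 2 by rewrite -exprM.
have eps0 : 0 < muF / (10 * K) by rewrite divr_gt0// mulr_gt0.
have [_ _ hx hy] := hiter.
have [la lb] := L4_errors t; have [_ ia] := la; have [_ ib] := lb.
have [_ ia'] := (L4_errors t.+1).1.
have [_ [mfmn ifm]] := A4_enorm_fm t.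
have ifm2 : integ P (fun w => (enorm (fm t w) ^+ 2) ^+ 2).
  by apply: eq_integrable ifm => // w _ /=; rewrite sq4.
have [inull mnull] : null P (fun w => 2 * enorm (fm t w) ^+ 2 * (2 * dotp (fm t w) (fnoise t w))).
  apply: (@eq_null _ _ _ _ (fun w => 4 * (enorm (fm t w) * enorm (fm t w) * dotp (fm t w) (fnoise t w)))).
    by move=> w; ring.
  by apply: nullZ; exact: null_dotp_fast_noise.
have afm2 : adapted (Ft t) (fun w => (enorm (fm t w) ^+ 2) ^+ 2).
  by do 2!apply: adaptedX; have [] := A4_enorm_fm t.
have [inoise mnoise] := weighted_noise (ltW (alpha0 t)) (ltW eps0)
  (mulr_ge0 perturb_a_ge0 (sqr_ge0 (alpha t))) (fun w => sqr_ge0 (enorm (fm t w) ^+ 2)) afm2 ifm2.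
have isum := integD ifm2 inull.
have step1 : mean P (fun w => a t.+1 w ^+ 4) <= mean P (fun w => (enorm (fm t w) ^+ 2) ^+ 2) +
    K * (alpha t * (muF / (10 * K) * mean P (fun w => (enorm (fm t w) ^+ 2) ^+ 2) + perturb_a * alpha t ^+ 2)).
  apply: (le_trans (le_mean ia' (integD isum inoise) _)).
    move=> w; rewrite sq4 /a /xhat hx hy.
    exact: (fast_sqr_le hF hG hmono hH L1 LHL SHL muFL muGL (alpha0 t) (beta0 t)
      (halpha t) (hbeta t) (hkappa t) muFGL (x t w) (y t w) (xi t w) (psi t w) eps0).
  by rewrite meanD// meanD// mnull addr0 lerD2l.
apply: (le_trans step1).
have [hm _] := step_alpha hF hmono (halpha t).
have m0 : 0 < alpha t * muF by rewrite mulr_gt0.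
have [aL bL baL] := stepL t.
have al0 := ltW (alpha0 t); have be0 := ltW (beta0 t).
have fmb w : enorm (fm t w) ^+ 2 <= (1 - 3 / 2 * (alpha t * muF)) * a t w ^+ 2 +
    11 * L ^+ 7 * alpha t * b t w ^+ 2.
  have := fast_mean_le hF hG hmono (alpha0 t) (beta0 t) (halpha t) (hkappa t) (x t w) (y t w).
  move=> /le_trans; apply; rewrite lerD2l -/(yhat t w) -/(b t w).
  have [_ [LH0 _] _ _] := hF; have [_ [_ LGy0] _ _] := hG.
  have h1 : beta t * LH * LGy <= (L * alpha t) * L * L.
    by do 2!(apply: ler_pM => //; try nneg).
  have h2 : (beta t * LH * LGy) ^+ 2 <= (L * alpha t * L * L) ^+ 2.
    by rewrite ler_pXn2r ?nnegrE//; nneg.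
  have -> : 11 * (beta t * LH * LGy * b t w) ^+ 2 / (alpha t * muF) =
      11 * b t w ^+ 2 / alpha t * ((beta t * LH * LGy) ^+ 2 * muF^-1).
    by field; rewrite !gt_eqF.
  have -> : 11 * L ^+ 7 * alpha t * b t w ^+ 2 = 11 * b t w ^+ 2 / alpha t * ((L * alpha t * L * L) ^+ 2 * L).
    by field; rewrite gt_eqF.
  apply: ler_wpM2l; first by nneg.
  by apply: ler_pM => //; nneg.
set m := alpha t * muF in hm m0 fmb.
set A := mean P (fun w => a t w ^+ 4).
set Bm := mean P (fun w => V t w ^+ 2).
have bV : mean P (fun w => b t w ^+ 4) <= Bm.
  apply: le_mean => // w; rewrite sq4 ler_pXn2r ?nnegrE//; first by rewrite /V lerDl mulr_ge0// sqr_ge0.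
  exact: sqr_ge0.
have hq : mean P (fun w => (enorm (fm t w) ^+ 2) ^+ 2) <= (1 - 2 * m) * A + 242 * L ^+ 15 * alpha t * Bm.
  apply: (@le_trans _ _ (mean P (fun w => (1 - 2 * m) * a t w ^+ 4 + 242 * L ^+ 15 * alpha t * b t w ^+ 4))).
    apply: le_mean => // [|w]; first by apply: integD; exact: integZ.
    set X := (1 - 3 / 2 * m) * a t w ^+ 2; set Y := 11 * L ^+ 7 * alpha t * b t w ^+ 2.
    have X0 : 0 <= X by rewrite /X mulr_ge0 ?sqr_ge0//; lra.
    have Y0 : 0 <= Y by rewrite /Y; nneg.
    apply: (@le_trans _ _ ((X + Y) ^+ 2)).
      by rewrite ler_pXn2r ?nnegrE ?sqr_ge0 ?addr_ge0// fmb.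
    have m20 : 0 < m / 2 by rewrite divr_gt0.
    have h1 := young X Y m20.
    have h2 : 12 * Y ^+ 2 <= Y ^+ 2 / m by rewrite ler_pdivlMr//; have := sqr_ge0 Y; nra.
    rewrite (_ : Y ^+ 2 / (4 * (m / 2)) = Y ^+ 2 / m / 2) in h1; last by field; rewrite gt_eqF.
    have h3 : Y ^+ 2 / m <= 121 * L ^+ 15 * alpha t * b t w ^+ 4.
      rewrite ler_pdivrMr// /Y /m sq4.
      rewrite [leRHS](_ : _ = 121 * L ^+ 14 * alpha t ^+ 2 * (b t w ^+ 2) ^+ 2 * (L * muF)); last by ring.
      rewrite [leLHS](_ : _ = 121 * L ^+ 14 * alpha t ^+ 2 * (b t w ^+ 2) ^+ 2); last by ring.
      apply: ler_peMr; first by nneg.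
      by rewrite -ler_pdivrMr// mul1r.
    have h4 : (1 + m) * X ^+ 2 <= (1 - 2 * m) * a t w ^+ 4.
      rewrite /X exprMn -sq4 mulrA ler_wpM2r ?sq4 ?sqr_ge0//.
      have m3 : m ^+ 3 <= m ^+ 2 * (1 / 12) by rewrite [m ^+ 3]exprSr ler_wpM2l ?sqr_ge0.
      have := sqr_ge0 m; lra.
    have -> : (X + Y) ^+ 2 = X ^+ 2 + 2 * (X * Y) + Y ^+ 2 by ring.
    have := sqr_ge0 Y; lra.
  rewrite meanD; [|exact: integZ|exact: integZ].
  by rewrite meanZ// meanZ// lerD2l; apply: ler_wpM2l bV; nneg.
set q := mean P _ in hq *.
have -> : q + K * (alpha t * (muF / (10 * K) * q + perturb_a * alpha t ^+ 2)) =
    (1 + m / 10) * q + K * perturb_a * alpha t * alpha t ^+ 2.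
  by rewrite /m; field; rewrite gt_eqF.
have A0 : 0 <= A by apply: mean_ge0 => w; rewrite sq4 sqr_ge0.
have Bm0 : 0 <= Bm by apply: mean_ge0 => w; exact: sqr_ge0.
have h1 : (1 + m / 10) * q <= (1 + m / 10) * ((1 - 2 * m) * A + 242 * L ^+ 15 * alpha t * Bm).
  by rewrite ler_wpM2l//; lra.
have h2 : (1 + m / 10) * (1 - 2 * m) * A <= (1 - m) * A.
  by rewrite ler_wpM2r//; have := sqr_ge0 m; lra.
have B'0 : 0 <= L ^+ 15 * alpha t * Bm by nneg.
have h3 : (1 + m / 10) * (242 * (L ^+ 15 * alpha t * Bm)) <= 2 * (242 * (L ^+ 15 * alpha t * Bm)).
  have : m * (L ^+ 15 * alpha t * Bm) <= 1 * (L ^+ 15 * alpha t * Bm) by apply: ler_wpM2r => //; lra.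
  lra.
rewrite [muF * _]mulrC -/m; lra.
Qed.

(** * Slow variation of the step sizes *)

Let alpha_le t : alpha t.+1 <= alpha t.
Proof.
by have [_ _ /(_ t.+1 isT)[/andP[+ _] _] _ _] := hstep; rewrite ler_pdivlMr// mul1r.
Qed.

Let beta_le t : beta t.+1 <= beta t.
Proof.
by have [_ _ /(_ t.+1 isT)[_ /andP[+ _]] _ _] := hstep; rewrite ler_pdivlMr// mul1r.
Qed.

Let ratio t := alpha t / alpha t.+1.

Let ratio_ge1 t : 1 <= ratio t.
Proof. by rewrite /ratio ler_pdivlMr// mul1r. Qed.

Let alphaE t : alpha t = ratio t * alpha t.+1.
Proof. by rewrite /ratio mulfVK// gt_eqF. Qed.

(** The condition at index [t + 1] involves [alpha_(t+1)], which is at most [alpha_t]. This bound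
    and [ratio_slow] serve the Gronwall arguments at rates [muF alpha] and [muG beta]
    respectively. *)
Let ratio_fast t : ratio t <= 1 + muF * alpha t / 16.
Proof.
have [_ /andP[d0 d1] _ _ _] := hlin.
have [_ _ /(_ t.+1 isT)[/andP[_ +] _] _ _] := hstep.
rewrite -/(ratio t) => /le_trans; apply; rewrite lerD2l !ge_min.
have -> : deltaF * muF / 16 * alpha t.+1 <= muF * alpha t / 16; last by [].
rewrite [leRHS](_ : _ = 1 * (muF / 16) * alpha t); last by ring.
by rewrite -[deltaF * _ / _]mulrA; do 2!(apply: ler_pM => //; try nneg).
Qed.

Let ratio_slow t : ratio t <= 1 + muG * beta t / 16.
Proof.
have [_ /andP[d0 d1] _ _ _] := hlin.
have [_ _ /(_ t.+1 isT)[/andP[_ +] _] _ _] := hstep.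
rewrite -/(ratio t) => /le_trans; apply; rewrite lerD2l !ge_min.
have -> : deltaF * muG / 16 * beta t.+1 <= muG * beta t / 16; last by rewrite orbT.
rewrite [leRHS](_ : _ = 1 * (muG / 16) * beta t); last by ring.
by rewrite -[deltaF * _ / _]mulrA; do 2!(apply: ler_pM => //; try nneg).
Qed.

Let beta_ratio t : beta t <= (1 + muG * beta t / 64) * beta t.+1.
Proof.
have [_ _ /(_ t.+1 isT)[_ /andP[_ +]] _ _] := hstep.
rewrite ler_pdivrMr// => /le_trans; apply; rewrite ler_wpM2r// ?(ltW (beta0 _))//.
by rewrite lerD2l mulrAC ler_wpM2r// ler_wpM2l// ltW.
Qed.

Let step_small t : [/\ muF * alpha t <= 1 / 12, muG * beta t <= 1 / 12 & 5 * (muG * beta t) <= muF * alpha t].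
Proof.
have [h1 _] := step_alpha hF hmono (halpha t).
have [h2 _] := step_beta hG hmono (hbeta t).
have [_ h3] := step_ratio hF hG hmono (alpha0 t) (beta0 t) (hkappa t).
by split; lra.
Qed.

Let sqr_ratio_le (e r : R) : 0 <= e <= 1 / 12 -> 1 <= r <= 1 + e / 16 -> r ^+ 2 <= 1 + e / 4.
Proof.
move=> /andP[e0 e1] /andP[r0 r1].
apply: (@le_trans _ _ ((1 + e / 16) ^+ 2)).
  by rewrite ler_pXn2r ?nnegrE//; lra.
have := ler_wpM2l e0 e1; lra.
Qed.

(** The ratio is at least 1, so its power 1 + c is at most its square. *)
Let powR_ratio t (e c : R) : 0 <= e <= 1 / 12 -> ratio t <= 1 + e / 16 -> 0 <= c <= 1 ->
  alpha t `^ (1 + c) <= (1 + e / 4) * alpha t.+1 `^ (1 + c).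
Proof.
move=> he hr /andP[c0 c1]; have := ltW (alpha0 t.+1) => a1.
have r0 : 0 <= ratio t by apply: le_trans (ratio_ge1 t).
rewrite alphaE powRM// ler_wpM2r ?powR_ge0//.
rewrite (le_trans (powR_le_expn (n := 2) (ratio_ge1 t) _))//; first by lra.
by apply: sqr_ratio_le => //; rewrite ratio_ge1.
Qed.

Let sqr_alpha_ratio t (e : R) : 0 <= e <= 1 / 12 -> ratio t <= 1 + e / 16 ->
  alpha t ^+ 2 <= (1 + e / 4) * alpha t.+1 ^+ 2.
Proof.
move=> he hr; rewrite alphaE exprMn ler_wpM2r ?sqr_ge0//.
by apply: sqr_ratio_le => //; rewrite ratio_ge1.
Qed.

(** * Fourth moments of order [alpha^2] *)

Hypotheses (alpha0L : (alpha 0 ^+ 2)^-1 <= L)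
  (xhat0L : enorm (x0 - H y0) <= L) (yhat0L : enorm (y0 - ystar) <= L).

Let a0E w : a 0 w = enorm (x0 - H y0).
Proof. by have [hx hy _ _] := hiter; rewrite /a /xhat hx hy. Qed.

Let b0E w : b 0 w = enorm (y0 - ystar).
Proof. by have [hx hy _ _] := hiter; rewrite /b /yhat hy. Qed.

Let w0L : w_ 0 <= L ^+ 2.
Proof.
have [aL bL baL] := stepL 0; rewrite /w_ /lyapunov_weight expr2; apply: ler_pM => //.
- by have [_ [LGx0 _] _ _] := hG; nneg.
- by have := alpha0 0; have := beta0 0 => ? ?; nneg.
- by rewrite ler_pdivrMr.
Qed.

Let alpha0_sqr : 1 <= L * alpha 0 ^+ 2.
Proof. by rewrite -ler_pdivrMr ?exprn_gt0// mul1r. Qed.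

(** The first summand is what [discrete_gronwall] asks of [M]; the second covers the start, where
    [V^2 <= 4 L^8 <= 4 L^9 alpha_0^2]. The constants [fast_const], [cross_const] and [slow_const]
    are built likewise. *)
Definition lyapunov_const : R := 2 * K * perturb_V / muG + 4 * L ^+ 9.

Lemma lyapunov_bound t : mean P (fun w => V t w ^+ 2) <= lyapunov_const * alpha t ^+ 2.
Proof.
have M0 : 0 <= lyapunov_const by rewrite /lyapunov_const; have := ltW K0 => ?; nneg.
apply: (@discrete_gronwall _ (fun t => mean P (fun w => V t w ^+ 2)) beta
  (fun t => alpha t ^+ 2) muG (K * perturb_V)) => {t}//.
- exact: ltW.
- have -> : lyapunov_const * (muG / 2) = K * perturb_V + 4 * L ^+ 9 * (muG / 2).
    by rewrite /lyapunov_const; field; rewrite gt_eqF.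
  by rewrite lerDl; have := ltW muG0 => ?; nneg.
- by move=> t; exact: ltW.
- by move=> t; have [_ h _] := step_small t; lra.
- by move=> t; exact: sqr_ge0.
- move=> t; have [_ h _] := step_small t.
  have mb0 : 0 <= muG * beta t by rewrite mulr_ge0 ?ltW.
  rewrite (le_trans (sqr_alpha_ratio (e := muG * beta t) _ (ratio_slow t)))//; first by rewrite mb0.
  by rewrite ler_wpM2r ?sqr_ge0// mulrAC lerD2l; lra.
- by move=> t; exact: lyapunov_recursion.
have -> : (fun w => V 0 w ^+ 2) = (fun=> (enorm (y0 - ystar) ^+ 2 + w_ 0 * enorm (x0 - H y0) ^+ 2) ^+ 2).
  by apply/funext => w; rewrite /V a0E b0E.
rewrite mean_cst.
have h1 : enorm (y0 - ystar) ^+ 2 + w_ 0 * enorm (x0 - H y0) ^+ 2 <= 2 * L ^+ 4.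
  have e1 : enorm (y0 - ystar) ^+ 2 <= L ^+ 2 by rewrite ler_pXn2r ?nnegrE//; exact: enorm_ge0.
  have e2 : enorm (x0 - H y0) ^+ 2 <= L ^+ 2 by rewrite ler_pXn2r ?nnegrE//; exact: enorm_ge0.
  have e3 : w_ 0 * enorm (x0 - H y0) ^+ 2 <= L ^+ 2 * L ^+ 2 by apply: ler_pM => //; nneg.
  have e4 : L ^+ 2 <= L ^+ 4 by rewrite ler_weXn2l.
  rewrite -exprD in e3; lra.
apply: (@le_trans _ _ ((2 * L ^+ 4) ^+ 2)).
  rewrite ler_pXn2r ?nnegrE//; last by nneg.
  by rewrite addr_ge0 ?sqr_ge0// mulr_ge0 ?sqr_ge0.
apply: (@le_trans _ _ (4 * L ^+ 9 * alpha 0 ^+ 2)).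
  rewrite (_ : (2 * L ^+ 4) ^+ 2 = 4 * L ^+ 8 * 1); last by ring.
  rewrite (_ : 4 * L ^+ 9 * _ = 4 * L ^+ 8 * (L * alpha 0 ^+ 2)); last by ring.
  by rewrite ler_wpM2l//; nneg.
rewrite ler_wpM2r ?sqr_ge0// /lyapunov_const lerDr; have := ltW K0 => ?; nneg.
Qed.

Definition fast_const : R := 2 * (500 * L ^+ 15 * lyapunov_const + K * perturb_a) / muF + L ^+ 5.

Let lyapunov_const_ge0 : 0 <= lyapunov_const.
Proof. by rewrite /lyapunov_const; have := ltW K0 => ?; nneg. Qed.

Let fast_const_ge0 : 0 <= fast_const.
Proof.
rewrite /fast_const; have := ltW K0; have := lyapunov_const_ge0.
move: lyapunov_const => l ? ?; nneg.
Qed.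

Lemma fast_bound t : mean P (fun w => a t w ^+ 4) <= fast_const * alpha t ^+ 2.
Proof.
pose k := 500 * L ^+ 15 * lyapunov_const + K * perturb_a.
have k0 : 0 <= k.
  rewrite /k; have := ltW K0; have := lyapunov_const_ge0.
  by move: lyapunov_const => l ? ?; nneg.
apply: (@discrete_gronwall _ (fun t => mean P (fun w => a t w ^+ 4)) alpha
  (fun t => alpha t ^+ 2) muF k) => {t}//.
- exact: ltW.
- have -> : fast_const * (muF / 2) = k + L ^+ 5 * (muF / 2).
    by rewrite /fast_const -/k; field; rewrite gt_eqF.
  by rewrite lerDl; have := ltW muF0 => ?; nneg.
- by move=> t; exact: ltW.
- by move=> t; have [h _ _] := step_small t; lra.
- by move=> t; exact: sqr_ge0.
- move=> t; have [h _ _] := step_small t.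
  have mb0 : 0 <= muF * alpha t by rewrite mulr_ge0 ?ltW.
  rewrite (le_trans (sqr_alpha_ratio (e := muF * alpha t) _ (ratio_fast t)))//; first by rewrite mb0.
  by rewrite ler_wpM2r ?sqr_ge0// mulrAC lerD2l; lra.
- move=> t; apply: (le_trans (fast_recursion t)); rewrite lerD2l.
  rewrite (_ : k * _ * _ = alpha t * (500 * L ^+ 15 * (lyapunov_const * alpha t ^+ 2) +
    K * perturb_a * alpha t ^+ 2)); last by rewrite /k; ring.
  apply: ler_wpM2l; first exact: ltW.
  by rewrite lerD2r; apply: ler_wpM2l (lyapunov_bound t); nneg.
have -> : (fun w => a 0 w ^+ 4) = (fun=> enorm (x0 - H y0) ^+ 4).
  by apply/funext => w; rewrite a0E.
rewrite mean_cst.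
apply: (@le_trans _ _ (L ^+ 5 * alpha 0 ^+ 2)).
  apply: (@le_trans _ _ (L ^+ 4 * 1)).
    by rewrite mulr1 ler_pXn2r ?nnegrE//; exact: enorm_ge0.
  rewrite (_ : L ^+ 5 * _ = L ^+ 4 * (L * alpha 0 ^+ 2)); last by ring.
  by rewrite ler_wpM2l//; nneg.
by rewrite ler_wpM2r ?sqr_ge0// /fast_const -/k lerDr; nneg.
Qed.

(** * The columns of the cross covariance *)

Definition size_const : R := 1 + fast_const + lyapunov_const.

Let S4 t w := size4 H ystar (alpha t) (x t w) (y t w).

Let S4E t w : S4 t w = 1 + (alpha t ^+ 2)^-1 * a t w ^+ 4 + (alpha t ^+ 2)^-1 * b t w ^+ 4.
Proof. by rewrite /S4 /size4 -/(xhat t w) -/(a t w) ![_^-1 * _]mulrC. Qed.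

Let S4_ge0 t w : 0 <= S4 t w.
Proof. exact: le_trans ler01 (size4_ge1 _ _ _ _ _). Qed.

Let adapted_S4 t : adapted (Ft t) (S4 t).
Proof.
rewrite (_ : S4 t = fun w => 1 + (alpha t ^+ 2)^-1 * a t w ^+ 4 + (alpha t ^+ 2)^-1 * b t w ^+ 4);
  last by apply/funext => w; exact: S4E.
apply: adaptedD; first apply: adaptedD.
- exact: measurable_cst.
- by apply: adaptedM; [exact: measurable_cst | apply: adaptedX; exact: ma].
- by apply: adaptedM; [exact: measurable_cst | apply: adaptedX; exact: mb].
Qed.

Let integ_S4 t : integ P (S4 t) /\ mean P (S4 t) <= size_const.
Proof.
rewrite (_ : S4 t = fun w => 1 + (alpha t ^+ 2)^-1 * a t w ^+ 4 + (alpha t ^+ 2)^-1 * b t w ^+ 4);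
  last by apply/funext => w; exact: S4E.
have [[_ ia] [_ ib]] := L4_errors t.
have i1 := integ_cst P 1; have i2 := integZ (alpha t ^+ 2)^-1 ia; have i3 := integZ (alpha t ^+ 2)^-1 ib.
split; first by apply: integD => //; exact: integD.
rewrite meanD//; last exact: integD.
rewrite meanD// mean_cst !meanZ// /size_const.
have sq4 (u : R) : u ^+ 4 = (u ^+ 2) ^+ 2 by rewrite -exprM.
have bV : mean P (fun w => b t w ^+ 4) <= mean P (fun w => V t w ^+ 2).
  apply: le_mean => // w; rewrite sq4 ler_pXn2r ?nnegrE//; first by rewrite /V lerDl mulr_ge0// sqr_ge0.
  exact: sqr_ge0.
by apply: lerD; [rewrite lerD2l|]; rewrite mulrC ler_pdivrMr ?exprn_gt0 ?fast_bound//
  (le_trans bV)// lyapunov_bound.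
Qed.

Let size_const_ge0 : 0 <= size_const.
Proof. by apply: le_trans (integ_S4 0).2; apply: mean_ge0 => w. Qed.

Let S4_noise t c : 0 <= c ->
  integ P (fun w => c * (S4 t w * (1 + enorm (xi t w) ^+ 4 + enorm (psi t w) ^+ 4))) /\
  mean P (fun w => c * (S4 t w * (1 + enorm (xi t w) ^+ 4 + enorm (psi t w) ^+ 4))) <=
    c * (K * size_const).
Proof.
move=> c0; have [iS mS] := integ_S4 t.
have [iN mN] := noise_weight_le (@adapted_S4 t) (S4_ge0 t) iS.
split; first exact: integZ.
by rewrite meanZ// ler_wpM2l// (le_trans mN)// ler_wpM2l ?(ltW K0).
Qed.

(** Column [j] of [E xhat yhat^T]. To first order the recursion multiplies this matrix on the left
    by [I - alpha B1], so it acts on each column separately and [B1_contraction] applies. *)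
Definition cross_moment t j : 'cV[R]_dx := \col_i mean P (fun w => xhat t w i 0 * yhat t w j 0).
Definition cross_scale t : R := alpha t `^ (1 + deltaF / 2) + beta t.
Definition cross_rate : R := dx%:R * (28 * L ^+ 5 * (K * size_const)).

Let pmx t w := xhat t w - alpha t *: (B1 *m xhat t w).

Let A4_pmx t i : A4 t (fun w => pmx t w i 0).
Proof.
have [la _] := L4_errors t.
apply: (A4_le _ _ la) => [|w].
  rewrite (_ : (fun w => _) = fun w => xhat t w i 0 - alpha t * (B1 *m xhat t w) i 0); last first.
    by apply/funext => w; rewrite /pmx !mxE.
  apply: (@measurable_funB _ (Tt t)); first exact: mxhat.
  apply: (@measurable_funM _ (Tt t) _ _ (cst _)) => //.
  by apply: (@measurable_mulmx _ (Tt t)) => j; exact: mxhat.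
rewrite (le_trans (normr_coord_le _ _))// (le_trans (B1_contraction hF hmono hlin (alpha0 t) (halpha t) _))//.
rewrite ler_piMl ?enorm_ge0//.
by have [h _ _] := step_small t; have := mulr_gt0 (alpha0 t) muF0; lra.
Qed.

Let integ_xy t i j : integ P (fun w => xhat t w i 0 * yhat t w j 0).
Proof. by apply: integ_mul2; [have [] := A4_xhat t i | have [] := A4_yhat t j]. Qed.

Let mean_pmx t i j : mean P (fun w => pmx t w i 0 * yhat t w j 0) =
  (cross_moment t j - alpha t *: (B1 *m cross_moment t j)) i 0.
Proof.
rewrite (_ : (fun w => _) = fun w => xhat t w i 0 * yhat t w j 0 -
   alpha t * \sum_(k < dx) B1 i k * (xhat t w k 0 * yhat t w j 0)); last first.
  apply/funext => w; rewrite /pmx !mxE mulrBl -mulrA big_distrl/=; congr (_ - _ * _).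
  by apply: eq_bigr => k _; rewrite mulrA.
have is_ : integ P (fun w => \sum_(k < dx) B1 i k * (xhat t w k 0 * yhat t w j 0)).
  by apply: integ_sum => k; exact: integZ.
rewrite meanB//; last exact: integZ.
rewrite meanZ// mean_sum => [|k]; last exact: integZ.
rewrite !mxE; congr (_ - _ * _); apply: eq_bigr => k _.
by rewrite meanZ// mxE.
Qed.

Lemma cross_recursion t j : enorm (cross_moment t.+1 j) <=
  (1 - 7 / 8 * muF * alpha t) * enorm (cross_moment t j) + cross_rate * alpha t * cross_scale t.
Proof.
have [_ _ hx hy] := hiter.
pose e := cross_moment t.+1 j - (cross_moment t j - alpha t *: (B1 *m cross_moment t j)).
pose c := 28 * L ^+ 5 * (alpha t * cross_scale t).
have sc0 : 0 <= cross_scale t by rewrite /cross_scale addr_ge0 ?powR_ge0// ltW.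
have c0 : 0 <= c by rewrite /c; have := ltW (alpha0 t) => ?; nneg.
have [iN mN] := S4_noise t c0.
have ei i : `|e i 0| <= c * (K * size_const).
  have -> : e i 0 = mean P (fun w => xhat t.+1 w i 0 * yhat t.+1 w j 0) -
      mean P (fun w => pmx t w i 0 * yhat t w j 0).
    by rewrite mean_pmx /e mxE [X in X + _]mxE [X in _ + X]mxE.
  have A4c : A4 t (fun=> 1) := adapted4_cst P (Ft t) 1.
  have [i1 m1] : null P (fun w => fnoise t w i 0 * yhat t w j 0 - beta t * (pmx t w i 0 * psi t w j 0)).
    apply: nullB.
      apply: eq_null (null_fast_noise i (A4_yhat t j) A4c A4c) => w.
      by rewrite !mulr1 mulrC.
    apply: nullZ; apply: eq_null (null_psi j (A4_pmx t i) A4c A4c) => w.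
    by rewrite !mulr1.
  have i2 : integ P (fun w => pmx t w i 0 * yhat t w j 0).
    by apply: integ_mul2; [have [] := A4_pmx t i | have [] := A4_yhat t j].
  (* The first-order noise is inserted at no cost, which produces the expression that
     [cross_next_le] bounds pointwise. *)
  rewrite -[mean P (fun w => pmx t w i 0 * _)]addr0 -m1 -meanD// -meanB//; last exact: integD.
  apply: (le_trans (le_mean_norm _ iN _)) => //.
    by apply: integB => //; exact: integD.
  move=> w; rewrite /xhat /yhat hx hy.
  exact: (cross_next_le hF hG hmono hH hlin L1 LHL LFL LGxL LGyL SHL SBFL muFL muGL
    (alpha0 t) (beta0 t) (halpha t) (hbeta t) (hkappa t) muFGL).
have -> : cross_moment t.+1 j = cross_moment t j - alpha t *: (B1 *m cross_moment t j) + e.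
  by rewrite /e [RHS]addrC subrK.
rewrite (le_trans (enormD _ _))//; apply: lerD.
  rewrite (le_trans (B1_contraction hF hmono hlin (alpha0 t) (halpha t) _))//.
  by rewrite le_eqVlt; apply/orP; left; apply/eqP; ring.
rewrite (le_trans (enorm_le_sum _))//.
apply: (@le_trans _ _ (\sum_(i < dx) c * (K * size_const))); first exact: ler_sum.
rewrite sumr_const card_ord -mulr_natl /cross_rate /c le_eqVlt; apply/orP; left; apply/eqP; ring.
Qed.

(** Lets a constant initial value be absorbed by the scales: for [alpha_0 <= 1] the power is at
    least [alpha_0^2], otherwise it is at least 1. *)
Let alpha0_pow (c : R) : 0 <= c <= 1 -> 1 <= L * alpha 0 `^ (1 + c).
Proof.
move=> /andP[c0 c1]; have := alpha0 0; have [h|h] := leP (alpha 0) 1 => al0.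
  apply: (le_trans alpha0_sqr); rewrite ler_wpM2l// -powR_mulrn ?(ltW al0)//.
  by rewrite ger_powR ?al0//; lra.
have : 1 <= alpha 0 `^ (1 + c).
  by rewrite (le_trans (ltW h))// le1r_powR ?(ltW h)//; lra.
by move=> h1; rewrite -[leLHS]mul1r; apply: ler_pM.
Qed.

Let deltaF2 : 0 <= deltaF / 2 <= 1.
Proof. by have [_ /andP[d0 d1] _ _ _] := hlin; apply/andP; split; lra. Qed.

Let deltaG1 : 0 <= deltaG <= 1.
Proof. by have [_ _ /andP[d0 d1] _ _] := hlin; rewrite ltW. Qed.

(** 16/7 is 2 divided by the 7/8 of [B1_contraction]. *)
Definition cross_const : R := 16 / 7 * (cross_rate / muF) + L ^+ 3.

Let cross_rate_ge0 : 0 <= cross_rate.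
Proof. by rewrite /cross_rate; have := ltW K0; have := size_const_ge0; move: size_const => s ? ?; nneg. Qed.

Let cross_const_ge0 : 0 <= cross_const.
Proof. by rewrite /cross_const; have := cross_rate_ge0; have := ltW muF0 => ? ?; nneg. Qed.

(** Needed at both rates: with [e = muF alpha] for the cross moments and with [e = muG beta] for
    |yhat|^2. *)
Let cross_scale_ratio t (e : R) : 0 <= e <= 1 / 12 -> ratio t <= 1 + e / 16 ->
  muG * beta t <= e -> cross_scale t <= (1 + e / 4) * cross_scale t.+1.
Proof.
move=> he hr hb; rewrite /cross_scale mulrDr lerD ?powR_ratio//.
rewrite (le_trans (beta_ratio t))// ler_wpM2r ?(ltW (beta0 _))// lerD2l.
by move: he => /andP[]; lra.
Qed.

Let L_sqr_le Q : 1 <= L * Q -> L ^+ 2 <= L ^+ 3 * Q.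
Proof. move=> h; rewrite -[leLHS]mulr1 (_ : L ^+ 3 * Q = L ^+ 2 * (L * Q)); last by ring.
by apply: ler_wpM2l => //; nneg. Qed.

Lemma cross_bound t j : enorm (cross_moment t j) <= cross_const * cross_scale t.
Proof.
apply: (@discrete_gronwall _ (fun t => enorm (cross_moment t j)) alpha cross_scale
  (7 / 8 * muF) cross_rate) => {t}//.
- by have := ltW muF0 => ?; nneg.
- have -> : cross_const * (7 / 8 * muF / 2) = cross_rate + L ^+ 3 * (7 / 8 * muF / 2).
    by rewrite /cross_const; field; rewrite gt_eqF.
  by rewrite lerDl; have := ltW muF0 => ?; nneg.
- by move=> t; exact: ltW.
- by move=> t; have [h _ _] := step_small t; lra.
- by move=> t; rewrite /cross_scale addr_ge0 ?powR_ge0// ltW.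
- move=> t; have [h h' h''] := step_small t.
  have mb0 : 0 <= muF * alpha t by rewrite mulr_ge0 ?ltW.
  have mc0 : 0 <= muG * beta t by rewrite mulr_ge0 ?ltW.
  rewrite (le_trans (cross_scale_ratio (e := muF * alpha t) _ (ratio_fast t) _))//; first by rewrite mb0.
    by lra.
  rewrite ler_wpM2r// ?lerD2l; last by lra.
  by rewrite /cross_scale addr_ge0 ?powR_ge0// ltW.
- by move=> t; exact: cross_recursion.
have [hx hy _ _] := hiter.
have -> : cross_moment 0 j = (y0 - ystar) j 0 *: (x0 - H y0).
  apply/matrixP => i k; rewrite ord1 mxE [RHS]mxE.
  rewrite (_ : (fun w => _) = fun=> (x0 - H y0) i 0 * (y0 - ystar) j 0); last first.
    by apply/funext => w; rewrite /xhat /yhat hx hy.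
  by rewrite mean_cst mulrC.
rewrite enormZ; apply: (@le_trans _ _ (L ^+ 2)).
  by rewrite expr2; apply: ler_pM => //; [exact: enorm_ge0 | exact: le_trans (normr_coord_le _ _) yhat0L].
apply: (@le_trans _ _ (L ^+ 3 * cross_scale 0)).
  apply: L_sqr_le; apply: (le_trans (alpha0_pow deltaF2)).
  by rewrite ler_wpM2l// /cross_scale lerDl ltW.
apply: ler_wpM2r; first by rewrite /cross_scale addr_ge0 ?powR_ge0// ltW.
by rewrite /cross_const lerDr; have := cross_rate_ge0; have := ltW muF0 => ? ?; nneg.
Qed.

(** * The second moment of [yhat] *)

Definition slow_scale t : R := alpha t `^ (1 + deltaG) + cross_scale t.
Definition slow_rate : R :=
  2 * (dy%:R * (dx%:R * (L * cross_const))) + 51 * L ^+ 3 * (K * size_const).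

Let integ_b2 t : integ P (fun w => b t w ^+ 2).
Proof.
have [_ lb] := L4_errors t.
by have := integ_mul2 lb lb; apply: eq_integrable => // w _ /=; rewrite expr2.
Qed.

(** The coupling is a linear function of the cross moments, so it inherits their order.
    Cauchy-Schwarz would use only the sizes of [xhat] and [yhat] and leave E |yhat|^2 at order
    [alpha]. *)
Let mean_dotp_B2 t :
  integ P (fun w => dotp (yhat t w) (B2 *m xhat t w)) /\
  - mean P (fun w => dotp (yhat t w) (B2 *m xhat t w)) <=
    dy%:R * (dx%:R * (L * cross_const)) * cross_scale t.
Proof.
have E : (fun w => dotp (yhat t w) (B2 *m xhat t w)) =
    (fun w => \sum_(j < dy) \sum_(i < dx) B2 j i * (xhat t w i 0 * yhat t w j 0)).
  apply/funext => w; apply: eq_bigr => j _; rewrite [(B2 *m _) _ _]mxE mulr_sumr.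
  by apply: eq_bigr => i _; ring.
have i1 j i : integ P (fun w => B2 j i * (xhat t w i 0 * yhat t w j 0)) by exact: integZ.
have i2 j : integ P (fun w => \sum_(i < dx) B2 j i * (xhat t w i 0 * yhat t w j 0)) by exact: integ_sum.
rewrite E; split; first exact: integ_sum.
rewrite mean_sum// -sumrN.
rewrite -mulrA mulr_natl -[X in _ *+ X](card_ord dy) -sumr_const; apply: ler_sum => j _.
rewrite mean_sum// -sumrN.
rewrite -mulrA mulr_natl -[X in _ *+ X](card_ord dx) -sumr_const; apply: ler_sum => i _.
rewrite meanZ// (le_trans (ler_norm _))// normrN normrM -mulrA; apply: ler_pM => //.
  have := normr_coord_le (col i B2) j; rewrite mxE => /le_trans; apply.
  exact: (le_trans (enorm_B2_col hG hlin i)).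
apply: le_trans (cross_bound t j); apply: le_trans (normr_coord_le _ i).
by rewrite mxE.
Qed.

Lemma slow_recursion t : mean P (fun w => b t.+1 w ^+ 2) <=
  (1 - muG * beta t) * mean P (fun w => b t w ^+ 2) + slow_rate * beta t * slow_scale t.
Proof.
have [_ _ hx hy] := hiter.
have be0 := ltW (beta0 t).
pose c := 51 * L ^+ 3 * (beta t * (alpha t `^ (1 + deltaG) + beta t)).
have c0 : 0 <= c.
  by rewrite /c; have := powR_ge0 (alpha t) (1 + deltaG); move: (_ `^ _) => z ?; nneg.
have [iN mN] := S4_noise t c0.
have [iB mB] := mean_dotp_B2 t.
have A4c : A4 t (fun=> 1) := adapted4_cst P (Ft t) 1.
have [i1 m1] : null P (fun w => 2 * beta t * dotp (sm t w) (psi t w)).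
  apply: nullZ; apply: eq_null (null_dotp_psi A4c A4c (A4_sm t)) => w.
  by rewrite !mul1r.
have i2 := integZ (1 - beta t * muG) (integ_b2 t).
have i3 := integZ (2 * beta t) iB.
have i4 := integB i2 i3; have i5 := integB i4 i1.
apply: (le_trans (le_mean (integ_b2 _) (integD i5 iN) _)).
  move=> w; rewrite {1}/b {1}/yhat hy.
  apply: (le_trans (slow_next_sqr_le hF hG hmono hlin L1 LGxL LGyL SBGL muFL muGL
    (alpha0 t) (beta0 t) (halpha t) (hbeta t) (hkappa t) muFGL (x t w) (y t w) (psi t w))).
  rewrite lerD2l -/c -/(S4 t w); apply: ler_wpM2l => //; apply: ler_wpM2l => //.
  by rewrite lerD2r lerDl; nneg.
rewrite meanD// meanB// m1 subr0 meanB// meanZ// meanZ// [beta t * muG]mulrC -addrA lerD2l.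
have h1 := ler_wpM2l be0 mB.
have := le_trans mN (lexx _); rewrite /c.
have s0 : 0 <= cross_scale t by rewrite /cross_scale addr_ge0 ?powR_ge0.
rewrite /slow_rate /slow_scale => h2.
have p0 : 0 <= alpha t `^ (1 + deltaG) by exact: powR_ge0.
have pF0 : 0 <= alpha t `^ (1 + deltaF / 2) by exact: powR_ge0.
have n1 : 0 <= beta t * (dy%:R * (dx%:R * (L * cross_const))) * (alpha t `^ (1 + deltaG)).
  by move: cross_const cross_const_ge0 => C C0; nneg.
have n2 : 0 <= 51 * L ^+ 3 * (K * size_const) * beta t * alpha t `^ (1 + deltaF / 2).
  by have := ltW K0; move: size_const size_const_ge0 => C C0 ?; nneg.
move: h1 h2 n1 n2; rewrite /cross_scale; move: (alpha t `^ _) (alpha t `^ _) p0 pF0 => *; lra.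
Qed.

Definition slow_const : R := 2 * slow_rate / muG + L ^+ 3.

Let slow_rate_ge0 : 0 <= slow_rate.
Proof.
rewrite /slow_rate; have := ltW K0; move: size_const size_const_ge0 => s s0 ?.
by move: cross_const cross_const_ge0 => C C0; nneg.
Qed.

Let slow_scale_ge0 t : 0 <= slow_scale t.
Proof. by rewrite /slow_scale /cross_scale !addr_ge0 ?powR_ge0// ltW. Qed.

Lemma slow_bound t : mean P (fun w => b t w ^+ 2) <= slow_const * slow_scale t.
Proof.
apply: (@discrete_gronwall _ (fun t => mean P (fun w => b t w ^+ 2)) beta slow_scale
  muG slow_rate) => {t}//.
- exact: ltW.
- by rewrite /slow_const; have := slow_rate_ge0; have := ltW muG0 => ? ?; nneg.
- have -> : slow_const * (muG / 2) = slow_rate + L ^+ 3 * (muG / 2).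
    by rewrite /slow_const; field; rewrite gt_eqF.
  by rewrite lerDl; have := ltW muG0 => ?; nneg.
- by move=> t; exact: ltW.
- by move=> t; have [_ h _] := step_small t; lra.
- move=> t; have [_ h' _] := step_small t.
  have mc0 : 0 <= muG * beta t by rewrite mulr_ge0 ?ltW.
  have he : 0 <= muG * beta t <= 1 / 12 by rewrite mc0.
  apply: (@le_trans _ _ ((1 + muG * beta t / 4) * slow_scale t.+1)).
    rewrite /slow_scale mulrDr; apply: lerD.
      exact: powR_ratio he (ratio_slow t) deltaG1.
    exact: cross_scale_ratio he (ratio_slow t) (lexx _).
  by rewrite ler_wpM2r// lerD2l; lra.
- by move=> t; exact: slow_recursion.
rewrite (_ : (fun w => _) = fun=> enorm (y0 - ystar) ^+ 2); last by apply/funext => w; rewrite b0E.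
rewrite mean_cst; apply: (@le_trans _ _ (L ^+ 2)).
  by rewrite ler_pXn2r ?nnegrE//; exact: enorm_ge0.
apply: (@le_trans _ _ (L ^+ 3 * slow_scale 0)).
  apply: L_sqr_le; apply: (le_trans (alpha0_pow deltaG1)).
  by rewrite ler_wpM2l// /slow_scale lerDl /cross_scale addr_ge0 ?powR_ge0// ltW.
apply: ler_wpM2r => //.
by rewrite /slow_const lerDr; have := slow_rate_ge0; have := ltW muG0 => ? ?; nneg.
Qed.

(** * The bounds at time t + 1 in terms of the steps at time t *)

Lemma fast_second_moment t :
  ('E_P[fun w => (enorm (xhat t.+1 w) ^+ 2)%R] <= ((fast_const + 1) * alpha t)%:E)%E.
Proof.
have [la _] := L4_errors t.+1; have [_ ia] := la; have al0 := alpha0 t.+1.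
have i2 : integ P (fun w => a t.+1 w ^+ 2).
  by have := integ_mul2 la la; apply: eq_integrable => // w _ /=; rewrite expr2.
have ic := integ_cst P (alpha t.+1); have iz := integZ (alpha t.+1)^-1 ia.
rewrite expectation_mean// lee_fin.
apply: (@le_trans _ _ ((fast_const + 1) * alpha t.+1)); last first.
  by apply: ler_wpM2l => //; rewrite addr_ge0.
have := le_mean i2 (integD iz ic); rewrite meanD// mean_cst meanZ// => h.
(* In place of Jensen's inequality, [u^2 <= u^4 / v + v] pointwise with [v = alpha_(t+1)]; the last
   summand accounts for the [+ 1] in the constant. *)
apply: (le_trans (h _)) => [w|].
  move: (a _ w) (alpha t.+1) al0 => u v v0; rewrite -subr_ge0.
  rewrite (_ : _ - _ = v^-1 * ((u ^+ 2 - v / 2) ^+ 2 + 3 / 4 * v ^+ 2)).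
    by have := ltW v0 => ?; nneg.
  by field; rewrite gt_eqF.
rewrite mulrDl mul1r lerD2r mulrC ler_pdivrMr// -mulrA -expr2; exact: fast_bound.
Qed.

Let powR_alpha_le t (c : R) : 0 <= c <= 1 -> alpha t.+1 `^ (1 + c) <= alpha t `^ (1 + c).
Proof.
move=> /andP[c0 _]; rewrite ge0_ler_powR ?nnegrE//; first by rewrite addr_ge0.
- exact: ltW.
- exact: ltW.
Qed.

Let cross_scale_le t : cross_scale t.+1 <= cross_scale t.
Proof. by rewrite /cross_scale lerD// powR_alpha_le. Qed.

Lemma cross_second_moment t :
  snorm (expectation_mx P (fun w => xhat t.+1 w *m (yhat t.+1 w)^T)) <=
  dy%:R * cross_const * cross_scale t.
Proof.
rewrite (le_trans (snorm_le_col _))//.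
rewrite -mulrA mulr_natl -[X in _ *+ X](card_ord dy) -sumr_const; apply: ler_sum => j _.
apply: (@le_trans _ _ (cross_const * cross_scale t.+1)); last exact: ler_wpM2l.
apply: le_trans (cross_bound t.+1 j); rewrite le_eqVlt; apply/orP; left; apply/eqP.
congr enorm; apply/matrixP => i k; rewrite [LHS]mxE [LHS]mxE [RHS]mxE.
rewrite (_ : (fun w => _) = fun w => xhat t.+1 w i 0 * yhat t.+1 w j 0).
  by rewrite expectation_mean.
by apply/funext => w; rewrite [LHS]mxE big_ord1 [_^T _ _]mxE.
Qed.

Lemma slow_second_moment t :
  ('E_P[fun w => (enorm (yhat t.+1 w) ^+ 2)%R] <= (slow_const * slow_scale t)%:E)%E.
Proof.
have := slow_rate_ge0; have := ltW muG0 => ? ?.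
rewrite expectation_mean; last exact: (integ_b2 t.+1).
rewrite lee_fin (le_trans (slow_bound t.+1))//.
apply: ler_wpM2l; first by rewrite /slow_const; nneg.
by rewrite /slow_scale lerD// powR_alpha_le.
Qed.

End moments.

Lemma le_sum_norm (R : realDomainType) (s : seq R) (u : R) :
  u \in s -> u <= \sum_(v <- s) `|v|.
Proof.
by move=> us; rewrite (big_rem u us)/= (le_trans (ler_norm u))// lerDl sumr_ge0.
Qed.

Theorem theorem3p1 (R : realType) (dx dy : nat)
    (LH LF LGx LGy muF muG SH deltaH SBF SBG deltaF deltaG : R)
    (Gamma11 Gamma22 Sigma11 Sigma22 Sigma12 : R)
    (xhat0 : 'cV[R]_dx) (yhat0 : 'cV[R]_dy) (C : R) :
  exists Mx Mxy1 Mxy2 My1 My2 My3 : R,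
    [/\ 0 <= Mx, 0 <= Mxy1 /\ 0 <= Mxy2 & [/\ 0 <= My1, 0 <= My2 & 0 <= My3]] /\
  forall (d : measure_display) (T : measurableType d) (P : probability T R)
    (F : 'cV[R]_dx -> 'cV[R]_dy -> 'cV[R]_dx)
    (G : 'cV[R]_dx -> 'cV[R]_dy -> 'cV[R]_dy)
    (H : 'cV[R]_dy -> 'cV[R]_dx) (ystar : 'cV[R]_dy)
    (B1 : 'M[R]_(dx, dx)) (B2 : 'M[R]_(dy, dx)) (B3 : 'M[R]_(dy, dy))
    (alpha beta : nat -> R)
    (xi : nat -> T -> 'cV[R]_dx) (psi : nat -> T -> 'cV[R]_dy)
    (x0 : 'cV[R]_dx) (y0 : 'cV[R]_dy)
    (x : nat -> T -> 'cV[R]_dx) (y : nat -> T -> 'cV[R]_dy),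
  borel_measurable F -> borel_measurable G ->
  (forall t, measurable_fun setT (xi t : T -> borel 'cV[R]_dx)) ->
  (forall t, measurable_fun setT (psi t : T -> borel 'cV[R]_dy)) ->
  tts_iteration F G alpha beta xi psi x0 y0 x y ->
  lipschitz_FH F H LH LF ->
  nested_lipschitz_G G H ystar LGx LGy ->
  star_strong_monotone F G H ystar muF muG ->
  locally_linear_H H SH deltaH ->
  nested_locally_linear F G H ystar B1 B2 B3 SBF SBG deltaF deltaG ->
  noise_conditions P x0 y0 xi psi Gamma11 Gamma22 Sigma11 Sigma22 Sigma12 ->
  stepsize_conditions dx alpha beta LH LF LGx LGy muF muG deltaF deltaG ->
  x0 - H y0 = xhat0 -> y0 - ystar = yhat0 ->
  contraction_sup muG alpha beta = C ->
  let xhat t w := x t w - H (y t w) in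
  let yhat t w := y t w - ystar in
  forall t,
  [/\ ('E_P[fun w => (enorm (xhat t.+1 w) ^+ 2)%R] <= (Mx * alpha t)%:E)%E,
      snorm (expectation_mx P (fun w => xhat t.+1 w *m (yhat t.+1 w)^T)) <=
        Mxy1 * beta t +
        Mxy2 * alpha t * beta t * (alpha t / beta t) `^ (2 / deltaF) &
      ('E_P[fun w => (enorm (yhat t.+1 w) ^+ 2)%R] <=
        (My1 * beta t +
         My2 * alpha t * beta t * (alpha t / beta t) `^ (2 / deltaF) +
         My3 * alpha t * beta t * (alpha t / beta t) `^ (1 / deltaG))%:E)%E].
Proof.
(* Every quantity that the moment bounds compare with [L] is listed; [2 * C] is there to dominate
   [alpha_0^-2]. *)
pose L : R := 1 + \sum_(v <- [:: LH; LF; LGx; LGy; SH; SBF; SBG; muF^-1; muG^-1;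
  muF / (5 * muG); 20 * LGx ^+ 2 / (muF * muG); 2 * C; enorm xhat0; enorm yhat0]) `|v|.
(* The absolute values are redundant once the hypotheses hold for some instance. *)
pose mx : R := `|fast_const muF muG Gamma11 Gamma22 L + 1|.
pose mxy : R := `|dy%:R * @cross_const _ dx muF muG Gamma11 Gamma22 L|.
pose my : R := `|@slow_const _ dx dy muF muG Gamma11 Gamma22 L|.
have mx0 : 0 <= mx by exact: normr_ge0.
have mxy0 : 0 <= mxy by exact: normr_ge0.
have my0 : 0 <= my by exact: normr_ge0.
(* The factors 2 and 3 count the copies of [beta]: one from the scale itself and one from each power
   of [alpha] converted by [powR_1D_le_ratio]. *)
exists mx, (2 * mxy), mxy, (3 * my), my, my; split.
  by split; [|split; first exact: mulr_ge0|split; first exact: mulr_ge0].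
move=> d T P F G H ystar B1 B2 B3 alpha beta xi psi x0 y0 x y mF mG mxi mpsi hiter hF hG
  hmono hH hlin hnoise hstep hx0 hy0 hC xhat yhat.
have [pos bnd _ _ hprod] := hstep.
have L1 : 1 <= L by rewrite lerDl sumr_ge0.
have leL u : u \in [:: LH; LF; LGx; LGy; SH; SBF; SBG; muF^-1; muG^-1;
    muF / (5 * muG); 20 * LGx ^+ 2 / (muF * muG); 2 * C; enorm xhat0; enorm yhat0] -> u <= L.
  by move=> us; rewrite (le_trans (le_sum_norm us))// lerDr.
have LHL : LH <= L by apply: leL; rewrite !inE eqxx ?orbT.
have LFL : LF <= L by apply: leL; rewrite !inE eqxx ?orbT.
have LGxL : LGx <= L by apply: leL; rewrite !inE eqxx ?orbT.
have LGyL : LGy <= L by apply: leL; rewrite !inE eqxx ?orbT.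
have SHL : SH <= L by apply: leL; rewrite !inE eqxx ?orbT.
have SBFL : SBF <= L by apply: leL; rewrite !inE eqxx ?orbT.
have SBGL : SBG <= L by apply: leL; rewrite !inE eqxx ?orbT.
have muFL : muF^-1 <= L by apply: leL; rewrite !inE eqxx ?orbT.
have muGL : muG^-1 <= L by apply: leL; rewrite !inE eqxx ?orbT.
have muFGL : muF / (5 * muG) <= L by apply: leL; rewrite !inE eqxx ?orbT.
have omegaL : 20 * LGx ^+ 2 / (muF * muG) <= L by apply: leL; rewrite !inE eqxx ?orbT.
have CL : 2 * C <= L by apply: leL; rewrite !inE eqxx ?orbT.
have xhat0L : enorm (x0 - H y0) <= L by rewrite hx0; apply: leL; rewrite !inE eqxx ?orbT.
have yhat0L : enorm (y0 - ystar) <= L by rewrite hy0; apply: leL; rewrite !inE eqxx ?orbT.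
have alpha0L : (alpha 0 ^+ 2)^-1 <= L.
  apply: le_trans CL; rewrite -hC; apply: alpha0_inv_sqr_le => [t||//]; first by have [] := pos t.
  by have [_ hb _ _] := bnd 0; have [+ _] := step_beta hG hmono hb; lra.
have [_ /andP[dF0 dF1] dG _ _] := hlin.
move=> t; have [a0 b0] := pos t.
have hcs : cross_scale deltaF alpha beta t <=
    2 * beta t + alpha t * beta t * (alpha t / beta t) `^ (2 / deltaF).
  (* The conversion is applied with exponent [deltaF / 2], whose inverse is the [2 / deltaF] of the
     statement. *)
  have dF2 : 0 < deltaF / 2 <= 1 by apply/andP; split; lra.
  have := powR_1D_le_ratio a0 b0 dF2; rewrite /cross_scale invf_div; lra.
split.
- apply: (le_trans (fast_second_moment mF mG mxi mpsi hiter hF hG hmono hH hlin hnoise hstep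
    L1 LHL LFL LGxL LGyL SHL muFL muGL muFGL omegaL alpha0L xhat0L yhat0L t)).
  by rewrite lee_fin ler_wpM2r ?(ltW a0)// ler_norm.
- apply: (le_trans (cross_second_moment mF mG mxi mpsi hiter hF hG hmono hH hlin hnoise hstep
    L1 LHL LFL LGxL LGyL SHL SBFL muFL muGL muFGL omegaL alpha0L xhat0L yhat0L t)).
  have s0 : 0 <= cross_scale deltaF alpha beta t by rewrite /cross_scale addr_ge0 ?powR_ge0// ltW.
  apply: (@le_trans _ _ (mxy * cross_scale deltaF alpha beta t)).
    by rewrite ler_wpM2r// ler_norm.
  by have := ler_wpM2l mxy0 hcs; lra.
apply: (le_trans (slow_second_moment mF mG mxi mpsi hiter hF hG hmono hH hlin hnoise hstep
  L1 LHL LFL LGxL LGyL SHL SBFL SBGL muFL muGL muFGL omegaL alpha0L xhat0L yhat0L t)).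
rewrite lee_fin.
have s0 : 0 <= slow_scale deltaF deltaG alpha beta t.
  by rewrite /slow_scale /cross_scale !addr_ge0 ?powR_ge0// ltW.
apply: (@le_trans _ _ (my * slow_scale deltaF deltaG alpha beta t)).
  by rewrite ler_wpM2r// ler_norm.
have hss : slow_scale deltaF deltaG alpha beta t <= 3 * beta t +
    alpha t * beta t * (alpha t / beta t) `^ (2 / deltaF) +
    alpha t * beta t * (alpha t / beta t) `^ (1 / deltaG).
  by have := powR_1D_le_ratio a0 b0 dG; rewrite /slow_scale [1 / deltaG]mul1r; lra.
by have := ler_wpM2l my0 hss; lra.
Qed.
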